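(* Let $n,m,p$ be positive integers and let $\mathscr{M}$ be a bounded subset of $M_n(\mathbb{R})\times M_{n,m}(\mathbb{R})\times M_{p,n}(\mathbb{R})$. For $\tau\ge0$ consider the switched linear control system $\dot x=A(t)x+B(t)u$, $y=C(t)x$, where $(A,B,C)$ belongs to the class $\mathcal{S}^{{\rm d},\tau}(\mathscr{M})$ of piecewise constant signals with dwell-time $\tau$, and let $\gamma_2(\tau)$ be the $L_2$-gain associated with $\mathcal{S}^{{\rm d},\tau}(\mathscr{M})$. Consider a minimal realization on $\mathbb{R}^{n'}$, $n'\le n$, associated with the classes $\mathcal{S}^{{\rm d},\tau}(\mathscr{M}^{\rm min})$, where $\mathscr{M}^{\rm min}$ is a bounded subset of $M_{n'}(\mathbb{R})\times M_{n',m}(\mathbb{R})\times M_{p,n'}(\mathbb{R})$. Then: (i) for every $\tau\ge0$ such that $\mathcal{S}^{{\rm d},\tau}(\mathscr{M}^{\rm min})$ is uniformly observable, $\gamma_2(\tau)$ is finite if and only if $\rho(\mathcal{S}^{{\rm d},\tau}(\mathscr{M}^{\rm min}_A))<1$; (ii) if $\mathcal{S}^{{\rm d},\tau}(\mathscr{M}^{\rm min})$ is uniformly observable for every $\tau>0$, then $\tau_{\min}:=\inf\{\tau>0\mid\gamma_2(\tau)\text{ is finite}\}$ satisfies $$\tau_{\min}=\inf\{\tau>0\mid\rho(\mathcal{S}^{{\rm d},\tau}(\mathscr{M}^{\rm min}_A))<1\}.$$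
   Context: A signal on $[0,\infty)$ is piecewise constant if on every finite interval it has finitely many discontinuities and takes finitely many values. $\mathcal{S}^{{\rm d},\tau}(\mathscr{N})$ is, for $\tau>0$, the class of piecewise constant $\mathscr{N}$-valued signals on $[0,\infty)$ such that the distance between any two switching times is at least $\tau$; for $\tau=0$ it is the class of all piecewise constant $\mathscr{N}$-valued signals. The $L_2$-gain of a class $\mathcal{T}$ of switching laws is $\gamma_2(\mathcal{T})=\sup\{\|y_{u,\sigma}\|_2/\|u\|_2\mid u\in L_2([0,\infty),\mathbb{R}^m)\setminus\{0\},\ \sigma\in\mathcal{T}\}\in[0,\infty]$, where $y_{u,\sigma}$ is the output for $x(0)=0$. $\Phi_A(t,s)$ is the flow (fundamental matrix) of $\dot x=A(\cdot)x$ from time $s$ to $t$. For a class $\mathcal{S}$ of matrix-valued signals with values in a bounded set, $\rho(\mathcal{S})=\limsup_{t\to+\infty}\sup_{A\in\mathcal{S}}\|\Phi_A(t,0)\|^{1/t}$. $\mathscr{M}^{\rm min}_A=\{A\mid(A,B,C)\in\mathscr{M}^{\rm min}\}$. Minimal realization. Let $\mathcal{V}(\mathscr{M})$ be the smallest subspace of $\mathbb{R}^n$ containing the ranges of all $B$, $(A,B,C)\in\mathscr{M}$, and invariant under all $A$, $(A,B,C)\in\mathscr{M}$; let $r$ be its dimension. Choose an invertible $P$ whose first $r$ columns span $\mathcal{V}(\mathscr{M})$ and put $\Pi^c(A,B,C)=(UP^{-1}APU^T,UP^{-1}B,CPU^T)$, $U=(\mathrm{Id}_r\ 0)$. For $\mathscr{M}^c=\Pi^c(\mathscr{M})$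 let $N\subset\mathbb{R}^r$ be the largest subspace contained in $\ker C$ for all $(A,B,C)\in\mathscr{M}^c$ and invariant under all $A$, $(A,B,C)\in\mathscr{M}^c$; let $n'=r-\dim N$. Choose an invertible $Q\in M_r(\mathbb{R})$ whose last $r-n'$ columns span $N$ and put $\Pi^o(A,B,C)=(VQ^{-1}AQV^T,VQ^{-1}B,CQV^T)$, $V=(\mathrm{Id}_{n'}\ 0)$. With $\Pi=\Pi^o\circ\Pi^c$ and $\mathscr{M}^{\rm min}=\Pi(\mathscr{M})$, the system on $\mathbb{R}^{n'}$ associated with $\mathcal{S}^{{\rm d},\tau}(\mathscr{M}^{\rm min})$ is called a minimal realization of the system associated with $\mathcal{S}^{{\rm d},\tau}(\mathscr{M})$. Uniform observability. A class $\mathcal{T}$ of switching laws $(A,B,C)$ on $\mathbb{R}^{n'}$ is uniformly observable if there exist $T,\gamma>0$ such that for every $(A,B,C)\in\mathcal{T}$ and every $t\ge0$, $\int_t^{t+T}\Phi_A(s,t)^TC(s)^TC(s)\Phi_A(s,t)\,ds\ge\gamma\,\mathrm{Id}_{n'}$. *)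

(* Defs.v *)
From mathcomp Require Import all_boot all_order all_algebra.
From mathcomp Require Import all_classical all_reals all_analysis.

Set Implicit Arguments.
Unset Strict Implicit.
Unset Printing Implicit Defensive.

Import Order.TTheory GRing.Theory Num.Theory.
Import numFieldNormedType.Exports.

Local Open Scope classical_set_scope.
Local Open Scope ring_scope.

Section norms_and_integrals.
Context {R : realType}.
Local Notation mu := (@lebesgue_measure R).

(* Signals, inputs and outputs are total functions on R, of which only the
   restriction to [time] is meaningful. *)
Definition time : set R := `[0, +oo[.

Definition enorm k (v : 'cV[R]_k) : R := Num.sqrt (\sum_i v i ord0 ^+ 2).

Definition opnorm k l (X : 'M[R]_(k, l)) : R :=
  sup [set enorm (X *m v) | v in [set v | enorm v <= 1]].

Definition mx_integrable k l (D : set R) (F : R -> 'M[R]_(k, l)) : Prop :=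
  forall i j, mu.-integrable D (fun t => (F t i j)%:E).

Definition mx_integral k l (D : set R) (F : R -> 'M[R]_(k, l)) : 'M[R]_(k, l) :=
  \matrix_(i, j) Rintegral mu D (fun t => F t i j).

Definition mx_psd_le k (X Y : 'M[R]_k) : Prop :=
  forall v : 'cV[R]_k,
    (v^T *m X *m v) ord0 ord0 <= (v^T *m Y *m v) ord0 ord0.

Definition L2norm k (f : R -> 'cV[R]_k) : \bar R :=
  ('N[mu]_(2%:E) [ (fun t => (enorm (f t))%:E) \_ time ])%E.

Definition L2_signal k (f : R -> 'cV[R]_k) : Prop :=
  (forall i, measurable_fun time (fun t => f t i ord0)) /\
  (L2norm f < +oo)%E.

(* Supremum in [0, +oo], so that the empty set has supremum 0. *)
Definition sup_nng (E : set (\bar R)) : \bar R := ereal_sup ([set 0%E] `|` E).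

End norms_and_integrals.

Section signals.
Context {R : realType} {T : topologicalType}.

(* Continuity is relative to [0, +oo[, i.e., one-sided at 0. *)
Definition switching_times (sigma : R -> T) : set R :=
  [set t | time t /\ ~ (sigma @ within time (nbhs t) --> sigma t)].

Definition piecewise_constant (sigma : R -> T) : Prop :=
  forall a b : R,
    finite_set (switching_times sigma `&` `[a, b]) /\
    finite_set (sigma @` (time `&` `[a, b])).

(* For tau = 0 the dwell-time condition is void. *)
Definition dwell_signals (tau : R) (N : set T) : set (R -> T) :=
  [set sigma | [/\ piecewise_constant sigma,
                   forall t, time t -> N (sigma t)
                 & forall s t, switching_times sigma s ->
                     switching_times sigma t -> s != t -> tau <= `|s - t|]].

End signals.

Section differential_equations.
Context {R : realType}.

(* Caratheodory solutions on [t0, +oo[ of x' = f(t, x), x(t0) = x0: the inputs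
   are merely L2, so x is only absolutely continuous. *)
Definition is_solution k l (f : R -> 'M[R]_(k, l) -> 'M[R]_(k, l))
    (t0 : R) (x0 : 'M[R]_(k, l)) (x : R -> 'M[R]_(k, l)) : Prop :=
  forall t, t0 <= t ->
    mx_integrable `[t0, t] (fun s => f s (x s)) /\
    x t = x0 + mx_integral `[t0, t] (fun s => f s (x s)).

(* For the linear equations below (piecewise constant coefficients, locally
   integrable forcing term) a solution exists and is unique on [t0, +oo[. *)
Definition solution k l (f : R -> 'M[R]_(k, l) -> 'M[R]_(k, l))
    (t0 : R) (x0 : 'M[R]_(k, l)) : R -> 'M[R]_(k, l) :=
  get [set x | is_solution f t0 x0 x].

(* [flow A t s] is the flow from time s to time t, for t >= s >= 0. *)
Definition flow k (A : R -> 'M[R]_k) (t s : R) : 'M[R]_k :=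
  solution (fun r X => A r *m X) s 1%:M t.

Definition rho k (S : set (R -> 'M[R]_k)) : \bar R :=
  limf_esup
    (fun t : R =>
       sup_nng [set (opnorm (flow A t 0) `^ t^-1)%:E | A in S])
    (pinfty_nbhs R).

End differential_equations.

Section linear_systems.
Context {R : realType}.

Definition system n m p : Type :=
  ('M[R]_n * 'M[R]_(n, m) * 'M[R]_(p, n))%type.

Definition mxA n m p (S : system n m p) : 'M[R]_n := S.1.1.
Definition mxB n m p (S : system n m p) : 'M[R]_(n, m) := S.1.2.
Definition mxC n m p (S : system n m p) : 'M[R]_(p, n) := S.2.

Definition state n m p (sigma : R -> system n m p) (u : R -> 'cV[R]_m) :
    R -> 'cV[R]_n :=
  solution (fun t x => mxA (sigma t) *m x + mxB (sigma t) *m u t) 0 0.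

Definition output n m p (sigma : R -> system n m p) (u : R -> 'cV[R]_m) :
    R -> 'cV[R]_p :=
  fun t => mxC (sigma t) *m state sigma u t.

(* [L2norm u != 0] says that u is nonzero as an element of L2. *)
Definition L2_gain n m p (T : set (R -> system n m p)) : \bar R :=
  sup_nng [set g | exists u sigma,
    [/\ L2_signal u, L2norm u != 0%E, T sigma
      & g = (L2norm (output sigma u) / L2norm u)%E]].

Definition uniformly_observable n m p (T : set (R -> system n m p)) : Prop :=
  exists T0 gamma : R, [/\ 0 < T0, 0 < gamma &
    forall sigma, T sigma -> forall t, 0 <= t ->
      mx_psd_le (gamma%:M)
        (mx_integral `[t, t + T0] (fun s =>
           let Phi := flow (fun r => mxA (sigma r)) s t in
           Phi^T *m (mxC (sigma s))^T *m mxC (sigma s) *m Phi))].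

Definition A_invariant n m p (M : set (system n m p))
    (W : {vspace 'cV[R]_n}) : Prop :=
  forall S, M S -> forall v, v \in W -> mxA S *m v \in W.

Definition contains_ranges n m p (M : set (system n m p))
    (W : {vspace 'cV[R]_n}) : Prop :=
  forall S, M S -> forall w : 'cV[R]_m, mxB S *m w \in W.

Definition in_kernels n m p (M : set (system n m p))
    (W : {vspace 'cV[R]_n}) : Prop :=
  forall S, M S -> forall v, v \in W -> mxC S *m v = 0.

Definition controllable_space n m p (M : set (system n m p))
    (V : {vspace 'cV[R]_n}) : Prop :=
  [/\ contains_ranges M V, A_invariant M V
    & forall W : {vspace 'cV[R]_n},
        contains_ranges M W -> A_invariant M W -> (V <= W)%VS].

Definition unobservable_space n m p (M : set (system n m p))
    (N : {vspace 'cV[R]_n}) : Prop :=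
  [/\ in_kernels M N, A_invariant M N
    & forall W : {vspace 'cV[R]_n},
        in_kernels M W -> A_invariant M W -> (W <= N)%VS].

(* (A, B, C) |-> (U P^-1 A P U^T, U P^-1 B, C P U^T) with U = (Id_k 0). *)
Definition truncate n m p k (P : 'M[R]_n) (S : system n m p) : system k m p :=
  let U : 'M[R]_(k, n) := pid_mx k in
  (U *m invmx P *m mxA S *m P *m U^T,
   U *m invmx P *m mxB S,
   mxC S *m P *m U^T).

(* The realization depends on the choice of P and Q; this relation holds
   for every admissible choice. *)
Definition minimal_realization n m p (M : set (system n m p))
    n' (Mmin : set (system n' m p)) : Prop :=
  exists (V : {vspace 'cV[R]_n}) (P : 'M[R]_n),
    let r := \dim V in
    let Mc : set (system r m p) := truncate r P @` M in
    [/\ controllable_space M V, P \in unitmx,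
        (\sum_(j < n | (j < r)%N) <[col j P]>)%VS = V
      & exists (N : {vspace 'cV[R]_r}) (Q : 'M[R]_r),
        [/\ unobservable_space Mc N, n' = (r - \dim N)%N, Q \in unitmx,
            (\sum_(j < r | (n' <= j)%N) <[col j Q]>)%VS = N
          & Mmin = truncate n' Q @` Mc]].

End linear_systems.

Arguments system : clear implicits.

(* Main.v *)
(** Passing to the minimal realization intertwines the states and keeps the
    outputs, hence the L2-gain. If rho < 1, the flow contracts by 1/2 over
    some time T, uniformly over the class; chaining windows of length T bounds
    the output energy by the input energy.

    Conversely, suppose that the gain is finite, and consider the vectors v for
    which the free output from v has energy bounded uniformly over the signals
    without switching before time tau. They form a subspace. It is invariant
    under exp(tA), t > tau, because such a signal may be preceded by a constant
    one, hence under every A by differentiating in t. It contains the states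
    reached from 0 under a constant signal, whose subsequent output energy the
    gain bounds by that of the input, hence the ranges of all B. By
    controllability it is the whole space, and in finite dimension the bound is
    uniform in v. Uniform observability bounds the state at the
    start of a window by the output energy on the window, and the state at the
    end of many windows is bounded by the state at the start of each: summing
    over the windows gives a uniform contraction, i.e., rho < 1. *)

From HB Require Import structures.
Require Import Defs.
From mathcomp Require Import all_boot all_order all_algebra.
From mathcomp Require Import all_classical all_reals all_analysis.
From mathcomp Require Import measurable_realfun ring lra.
Import Order.TTheory GRing.Theory Num.Theory.
Import numFieldNormedType.Exports.
Set Implicit Arguments.
Unset Strict Implicit.
Unset Printing Implicit Defensive.
Local Open Scope classical_set_scope.
Local Open Scope ring_scope.

(** * Integrals over segments *)

Section segment_integrals.
Context {R : realType}.
Local Notation mu := (@lebesgue_measure R).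
Implicit Types (f g : R -> R) (a b c t : R).
Local Notation int a b f := (Rintegral mu `[a, b] f).
Local Notation itg a b f := (mu.-integrable `[a, b] (EFin \o f)).

(** Inputs are only square integrable, so states are treated as solutions of integral equations with
    bounded measurable coefficients. Constants are never sharp: only finiteness of the gain and some
    contraction factor matter, which permits crude norm equivalences and a Gronwall bound with
    doubled rate.

    The obstacle in the converse is that dwell time restricts concatenation. In general a constant
    piece can precede a signal only if the signal has no switch in ]0, tau[, and the result has this
    property again only if the piece lasts at least tau. Hence the condition t > tau, the initial
    wait of at most tau before the energy bound applies to an arbitrary signal, and the two margins
    tau in the length of the contracting window.

    As exp(tA) is available only for t > tau, it cannot be differentiated at t = 0. Invertibility of
    the flow makes up for this: exp(tA) maps the subspace onto itself, so each of its vectors is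
    exp(tA)x with x in the subspace, and the derivative is taken there, at an interior time. For a
    reached state x the derivative is Ax + Bw, so invariance under A has to come before the ranges
    of B. *)

Lemma integrable_sub_segment f a b a' b' : a <= a' -> b' <= b ->
  itg a b f -> itg a' b' f.
Proof.
move=> aa bb; apply: integrableS => //.
by move=> x /=; rewrite !in_itv/= => /andP[? ?]; apply/andP; split; lra.
Qed.

Lemma Rintegral_chasles f a b c : a <= b -> b <= c -> itg a c f ->
  int a c f = int a b f + int b c f.
Proof.
move=> ab bc fi.
have := @Rintegral_itvB R f (BLeft a) (BRight c) b fi.
rewrite !bnd_simp => /(_ ab bc); rewrite Rintegral_itv_obnd_cbnd; first by lra.
apply: integrableS fi => // x /=; rewrite !in_itv/= => /andP[? ?].
by apply/andP; split; lra.
Qed.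

Lemma bounded_integrable_segment f a b (K : R) : measurable_fun `[a, b] f ->
  (forall t, t \in `[a, b] -> `|f t| <= K) -> itg a b f.
Proof.
move=> mf fK; apply: measurable_bounded_integrable => //.
  exact: compact_finite_measure (@segment_compact _ a b).
exists K; split; first exact: num_real.
by move=> x Kx t /= tab; apply: le_trans (ltW Kx); apply: fK.
Qed.

Lemma Rintegral_cst_segment (K a b : R) : a <= b ->
  int a b (fun=> K) = K * (b - a).
Proof.
move=> ab; rewrite Rintegral_cst//.
rewrite (_ : fine _ = b - a)//.
apply: (etrans (congr1 fine (lebesgue_measure_itv `[a, b]))).
rewrite /= lte_fin.
by case: ltgtP ab => // -> _; rewrite subrr.
Qed.

Lemma Rintegral_sum (I : Type) (r : seq I) (F : I -> R -> R) (D : set R) :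
  measurable D -> (forall i, mu.-integrable D (EFin \o F i)) ->
  Rintegral mu D (fun x => \sum_(i <- r) F i x) =
  \sum_(i <- r) Rintegral mu D (F i).
Proof.
move=> mD Fi; elim: r => [|i r IH].
  under eq_Rintegral do rewrite big_nil.
  by rewrite big_nil Rintegral_cst// mul0r.
under eq_Rintegral do rewrite big_cons.
rewrite big_cons RintegralD//; first by rewrite IH.
have -> : (EFin \o fun x => \sum_(j <- r) F j x) =
  (fun x => \sum_(j <- r) (F j x)%:E)%E by apply/funext => x /=; rewrite sumEFin.
by apply: integrable_sum => // j _; exact: Fi.
Qed.

Lemma integrable_sumR (I : Type) (r : seq I) (F : I -> R -> R) (D : set R) :
  measurable D -> (forall i, mu.-integrable D (EFin \o F i)) ->
  mu.-integrable D (EFin \o (fun x => \sum_(i <- r) F i x)).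
Proof.
move=> mD Fi.
have -> : (EFin \o fun x => \sum_(j <- r) F j x) =
  (fun x => \sum_(j <- r) (F j x)%:E)%E by apply/funext => x /=; rewrite sumEFin.
by apply: integrable_sum => // j _; exact: Fi.
Qed.

Lemma Rintegral_expR (c a s t : R) : s <= t ->
  int s t (fun r => c * expR (c * (r - a))) =
  expR (c * (t - a)) - expR (c * (s - a)).
Proof.
rewrite le_eqVlt => /predU1P[<-|st].
  by rewrite set_itv1 Rintegral_set1 subrr.
have dE (x : R) : is_derive x 1 (fun r : R => expR (c * (r - a))) (c * expR (c * (x - a))).
  apply: is_derive_eq.
  by rewrite /GRing.scale/=; ring.
have cE (h : R -> R) : (forall x : R, derivable h x 1) -> continuous h.
  by move=> dh x; apply/differentiable_continuous/derivable1_diffP.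
have cE1 : continuous (fun r : R => expR (c * (r - a))).
  by apply: cE => x; apply: ex_derive.
rewrite /Rintegral (@continuous_FTC2 _ _ (fun r => expR (c * (r - a))))//=.
- by apply: continuous_subspaceT => x; apply: cvgM; [exact: cvg_cst|exact: cE1].
- split; first by move=> x _; apply: ex_derive.
  + by apply: cvg_at_right_filter; exact: cE1.
  + by apply: cvg_at_left_filter; exact: cE1.
- by move=> x _; rewrite derive1E; apply: derive_val.
Qed.

(** Translation invariance, from the uniqueness of a measure that gives half-open intervals their
    length. It underlies the restart of a signal at a later time. *)
Lemma lebesgue_measure_shift (c : R) (A : set R) : measurable A ->
  pushforward mu (+%R^~ c : R -> measurableTypeR R) A = mu A.
Proof.
have mf : measurable_fun setT (+%R^~ c : R -> measurableTypeR R).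
  exact: measurable_funD.
pose F : {mfun R >-> measurableTypeR R} := HB.pack (+%R^~ c : R -> measurableTypeR R) (isMeasurableFun.Build _ _ _ _ _ mf).
move=> mA; rewrite -/(F : R -> measurableTypeR R).
apply/esym/(@lebesgue_measure_unique R (pushforward mu F)) => //= _ [[a b]] _ <-.
rewrite /pushforward.
have -> : (+%R^~ c) @^-1` `]a, b]%classic = `]a - c, b - c]%classic.
  by apply/seteqP; split=> x /=; rewrite !in_itv/= => /andP[? ?]; apply/andP; split; lra.
rewrite !lebesgue_measure_itv/= !lte_fin ltrD2r.
by case: ifP => // _; rewrite -!EFinB; congr EFin; ring.
Qed.

Lemma ge0_integral_shift (c : R) (D : set R) (g : R -> \bar R) :
  measurable D -> measurable_fun D g -> (forall x, 0 <= g x)%E ->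
  (\int[mu]_(y in D) g y = \int[mu]_(x in +%R^~ c @^-1` D) g (x + c)%R)%E.
Proof.
move=> mD mg g0.
have mf : measurable_fun setT (+%R^~ c : R -> measurableTypeR R).
  exact: measurable_funD.
rewrite -(@ge0_integral_pushforward _ _ (measurableTypeR R) (measurableTypeR R) R _ mf mu D g)//.
by apply: eq_measure_integral => A mA _; apply/esym/lebesgue_measure_shift.
Qed.

Lemma preimage_shift_segment (c a b : R) :
  +%R^~ c @^-1` `[a + c, b + c]%classic = `[a, b]%classic.
Proof.
by apply/seteqP; split=> x /=; rewrite !in_itv/= => /andP[? ?]; apply/andP; split; lra.
Qed.

(** Only measurability is assumed and the integrals are extended-valued, so the identity also
    applies to the absolute value of a function whose shift is still to be proved integrable. *)
Lemma integral_shift (c a b : R) (f : R -> R) :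
  measurable_fun `[a + c, b + c] f ->
  (\int[mu]_(x in `[a, b]) (f (x + c)%R)%:E =
   \int[mu]_(x in `[(a + c)%R, (b + c)%R]) (f x)%:E)%E.
Proof.
move=> mf; rewrite [LHS]integralE [RHS]integralE; congr (_ - _)%E.
- have := @ge0_integral_shift c `[a + c, b + c]%classic ((fun x => (f x)%:E)^\+)%E.
  rewrite preimage_shift_segment => -> //.
    by apply: eq_integral => x _; rewrite !funeposE.
  by apply: measurable_funepos; apply/measurable_EFinP.
- have := @ge0_integral_shift c `[a + c, b + c]%classic ((fun x => (f x)%:E)^\-)%E.
  rewrite preimage_shift_segment => -> //.
    by apply: eq_integral => x _; rewrite !funenegE.
  by apply: measurable_funeneg; apply/measurable_EFinP.
Qed.

Lemma measurable_fun_shift (c a b : R) (f : R -> R) :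
  measurable_fun `[a + c, b + c] f ->
  measurable_fun `[a, b] (fun x => f (x + c)).
Proof.
move=> mf; apply: (measurable_comp (F := `[a + c, b + c]%classic)) => //.
  by move=> _ [x + <-]; rewrite -(preimage_shift_segment c).
exact: measurable_funD.
Qed.

Lemma Rintegral_shift (c a b : R) f : itg (a + c) (b + c) f ->
  int a b (fun t => f (t + c)) = int (a + c) (b + c) f.
Proof.
move=> /integrableP[/measurable_EFinP mf _].
by rewrite /Rintegral integral_shift.
Qed.

Lemma integrable_shift (c a b : R) f : itg (a + c) (b + c) f ->
  itg a b (fun t => f (t + c)).
Proof.
move=> /integrableP[/measurable_EFinP mf foo]; apply/integrableP; split.
  by apply/measurable_EFinP; exact: measurable_fun_shift.
have := @integral_shift c a b (fun x => `|f x|); rewrite /= => ->//.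
exact: measurableT_comp.
Qed.

End segment_integrals.

(** * The entrywise sum norm of matrices *)

Section norm1.
Context {R : realType}.

(** Submultiplicative, and compared with integrals entry by entry: the norm of a matrix-valued
    integral is bounded without any convexity argument. *)
Definition norm1 k l (X : 'M[R]_(k, l)) : R := \sum_i \sum_j `|X i j|.

Lemma norm1_ge0 k l (X : 'M[R]_(k, l)) : 0 <= norm1 X.
Proof. by apply: sumr_ge0 => i _; apply: sumr_ge0. Qed.

Lemma norm1_entry k l (X : 'M[R]_(k, l)) i j : `|X i j| <= norm1 X.
Proof.
rewrite /norm1 (bigD1 i)//= (bigD1 j)//= -addrA lerDl addr_ge0//.
  exact: sumr_ge0.
by apply: sumr_ge0 => ? _; apply: sumr_ge0.
Qed.

Lemma norm10 k l : norm1 (0 : 'M[R]_(k, l)) = 0.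
Proof. by rewrite /norm1 big1// => i _; rewrite big1// => j _; rewrite mxE normr0. Qed.

Lemma norm1_eq0 k l (X : 'M[R]_(k, l)) : norm1 X <= 0 -> X = 0.
Proof.
move=> X0; apply/matrixP => i j; rewrite mxE; apply/normr0_eq0/le_anti.
by rewrite normr_ge0 (le_trans (norm1_entry _ _ _) X0).
Qed.

Lemma norm1D k l (X Y : 'M[R]_(k, l)) : norm1 (X + Y) <= norm1 X + norm1 Y.
Proof.
rewrite /norm1 -big_split/=; apply: ler_sum => i _.
by rewrite -big_split/=; apply: ler_sum => j _; rewrite mxE ler_normD.
Qed.

Lemma norm1N k l (X : 'M[R]_(k, l)) : norm1 (- X) = norm1 X.
Proof. by apply: eq_bigr => i _; apply: eq_bigr => j _; rewrite mxE normrN. Qed.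

Lemma norm1M k l h (X : 'M[R]_(k, l)) (Y : 'M[R]_(l, h)) :
  norm1 (X *m Y) <= norm1 X * norm1 Y.
Proof.
rewrite /norm1 mulr_suml; apply: ler_sum => i _.
apply: (@le_trans _ _ (\sum_j \sum_q `|X i q| * `|Y q j|)).
  apply: ler_sum => j _; rewrite mxE; apply: le_trans (ler_norm_sum _ _ _) _.
  by apply: ler_sum => q _; rewrite normrM.
rewrite exchange_big/= mulr_suml; apply: ler_sum => q _.
rewrite -mulr_sumr ler_wpM2l// [leRHS](bigD1 q)//= lerDl.
by apply: sumr_ge0 => ? _; apply: sumr_ge0.
Qed.
End norm1.

(** * Integrals of matrix-valued functions *)

Section matrix_integrals.
Context {R : realType}.
Local Notation mu := (@lebesgue_measure R).
Implicit Types (a b c t : R).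
Local Notation int a b f := (Rintegral mu `[a, b] f).
Local Notation itg a b f := (mu.-integrable `[a, b] (EFin \o f)).

Definition mx_measurable k l (D : set R) (F : R -> 'M[R]_(k, l)) :=
  forall i j, measurable_fun D (fun t => F t i j).

Lemma mx_integrable_measurable k l D (F : R -> 'M[R]_(k, l)) :
  mx_integrable D F -> mx_measurable D F.
Proof. by move=> Fi i j; have /integrableP[/measurable_EFinP] := Fi i j. Qed.

Lemma mx_integrable_sub k l (F : R -> 'M[R]_(k, l)) a b a' b' :
  a <= a' -> b' <= b -> mx_integrable `[a, b] F -> mx_integrable `[a', b'] F.
Proof. by move=> aa bb Fi i j; apply: integrable_sub_segment (Fi i j). Qed.

Lemma eq_mx_integrable k l (D : set R) (F G : R -> 'M[R]_(k, l)) :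
  measurable D ->
  (forall t, D t -> F t = G t) -> mx_integrable D F -> mx_integrable D G.
Proof.
move=> mD FG Fi i j; apply: eq_integrable (Fi i j) => // t /set_mem Dt.
by rewrite FG.
Qed.

Lemma eq_mx_integral k l (D : set R) (F G : R -> 'M[R]_(k, l)) :
  (forall t, D t -> F t = G t) -> mx_integral D F = mx_integral D G.
Proof.
move=> FG; apply/matrixP => i j; rewrite !mxE; apply: eq_Rintegral => t /set_mem Dt.
by rewrite FG.
Qed.

Section measurable_domain.
Variable D : set R.
Hypothesis mD : measurable D.

Lemma mx_integrable0 k l : mx_integrable D (fun=> 0 : 'M[R]_(k, l)).
Proof.
move=> i j; rewrite (_ : (fun _ => _) = cst 0%E); first exact: integrable0.
by apply/funext => t; rewrite mxE.
Qed.

Lemma mx_integral0 k l : mx_integral D (fun=> 0 : 'M[R]_(k, l)) = 0.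
Proof.
apply/matrixP => i j; rewrite !mxE.
by rewrite Rintegral_cst// mul0r.
Qed.

Lemma mx_integrableD k l (F G : R -> 'M[R]_(k, l)) :
  mx_integrable D F -> mx_integrable D G ->
  mx_integrable D (fun t => F t + G t).
Proof.
move=> Fi Gi i j.
have := @integrableD _ _ _ mu D mD _ _ (Fi i j) (Gi i j).
by apply: eq_integrable => // t _; rewrite /= mxE.
Qed.

Lemma mx_integralD k l (F G : R -> 'M[R]_(k, l)) :
  mx_integrable D F -> mx_integrable D G ->
  mx_integral D (fun t => F t + G t) = mx_integral D F + mx_integral D G.
Proof.
move=> Fi Gi; apply/matrixP => i j; rewrite !mxE -RintegralD//.
- by apply: eq_Rintegral => t _; rewrite mxE.
- exact: Fi.
- exact: Gi.
Qed.

Lemma mx_integrableMl k l h (E : 'M[R]_(h, k)) (F : R -> 'M[R]_(k, l)) :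
  mx_integrable D F -> mx_integrable D (fun t => E *m F t).
Proof.
move=> Fi i j.
have := @integrable_sumR R _ (index_enum _) (fun q t => E i q * F t q j) D mD.
have H q : mu.-integrable D (EFin \o (fun t => E i q * F t q j)).
  by have := @integrableZl _ _ _ mu D mD (E i q) _ (Fi q j); apply: eq_integrable.
by move=> /(_ H); apply: eq_integrable => // t _; rewrite /= mxE.
Qed.

Lemma mx_integrableN k l (F : R -> 'M[R]_(k, l)) :
  mx_integrable D F -> mx_integrable D (fun t => - F t).
Proof.
move=> /(mx_integrableMl (- 1%:M)).
by apply: eq_mx_integrable => // t _; rewrite mulNmx mul1mx.
Qed.

Lemma mx_integrableB k l (F G : R -> 'M[R]_(k, l)) :
  mx_integrable D F -> mx_integrable D G ->
  mx_integrable D (fun t => F t - G t).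
Proof. by move=> Fi /mx_integrableN; exact: mx_integrableD. Qed.

Lemma mx_integralMl k l h (E : 'M[R]_(h, k)) (F : R -> 'M[R]_(k, l)) :
  mx_integrable D F ->
  mx_integral D (fun t => E *m F t) = E *m mx_integral D F.
Proof.
move=> Fi; apply/matrixP => i j; rewrite !mxE.
under eq_Rintegral do rewrite mxE.
rewrite Rintegral_sum//; last first.
  by move=> q; have := @integrableZl _ _ _ mu D mD (E i q) _ (Fi q j); apply: eq_integrable.
by apply: eq_bigr => q _; rewrite mxE RintegralZl//; exact: Fi.
Qed.

Lemma mx_integrable_tr k l (F : R -> 'M[R]_(k, l)) :
  mx_integrable D F -> mx_integrable D (fun t => (F t)^T).
Proof.
move=> Fi i j; have := Fi j i; apply: eq_integrable => // t _.
by rewrite mxE.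
Qed.

Lemma mx_integral_tr k l (F : R -> 'M[R]_(k, l)) :
  mx_integral D (fun t => (F t)^T) = (mx_integral D F)^T.
Proof.
apply/matrixP => i j; rewrite !mxE; apply: eq_Rintegral => t _; exact: mxE.
Qed.

Lemma mx_integrableMr k l h (E : 'M[R]_(l, h)) (F : R -> 'M[R]_(k, l)) :
  mx_integrable D F -> mx_integrable D (fun t => F t *m E).
Proof.
move=> /mx_integrable_tr/(mx_integrableMl E^T)/mx_integrable_tr.
by apply: eq_mx_integrable => // t _; rewrite trmx_mul !trmxK.
Qed.

Lemma mx_integralMr k l h (E : 'M[R]_(l, h)) (F : R -> 'M[R]_(k, l)) :
  mx_integrable D F ->
  mx_integral D (fun t => F t *m E) = mx_integral D F *m E.
Proof.
move=> /mx_integrable_tr/(mx_integralMl E^T).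
rewrite mx_integral_tr -trmx_mul => /(congr1 trmx); rewrite trmxK -mx_integral_tr => <-.
by apply: eq_mx_integral => t _; rewrite trmx_mul !trmxK.
Qed.

Lemma integrable_norm1 k l (F : R -> 'M[R]_(k, l)) :
  mx_integrable D F -> mu.-integrable D (EFin \o (fun t => norm1 (F t))).
Proof.
move=> Fi; apply: integrable_sumR => // i; apply: integrable_sumR => // j.
exact: integrable_norm (Fi i j).
Qed.

Lemma norm1_mx_integral k l (F : R -> 'M[R]_(k, l)) : mx_integrable D F ->
  norm1 (mx_integral D F) <= Rintegral mu D (fun t => norm1 (F t)).
Proof.
move=> Fi;
have nFi i j : mu.-integrable D (EFin \o (fun t => `|F t i j|)).
  exact: integrable_norm (Fi i j).
rewrite /norm1 Rintegral_sum//; last by move=> i; apply: integrable_sumR.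
apply: ler_sum => i _; rewrite Rintegral_sum//; apply: ler_sum => j _.
by rewrite mxE; apply: le_normr_Rintegral => //; exact: Fi.
Qed.

Lemma mx_integrable_bounded_mul k l h (A : R -> 'M[R]_(h, k))
    (F : R -> 'M[R]_(k, l)) (K : R) : mx_measurable D A ->
  (forall t, D t -> norm1 (A t) <= K) -> mx_integrable D F ->
  mx_integrable D (fun t => A t *m F t).
Proof.
move=> mA AK Fi i j.
have := @integrable_sumR R _ (index_enum _) (fun q t => A t i q * F t q j) D mD.
have H q : mu.-integrable D (EFin \o (fun t => A t i q * F t q j)).
  have := @integrableMr _ _ _ mu D mD (fun t => A t i q) (fun t => (F t q j)%:E).
  move=> /(_ (mA i q)); rewrite /comp/=; apply; last exact: Fi.
  exists K; split; first exact: num_real.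
  move=> x Kx t /= Dt; apply: le_trans (ltW Kx); apply: le_trans (AK _ Dt).
  exact: norm1_entry.
by move=> /(_ H); apply: eq_integrable => // t _; rewrite /= mxE.
Qed.

End measurable_domain.

Lemma mx_integral_chasles k l (F : R -> 'M[R]_(k, l)) a b c :
  a <= b -> b <= c -> mx_integrable `[a, c] F ->
  mx_integral `[a, c] F = mx_integral `[a, b] F + mx_integral `[b, c] F.
Proof.
move=> ab bc Fi; apply/matrixP => i j; rewrite !mxE.
exact: Rintegral_chasles (Fi i j).
Qed.

Lemma mx_integral_shift k l (F : R -> 'M[R]_(k, l)) a b c :
  mx_integrable `[a + c, b + c] F ->
  mx_integral `[a, b] (fun t => F (t + c)) = mx_integral `[a + c, b + c] F.
Proof.
move=> Fi; apply/matrixP => i j; rewrite !mxE.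
by rewrite -(Rintegral_shift (Fi i j)).
Qed.

Lemma mx_integrable_shift k l (F : R -> 'M[R]_(k, l)) a b c :
  mx_integrable `[a + c, b + c] F ->
  mx_integrable `[a, b] (fun t => F (t + c)).
Proof. by move=> Fi i j; have := integrable_shift (Fi i j). Qed.

Lemma mx_integral_set1 k l (F : R -> 'M[R]_(k, l)) a : mx_integral `[a, a] F = 0.
Proof. by apply/matrixP => i j; rewrite !mxE set_itv1 Rintegral_set1. Qed.

Lemma bounded_mx_integrable k l (F : R -> 'M[R]_(k, l)) a b (K : R) :
  mx_measurable `[a, b] F -> (forall t, a <= t <= b -> norm1 (F t) <= K) ->
  mx_integrable `[a, b] F.
Proof.
move=> mF FK i j; apply: (@bounded_integrable_segment _ _ _ _ K); first exact: mF.
move=> t; rewrite in_itv/= => /FK; apply: le_trans; exact: norm1_entry.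
Qed.
End matrix_integrals.

(** * Gronwall's lemma *)

Section sequences_and_gronwall.
Context {R : realType}.
Local Notation mu := (@lebesgue_measure R).
Implicit Types (a b c t : R).
Local Notation int a b f := (Rintegral mu `[a, b] f).
Local Notation itg a b f := (mu.-integrable `[a, b] (EFin \o f)).

Lemma le0_geometric (x K : R) : (forall n, x <= K / 2 ^+ n) -> x <= 0.
Proof.
move=> xK; apply/ler_addgt0Pr => e e0; rewrite add0r.
have := @cvg_geometric R K 2^-1 _.
have h2 : `|2^-1 : R| < 1 by rewrite ger0_norm ?invr_ge0// invf_lt1// ltr1n.
move=> /(_ h2)/cvgrPdist_lt/(_ _ e0)[n _ /(_ n (leqnn n))].
rewrite /= sub0r normrN => Ke; apply: le_trans (xK n) _.
by rewrite -exprVn; apply: ltW; apply: le_lt_trans Ke; apply: ler_norm.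
Qed.

(** The increments after rank n sum to at most 2K/2^n. Lowering and raising u by this tail gives a
    nondecreasing and a nonincreasing sequence, which enclose the limit and so yield the rate of
    convergence with it. *)
Lemma geometric_cauchy (u : nat -> R) (K : R) :
  (forall n, `|u n.+1 - u n| <= K / 2 ^+ n) ->
  exists l, u @ \oo --> l /\ forall n, `|l - u n| <= 2 * K / 2 ^+ n.
Proof.
move=> uK.
pose a n := u n - 2 * K / 2 ^+ n; pose b n := u n + 2 * K / 2 ^+ n.
have K0 : 0 <= K.
  by have := uK 0; rewrite expr0 divr1; apply: le_trans; apply: normr_ge0.
have e0 n : 0 <= 2 * K / 2 ^+ n :> R by rewrite divr_ge0 ?mulr_ge0// exprn_ge0.
have hS n : 2 * K / 2 ^+ n = K / 2 ^+ n + 2 * K / 2 ^+ n.+1 :> R.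
  by rewrite exprS; field; rewrite expf_neq0.
have aS : nondecreasing_seq a.
  apply/nondecreasing_seqP => n; rewrite /a (hS n).
  have := uK n; rewrite ler_norml => /andP[]; lra.
have bS : nonincreasing_seq b.
  apply/nonincreasing_seqP => n; rewrite /b (hS n).
  have := uK n; rewrite ler_norml => /andP[]; lra.
have ab n m : a n <= b m.
  apply: (@le_trans _ _ (a (maxn n m))); first by apply: aS; rewrite leq_maxl.
  apply: (@le_trans _ _ (b (maxn n m))); last by apply: bS; rewrite leq_maxr.
  by rewrite /a /b; have := e0 (maxn n m); lra.
have ca : cvgn a.
  apply: nondecreasing_is_cvgn => //; exists (b 0) => _ [n _ <-]; exact: ab.
exists (limn a).
have P n : `|limn a - u n| <= 2 * K / 2 ^+ n.
  have h1 : a n <= limn a by apply: nondecreasing_cvgn_le.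
  have h2 : limn a <= b n by apply: limr_le => //; apply: nearW => m; exact: ab.
  by rewrite ler_norml; move: h1 h2; rewrite /a /b; lra.
split => //.
have h2 : `|2^-1 : R| < 1 by rewrite ger0_norm ?invr_ge0// invf_lt1// ltr1n.
have := @cvg_geometric R (2 * K) 2^-1 h2 => cg.
apply/cvgrPdist_le => e e1.
move/cvgrPdist_lt : cg => /(_ _ e1); apply: filterS => n /=.
rewrite sub0r normrN exprVn => Ke.
apply: le_trans (P n) _; apply: le_trans (ler_norm _) _; exact: ltW.
Qed.

(** A bootstrap: each bound S improves to c + S/2, whose fixed point is 2c. After n rounds the
    constant is 2c(1 - 2^-n) + S0/2^n, so the initial bound S0 disappears in the limit. *)
Lemma halving_bound (D : R -> Prop) (phi w : R -> R) (c S0 : R) :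
  0 <= c -> 0 <= S0 -> (forall t, D t -> phi t <= S0 * w t) ->
  (forall S, 0 <= S -> (forall t, D t -> phi t <= S * w t) ->
             forall t, D t -> phi t <= (c + S / 2) * w t) ->
  forall t, D t -> phi t <= 2 * c * w t.
Proof.
move=> c0 S00 P0 PS t Dt.
have key n : forall t, D t -> phi t <= (2 * c * (1 - (2 ^+ n)^-1) + S0 / 2 ^+ n) * w t.
  elim: n => [|n IH] s Ds.
    by rewrite expr0 !divr1 invr1 subrr mulr0 add0r; exact: P0.
  have n0 : 0 <= (2 ^+ n)^-1 :> R by rewrite invr_ge0 exprn_ge0.
  have n1 : (2 ^+ n)^-1 <= 1 :> R.
    by rewrite invf_le1 ?exprn_gt0// exprn_ege1// ler1n.
  have := PS _ _ IH s Ds.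
  have -> : c + (2 * c * (1 - (2 ^+ n)^-1) + S0 / 2 ^+ n) / 2 =
     2 * c * (1 - (2 ^+ n.+1)^-1) + S0 / 2 ^+ n.+1 :> R.
    by rewrite exprS; field; rewrite expf_neq0.
  by apply; apply: addr_ge0; [apply: mulr_ge0; lra|exact: mulr_ge0].
rewrite -subr_le0; apply: (@le0_geometric _ ((S0 - 2 * c) * w t)) => n.
by have := key n t Dt; lra.
Qed.

Lemma integrable_expR (c a s t : R) : itg s t (fun r => expR (c * (r - a))).
Proof.
apply: continuous_compact_integrable; first exact: segment_compact.
apply: continuous_subspaceT => x.
have dE : is_derive x 1 (fun r : R => expR (c * (r - a))) (c * expR (c * (x - a))).
  by apply: is_derive_eq; rewrite /GRing.scale/=; ring.
by apply/differentiable_continuous/derivable1_diffP; apply: ex_derive.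
Qed.

Lemma Rintegral_le_expR (phi : R -> R) (c a s t S : R) : s <= t -> c != 0 ->
  itg s t phi -> (forall r, s <= r <= t -> phi r <= S * expR (c * (r - a))) ->
  int s t phi <= S / c * (expR (c * (t - a)) - expR (c * (s - a))).
Proof.
move=> st c0 phii phiS.
have ie := integrable_expR c a s t.
apply: (@le_trans _ _ (int s t (fun r => S * expR (c * (r - a))))).
  apply: le_Rintegral => //; first by have := @integrableZl _ _ _ mu _ _ S _ ie; apply.
rewrite RintegralZl//.
have := Rintegral_expR c a st.
rewrite RintegralZl// => <-.
by rewrite mulrA divfK.
Qed.

(** With the weight exp(2k(t - a)), k times the integral of the weight is at most half the weight,
    so the hypothesis improves a bound S to c + S/2 and [halving_bound] applies. The price is the
    doubled rate and the factor 2; the bound K only starts the iteration. *)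
Lemma gronwall (phi : R -> R) (a b c k K : R) : 0 < k -> 0 <= c ->
  (forall t, a <= t <= b -> 0 <= phi t <= K) -> itg a b phi ->
  (forall t, a <= t <= b -> phi t <= c + k * int a t phi) ->
  forall t, a <= t <= b -> phi t <= 2 * c * expR (2 * k * (t - a)).
Proof.
move=> k0 c0 phiK phii H.
have E1 t : a <= t <= b -> 1 <= expR (2 * k * (t - a)).
  by move=> /andP[h _]; rewrite -expR0 ler_expR !mulr_ge0 ?subr_ge0//; lra.
move=> t tab; have K0 : 0 <= K by have := phiK _ tab => /andP[]; lra.
move: t tab; apply: (@halving_bound (fun t => a <= t <= b) _ _ _ K) => //.
  move=> t tab; have /andP[_ h] := phiK _ tab; apply: le_trans h _.
  by rewrite ler_peMr ?E1.
move=> S S0 HS t tab; apply: le_trans (H _ tab) _.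
have /andP[ta tb] := tab.
have : int a t phi <= S / (2 * k) * (expR (2 * k * (t - a)) - expR (2 * k * (a - a))).
  apply: Rintegral_le_expR => //; first lra.
    by apply: integrable_sub_segment phii.
  by move=> r /andP[? ?]; apply: HS; apply/andP; split; lra.
rewrite subrr mulr0 expR0 => h.
have : k * int a t phi <= S / 2 * (expR (2 * k * (t - a)) - 1).
  have -> : S / 2 = k * (S / (2 * k)) by field; lra.
  by rewrite -[leRHS]mulrA ler_wpM2l// ltW.
have := E1 _ tab; nra.
Qed.

(** The same bootstrap with the weight exp(2k(b - t)), which decreases toward the final time. It
    serves to show that a solution of a homogeneous equation vanishing at b also vanished before. *)
Lemma gronwall_backward (phi : R -> R) (a b c k K : R) : 0 < k -> 0 <= c ->
  (forall t, a <= t <= b -> 0 <= phi t <= K) -> itg a b phi ->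
  (forall t, a <= t <= b -> phi t <= c + k * int t b phi) ->
  forall t, a <= t <= b -> phi t <= 2 * c * expR (2 * k * (b - t)).
Proof.
move=> k0 c0 phiK phii H.
have E1 t : a <= t <= b -> 1 <= expR (2 * k * (b - t)).
  by move=> /andP[_ h]; rewrite -expR0 ler_expR !mulr_ge0 ?subr_ge0//; lra.
move=> t tab; have K0 : 0 <= K by have := phiK _ tab => /andP[]; lra.
move: t tab; apply: (@halving_bound (fun t => a <= t <= b) _ _ _ K) => //.
  move=> t tab; have /andP[_ h] := phiK _ tab; apply: le_trans h _.
  by rewrite ler_peMr ?E1.
move=> S S0 HS t tab; apply: le_trans (H _ tab) _.
have /andP[ta tb] := tab.
have : int t b phi <= S / (- (2 * k)) * (expR (- (2 * k) * (b - b)) - expR (- (2 * k) * (t - b))).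
  apply: Rintegral_le_expR => //; first lra.
    by apply: integrable_sub_segment phii.
  move=> r /andP[? ?]; rewrite mulNr -mulrN opprB.
  by apply: HS; apply/andP; split; lra.
rewrite subrr mulr0 expR0 mulNr -mulrN opprB => h.
have : k * int t b phi <= S / 2 * (expR (2 * k * (b - t)) - 1).
  have -> : S / 2 * (expR (2 * k * (b - t)) - 1) =
    k * (S / (- (2 * k)) * (1 - expR (2 * k * (b - t)))) by field; lra.
  by rewrite ler_wpM2l// ltW.
have := E1 _ tab; nra.
Qed.

End sequences_and_gronwall.

(** * Linear equations with bounded measurable coefficients *)

Section primitives.
Context {R : realType}.
Local Notation mu := (@lebesgue_measure R).
Implicit Types (a b c t : R).

Lemma primitive_continuous k l (F : R -> 'M[R]_(k, l)) (x0 : 'M[R]_(k, l)) a b :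
  a <= b ->
  mx_integrable `[a, b] F -> forall i j,
  {within `[a, b], continuous (fun t => (x0 + mx_integral `[a, t] F) i j)}.
Proof.
move=> ab Fi i j.
have := @parameterized_integral_continuous R a b _ ab (Fi i j).
set h := (X in {within _, continuous X}) => ch.
rewrite (_ : (fun t => _) = (fun t => x0 i j + h t)).
  move=> t; apply: cvgD; first exact: cvg_cst.
  exact: ch.
by apply/funext => t; rewrite !mxE.
Qed.

Lemma continuous_bounded (f : R -> R) a b :
  {within `[a, b], continuous f} ->
  exists K : R, 0 <= K /\ forall t, a <= t <= b -> `|f t| <= K.
Proof.
move=> cf.
have := continuous_compact cf (@segment_compact _ a b).
move=> /compact_bounded[K [_ HK]].
exists (`|K| + 1); split; first by rewrite addr_ge0.
move=> t tab; apply: (HK (`|K| + 1)).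
  by apply: le_lt_trans (ler_norm _) _; rewrite ltrDl.
by exists t => //=; rewrite in_itv.
Qed.

Lemma continuous_mx_bounded k l (F : R -> 'M[R]_(k, l)) a b :
  (forall i j, {within `[a, b], continuous (fun t => F t i j)}) ->
  exists K : R, 0 <= K /\ forall t, a <= t <= b -> norm1 (F t) <= K.
Proof.
move=> cF.
have /choice[K0 HK0] : forall ij : 'I_k * 'I_l, exists K : R, 0 <= K /\
    forall t, a <= t <= b -> `|F t ij.1 ij.2| <= K.
  by move=> ij; apply: continuous_bounded; apply: cF.
exists (\sum_i \sum_j K0 (i, j)); split.
  by apply: sumr_ge0 => i _; apply: sumr_ge0 => j _; case: (HK0 (i, j)).
move=> t tab; apply: ler_sum => i _; apply: ler_sum => j _.
by case: (HK0 (i, j)) => _; apply.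
Qed.

Lemma continuous_mx_measurable k l (F : R -> 'M[R]_(k, l)) a b :
  (forall i j, {within `[a, b], continuous (fun t => F t i j)}) ->
  mx_measurable `[a, b] F.
Proof.
by move=> cF i j; apply: subspace_continuous_measurable_fun => //; exact: cF.
Qed.

Lemma continuous_mx_integrable k l (F : R -> 'M[R]_(k, l)) a b :
  (forall i j, {within `[a, b], continuous (fun t => F t i j)}) ->
  mx_integrable `[a, b] F.
Proof.
move=> cF; have [K [_ FK]] := continuous_mx_bounded cF.
by apply: (bounded_mx_integrable (K := K)) => //; exact: continuous_mx_measurable.
Qed.

End primitives.

Section linear_equations.
Context {R : realType}.
Local Notation mu := (@lebesgue_measure R).
Implicit Types (a b c t : R).
Local Notation int a b f := (Rintegral mu `[a, b] f).
Local Notation itg a b f := (mu.-integrable `[a, b] (EFin \o f)).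

Definition bounded_coef k l (K : R) (A : R -> 'M[R]_(k, l)) :=
  mx_measurable time A /\ forall t, 0 <= t -> norm1 (A t) <= K.

Definition loc_integrable k l (G : R -> 'M[R]_(k, l)) :=
  forall b, mx_integrable `[0, b] G.

Definition lin_solution k l (A : R -> 'M[R]_k) (G : R -> 'M[R]_(k, l)) :=
  is_solution (fun t X => A t *m X + G t).

Lemma bounded_coef_measurable k l K (A : R -> 'M[R]_(k, l)) a b : 0 <= a ->
  bounded_coef K A -> mx_measurable `[a, b] A.
Proof.
move=> a0 [mA _] i j; apply: measurable_funS (mA i j) => //.
  exact: measurable_itv.
by move=> t; rewrite /time /= !in_itv/= => /andP[? _]; rewrite andbT; lra.
Qed.

Lemma bounded_coef_mul k l h K (A : R -> 'M[R]_(h, k)) (F : R -> 'M[R]_(k, l)) a b :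
  0 <= a -> bounded_coef K A -> mx_integrable `[a, b] F ->
  mx_integrable `[a, b] (fun t => A t *m F t).
Proof.
move=> a0 cA; apply: (@mx_integrable_bounded_mul R _ _ k l h A F K) => //.
  exact: bounded_coef_measurable cA.
move=> t; rewrite /= in_itv/= => /andP[? _]; apply: cA.2; lra.
Qed.

Section existence.
Variables (k l : nat) (A : R -> 'M[R]_k) (G : R -> 'M[R]_(k, l)) (K t0 : R).
Variable x0 : 'M[R]_(k, l).
Hypotheses (K0 : 0 < K) (t00 : 0 <= t0).
Hypotheses (cA : bounded_coef K A) (iG : loc_integrable G).

Let rhs (X : R -> 'M[R]_(k, l)) t := A t *m X t + G t.

Let rhs_integrable X b : mx_integrable `[t0, b] X ->
  mx_integrable `[t0, b] (rhs X).
Proof.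
move=> iX; apply: mx_integrableD => //; first exact: bounded_coef_mul cA iX.
exact: mx_integrable_sub (iG b).
Qed.

Fixpoint picard n : R -> 'M[R]_(k, l) :=
  if n is n'.+1 then fun t => x0 + mx_integral `[t0, t] (rhs (picard n'))
  else fun=> 0.

Let picard_integrable n b : t0 <= b -> mx_integrable `[t0, b] (picard n).
Proof.
elim: n b => [|n IH] b tb; first exact: mx_integrable0.
apply: continuous_mx_integrable.
by apply: primitive_continuous => //; apply: rhs_integrable; apply: IH.
Qed.

Let picard_step X Y b : t0 <= b -> mx_integrable `[t0, b] X ->
  mx_integrable `[t0, b] Y ->
  norm1 (mx_integral `[t0, b] (rhs X) - mx_integral `[t0, b] (rhs Y)) <=
  K * int t0 b (fun t => norm1 (X t - Y t)).
Proof.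
move=> tb iX iY.
have iD : mx_integrable `[t0, b] (fun t => X t - Y t).
  exact: mx_integrableB.
have iAD := bounded_coef_mul t00 cA iD.
have -> : mx_integral `[t0, b] (rhs X) = mx_integral `[t0, b] (rhs Y) +
   mx_integral `[t0, b] (fun t => A t *m (X t - Y t)).
  rewrite -mx_integralD//; last exact: rhs_integrable.
  apply: eq_mx_integral => t _; rewrite /rhs mulmxBr.
  by apply/matrixP => i j; rewrite !mxE; ring.
rewrite addrAC subrr add0r; apply: le_trans (norm1_mx_integral _ iAD) _ => //.
rewrite -RintegralZl//; last exact: integrable_norm1.
have inD := integrable_norm1 (measurable_itv _) iD.
apply: le_Rintegral => //; first exact: integrable_norm1.
  by have := @integrableZl _ _ _ mu _ _ K _ inD; apply.
move=> t; rewrite /= in_itv/= => /andP[? _]; apply: le_trans (norm1M _ _) _.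
by rewrite ler_wpM2r ?norm1_ge0//; apply: cA.2; exact: le_trans t00 _.
Qed.

(** In the supremum norm weighted by exp(-2K(t - t0)) the Picard map is a contraction of factor 1/2
    on every segment, however long, so solutions need not be continued from short segments. *)
Let picard_diff b : t0 <= b -> exists S : R, 0 <= S /\ forall n t, t0 <= t <= b ->
  norm1 (picard n.+1 t - picard n t) <= S / 2 ^+ n * expR (2 * K * (t - t0)).
Proof.
move=> tb.
have i1 := picard_integrable 1 tb.
have c1 : forall i j, {within `[t0, b], continuous (fun t => picard 1 t i j)}.
  by apply: primitive_continuous => //; apply: rhs_integrable; exact: mx_integrable0.
(* The iteration starts from 0, so a bound on the first iterate is a bound on the first
   difference. *)
have [S [S0 HS]] := continuous_mx_bounded c1.
exists S; split => // n; elim: n => [|n IH] t /andP[ta tb'].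
  rewrite subr0 expr0 divr1; apply: le_trans (HS t _) _; first by rewrite ta.
  by rewrite ler_peMr// -expR0 ler_expR !mulr_ge0 ?subr_ge0// ltW.
rewrite [picard n.+2 t]/= [picard n.+1 t]/= opprD addrACA subrr add0r.
have i2 : mx_integrable `[t0, t] (picard n.+1) by apply: picard_integrable.
have i3 : mx_integrable `[t0, t] (picard n) by apply: picard_integrable.
apply: le_trans (picard_step ta i2 i3) _.
have iD : itg t0 t (fun s => norm1 (picard n.+1 s - picard n s)).
  apply: integrable_norm1 => //; exact: mx_integrableB.
have := @Rintegral_le_expR _ _ (2 * K) t0 t0 t (S / 2 ^+ n) ta _ iD _.
have K20 : 2 * K != 0 by rewrite mulf_neq0 ?gt_eqF.
move=> /(_ K20); have H : forall r, t0 <= r <= t ->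
  norm1 (picard n.+1 r - picard n r) <= S / 2 ^+ n * expR (2 * K * (r - t0)).
  by move=> r /andP[? ?]; apply: IH; apply/andP; split; lra.
move=> /(_ H) h; apply: (le_trans (ler_wpM2l (ltW K0) h)).
rewrite subrr mulr0 expR0.
have -> : K * (S / 2 ^+ n / (2 * K) * (expR (2 * K * (t - t0)) - 1)) =
  S / 2 ^+ n.+1 * (expR (2 * K * (t - t0)) - 1).
  by rewrite exprS; field; rewrite expf_neq0// gt_eqF.
by apply: ler_wpM2l; rewrite ?divr_ge0 ?exprn_ge0// lerBlDr lerDl.
Qed.

Let picard_cauchy b : t0 <= b -> exists S : R, 0 <= S /\ forall n t, t0 <= t <= b ->
  norm1 (picard n.+1 t - picard n t) <= S / 2 ^+ n.
Proof.
move=> tb; have [S [S0 HS]] := picard_diff tb.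
exists (S * expR (2 * K * (b - t0))); split; first by rewrite mulr_ge0 ?expR_ge0.
move=> n t tt; apply: le_trans (HS _ _ tt) _; rewrite mulrAC.
rewrite -!mulrA ler_wpM2l// ler_wpM2r ?invr_ge0 ?exprn_ge0//.
by rewrite ler_expR !ler_wpM2l ?(ltW K0)// lerD2r; case/andP: tt.
Qed.

Let sol t : 'M[R]_(k, l) :=
  \matrix_(i, j) lim ((fun n => picard n t i j) @ \oo).

Let sol_cvg b t i j : t0 <= t <= b ->
  (fun n => picard n t i j) @ \oo --> sol t i j.
Proof.
move=> tb; have tb' : t0 <= b by lra.
have [S [S0 HS]] := picard_cauchy tb'.
have := @geometric_cauchy _ (fun n => picard n t i j) S.
case=> [n|v [cv _]].
  by have := norm1_entry (picard n.+1 t - picard n t) i j; rewrite !mxE => /le_trans; apply; exact: HS.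
by rewrite /sol mxE; apply/cvg_ex; exists v.
Qed.

Let sol_approx b : t0 <= b -> exists S : R, 0 <= S /\ forall n t, t0 <= t <= b ->
  norm1 (sol t - picard n t) <= S / 2 ^+ n.
Proof.
move=> tb; have [S [S0 HS]] := picard_cauchy tb.
exists (\sum_(i < k) \sum_(j < l) (2 * S)); split.
  by apply: sumr_ge0 => i _; apply: sumr_ge0 => j _; rewrite mulr_ge0.
move=> n t tt; rewrite mulr_suml; apply: ler_sum => i _.
rewrite mulr_suml; apply: ler_sum => j _.
have := @geometric_cauchy _ (fun n => picard n t i j) S.
case=> [m|v [cv H]].
  by have := norm1_entry (picard m.+1 t - picard m t) i j; rewrite !mxE => /le_trans; apply; exact: HS.
have sv : sol t i j = v by rewrite /sol mxE; apply/cvg_lim => //; exact: cv.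
by rewrite !mxE in sv *; rewrite sv; exact: H.
Qed.

Let sol_integrable b : t0 <= b -> mx_integrable `[t0, b] sol.
Proof.
move=> tb; have [S [S0 HS]] := sol_approx tb.
(* Measurability comes from the pointwise limit, boundedness from the estimate at rank 0, where the
   iterate is 0. *)
apply: (@bounded_mx_integrable _ _ _ _ _ _ S).
  move=> i j.
  apply: (@measurable_fun_cvg _ _ _ _ (fun n t => picard n t i j)).
    move=> n; exact: (mx_integrable_measurable (picard_integrable n tb)).
  by move=> t; rewrite /= in_itv/= => tt; exact: sol_cvg tt.
by move=> t tt; have := HS 0 t tt; rewrite subr0 expr0 divr1.
Qed.

Lemma lin_solution_exists : exists x, lin_solution A G t0 x0 x.
Proof.
exists sol => t tt.
have isol := sol_integrable tt.
split; first exact: rhs_integrable.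
have [S [S0 HS]] := sol_approx tt.
apply/eqP; rewrite -subr_eq0; apply/eqP/norm1_eq0.
(* The defect of the integral equation is split at iterate n + 1: S/2^n bounds the distance to that
   iterate, K(t - t0)S/2^n the error made under the integral. No limit is taken under the integral
   sign. *)
apply: (@le0_geometric _ _ (S + K * (S * (t - t0)))) => n.
have -> : sol t - (x0 + mx_integral `[t0, t] (fun s => A s *m sol s + G s)) =
  (sol t - picard n.+1 t) +
  (mx_integral `[t0, t] (rhs (picard n)) - mx_integral `[t0, t] (rhs sol)).
  rewrite [picard _ _]/= -/(rhs sol).
  by apply/matrixP => i j; rewrite !mxE; ring.
apply: le_trans (norm1D _ _) _.
have h1 : norm1 (sol t - picard n.+1 t) <= S / 2 ^+ n.
  apply: le_trans (HS _ _ _) _; first by rewrite tt lexx.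
  rewrite ler_wpM2l// lef_pV2 ?posrE ?exprn_gt0//.
  by rewrite ler_weXn2l// ler1n.
have iP : mx_integrable `[t0, t] (picard n) by apply: picard_integrable.
have h2 := picard_step tt iP isol.
have iD : itg t0 t (fun s => norm1 (picard n s - sol s)).
  apply: integrable_norm1 => //; exact: mx_integrableB.
have h3 : int t0 t (fun s => norm1 (picard n s - sol s)) <= S / 2 ^+ n * (t - t0).
  apply: (@le_trans _ _ (int t0 t (cst (S / 2 ^+ n)))).
    apply: le_Rintegral => //.
      apply: continuous_compact_integrable; first exact: segment_compact.
      by apply: continuous_subspaceT => ?; exact: cvg_cst.
    move=> s; rewrite /= in_itv/= => ss; rewrite -norm1N opprB; exact: HS.
  by rewrite Rintegral_cst_segment.
apply: le_trans (lerD h1 h2) _.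
rewrite [leRHS]mulrDl lerD2l -mulrA ler_wpM2l ?(ltW K0)//.
by apply: le_trans h3 _; rewrite mulrAC.
Qed.

End existence.
End linear_equations.

(** * Calculus of solutions, a priori bounds and flows *)

Section linear_solutions.
Context {R : realType}.
Local Notation mu := (@lebesgue_measure R).
Implicit Types (a b c t s r : R).
Local Notation int a b f := (Rintegral mu `[a, b] f).
Local Notation itg a b f := (mu.-integrable `[a, b] (EFin \o f)).

Lemma lin_solution_init k l A G t0 x0 (x : R -> 'M[R]_(k, l)) :
  lin_solution A G t0 x0 x -> x t0 = x0.
Proof. by move=> /(_ t0 (lexx _))[_ ->]; rewrite mx_integral_set1 addr0. Qed.

Lemma lin_solution_continuous k l A G t0 b x0 (x : R -> 'M[R]_(k, l)) :
  lin_solution A G t0 x0 x -> t0 <= b -> forall i j,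
  {within `[t0, b], continuous (fun t => x t i j)}.
Proof.
move=> xP tb i j.
have := @primitive_continuous R k l _ x0 t0 b tb (xP b tb).1 i j.
apply: subspace_eq_continuous => t /set_mem; rewrite /= in_itv/= => /andP[tt _].
exact: esym (congr1 (fun X : 'M[R]_(k, l) => X i j) (xP t tt).2).
Qed.

Lemma lin_solution_integrable k l A G t0 a b x0 (x : R -> 'M[R]_(k, l)) :
  lin_solution A G t0 x0 x -> t0 <= a -> a <= b -> mx_integrable `[a, b] x.
Proof.
move=> xP ta ab; apply: (mx_integrable_sub ta (lexx b)).
apply: continuous_mx_integrable; apply: lin_solution_continuous xP _.
exact: le_trans ab.
Qed.

Lemma lin_solution_increment k l A G t0 s t x0 (x : R -> 'M[R]_(k, l)) :
  lin_solution A G t0 x0 x -> t0 <= s -> s <= t ->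
  mx_integrable `[s, t] (fun r => A r *m x r + G r) /\
  x t = x s + mx_integral `[s, t] (fun r => A r *m x r + G r).
Proof.
move=> xP ts st; have tt := le_trans ts st.
split; first by apply: mx_integrable_sub (xP t tt).1.
rewrite (xP t tt).2 (xP s ts).2 -addrA; congr (_ + _).
by apply: mx_integral_chasles => //; exact: (xP t tt).1.
Qed.

Lemma lin_solution_restart k l A G t0 t1 x0 (x : R -> 'M[R]_(k, l)) :
  lin_solution A G t0 x0 x -> t0 <= t1 -> lin_solution A G t1 (x t1) x.
Proof. by move=> xP t01 t t1t; exact: lin_solution_increment xP _ _. Qed.

Lemma lin_solutionD k l A G G' t0 x0 x0' (x x' : R -> 'M[R]_(k, l)) :
  lin_solution A G t0 x0 x -> lin_solution A G' t0 x0' x' ->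
  lin_solution A (fun t => G t + G' t) t0 (x0 + x0') (fun t => x t + x' t).
Proof.
move=> xP xP' t tt; have [i1 e1] := xP t tt; have [i2 e2] := xP' t tt.
have E r : A r *m x r + G r + (A r *m x' r + G' r) =
    A r *m (x r + x' r) + (G r + G' r) by rewrite mulmxDr addrACA.
split.
  by apply: eq_mx_integrable (mx_integrableD _ i1 i2) => // r _.
rewrite e1 e2 addrACA -mx_integralD//; congr (_ + _).
by apply: eq_mx_integral => r _.
Qed.

(** The maps of the realization intertwine the coefficients at every time; by this lemma they carry
    states to states. *)
Lemma lin_solution_intertwine k k' l A A' G t0 x0 (x : R -> 'M[R]_(k, l))
    (E : 'M[R]_(k', k)) :
  (forall t, t0 <= t -> A' t *m E = E *m A t) -> lin_solution A G t0 x0 x ->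
  lin_solution A' (fun t => E *m G t) t0 (E *m x0) (fun t => E *m x t).
Proof.
move=> AE xP t tt; have [i1 e1] := xP t tt.
have EE r : `[t0, t]%classic r ->
    E *m (A r *m x r + G r) = A' r *m (E *m x r) + E *m G r.
  by rewrite /= in_itv/= => /andP[h _]; rewrite mulmxDr !mulmxA AE.
split.
  by apply: eq_mx_integrable (mx_integrableMl _ E i1) => // r _.
rewrite e1 mulmxDr -mx_integralMl//; congr (_ + _).
exact: eq_mx_integral.
Qed.

Lemma lin_solutionMr k l l' A G t0 x0 (x : R -> 'M[R]_(k, l)) (v : 'M[R]_(l, l')) :
  lin_solution A G t0 x0 x ->
  lin_solution A (fun t => G t *m v) t0 (x0 *m v) (fun t => x t *m v).
Proof.
move=> xP t tt; have [i1 e1] := xP t tt.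
have EE r : (A r *m x r + G r) *m v = A r *m (x r *m v) + G r *m v.
  by rewrite mulmxDl mulmxA.
split.
  by apply: eq_mx_integrable (mx_integrableMr _ v i1) => // r _.
rewrite e1 mulmxDl -mx_integralMr//; congr (_ + _).
by apply: eq_mx_integral => r _.
Qed.

Lemma lin_solution_shift k l A G t0 c x0 (x : R -> 'M[R]_(k, l)) :
  lin_solution A G (t0 + c) x0 x ->
  lin_solution (fun t => A (t + c)) (fun t => G (t + c)) t0 x0
    (fun t => x (t + c)).
Proof.
move=> xP t tt; have [i1 e1] := xP (t + c) ltac:(by rewrite lerD2r).
split; first exact: mx_integrable_shift i1.
by rewrite e1 -(mx_integral_shift i1).
Qed.

Lemma lin_solutionN k l A G t0 x0 (x : R -> 'M[R]_(k, l)) :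
  lin_solution A G t0 x0 x ->
  lin_solution A (fun t => - G t) t0 (- x0) (fun t => - x t).
Proof.
move=> xP t tt; have [i1 e1] := xP t tt.
have EE r : - (A r *m x r + G r) = A r *m (- x r) + (- G r).
  by rewrite opprD mulmxN.
split; first by apply: eq_mx_integrable (mx_integrableN _ i1).
rewrite e1 opprD; congr (_ + _); apply/eqP; rewrite eq_sym -addr_eq0; apply/eqP.
have iN := mx_integrableN (measurable_itv `[t0, t]) i1.
rewrite -(eq_mx_integral (fun r _ => EE r)) -mx_integralD//.
by under eq_mx_integral do rewrite addNr; rewrite mx_integral0.
Qed.

Section bounds.
Variables (k l : nat) (A : R -> 'M[R]_k) (K : R).
Hypotheses (K0 : 0 < K) (cA : bounded_coef K A).
Implicit Types (G : R -> 'M[R]_(k, l)).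

Let int_bound G (x : R -> 'M[R]_(k, l)) t0 x0 s t : 0 <= t0 -> t0 <= s -> s <= t ->
  lin_solution A G t0 x0 x -> loc_integrable G ->
  norm1 (x t - x s) <=
    int s t (fun r => norm1 (G r)) + K * int s t (fun r => norm1 (x r)).
Proof.
move=> t00 ts st xP iG; have [i1 ->] := lin_solution_increment xP ts st.
rewrite addrAC subrr add0r; apply: le_trans (norm1_mx_integral _ i1) _ => //.
have iGs : mx_integrable `[s, t] G.
  by apply: mx_integrable_sub (iG t) => //; exact: le_trans ts.
have ix := lin_solution_integrable xP ts st.
have inx := integrable_norm1 (measurable_itv _) ix.
have inG := integrable_norm1 (measurable_itv _) iGs.
have iK : itg s t (fun r => K * norm1 (x r)).
  by have := @integrableZl _ _ _ mu _ _ K _ inx; apply.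
rewrite -RintegralZl// -RintegralD//.
apply: le_Rintegral => //; first exact: integrable_norm1.
  by have := @integrableD _ _ _ mu _ _ _ _ inG iK; apply.
move=> r; rewrite /= in_itv/= => /andP[sr _]; rewrite addrC.
have H : norm1 (A r *m x r) <= K * norm1 (x r).
  apply: le_trans (norm1M _ _) _; rewrite ler_wpM2r ?norm1_ge0//.
  by apply: cA.2; apply: le_trans sr; apply: le_trans ts.
exact: le_trans (norm1D _ _) (lerD (lexx _) H).
Qed.

Let solution_bounded G (x : R -> 'M[R]_(k, l)) t0 x0 b : t0 <= b -> lin_solution A G t0 x0 x ->
  exists S : R, forall t, t0 <= t <= b -> 0 <= norm1 (x t) <= S.
Proof.
move=> tb xP.
have [S [_ HS]] := continuous_mx_bounded (lin_solution_continuous xP tb).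
by exists S => t /HS ->; rewrite norm1_ge0.
Qed.

Lemma lin_solution_bound G (x : R -> 'M[R]_(k, l)) t0 x0 b t : 0 <= t0 -> t0 <= t <= b ->
  lin_solution A G t0 x0 x -> loc_integrable G ->
  norm1 (x t) <= 2 * (norm1 x0 + int t0 b (fun r => norm1 (G r))) *
                 expR (2 * K * (t - t0)).
Proof.
move=> t00 tt xP iG; have tb : t0 <= b by lra.
have [S HS] := solution_bounded tb xP.
have i0 : 0 <= int t0 b (fun r => norm1 (G r)).
  by apply: Rintegral_ge0 => ? _; exact: norm1_ge0.
move: t tt; apply: (@gronwall _ (fun t => norm1 (x t)) t0 b _ K S) => //.
- by rewrite addr_ge0// norm1_ge0.
- by apply: integrable_norm1 => //; apply: lin_solution_integrable xP _ tb.
move=> t /andP[tt tb']; have := int_bound t00 (lexx _) tt xP iG.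
rewrite (lin_solution_init xP) => h.
have : int t0 t (fun r => norm1 (G r)) <= int t0 b (fun r => norm1 (G r)).
  have iGb : mx_integrable `[t0, b] G.
    by apply: mx_integrable_sub (iG b).
  rewrite (Rintegral_chasles tt tb'); last exact: integrable_norm1.
  by rewrite lerDl; apply: Rintegral_ge0 => ? _; exact: norm1_ge0.
have := norm1D (x t - x0) x0; rewrite subrK.
lra.
Qed.

Lemma lin_solution_unique G (x x' : R -> 'M[R]_(k, l)) t0 x0 t : 0 <= t0 -> t0 <= t ->
  lin_solution A G t0 x0 x -> lin_solution A G t0 x0 x' -> x t = x' t.
Proof.
move=> t00 tt xP xP'; apply/eqP; rewrite -subr_eq0; apply/eqP/norm1_eq0.
have := lin_solutionD xP (lin_solutionN xP').
have -> : (fun t => G t - G t) = fun=> 0 by apply/funext => r; rewrite subrr.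
rewrite subrr => dP.
have iz : loc_integrable (fun=> 0 : 'M[R]_(k, l)) by move=> b; exact: mx_integrable0.
have := @lin_solution_bound (fun=> 0) _ t0 0 t t t00 _ dP iz.
rewrite tt lexx norm10 add0r => /(_ isT) /le_trans; apply.
by rewrite Rintegral_cst_segment// mul0r mulr0 mul0r.
Qed.

Lemma lin_solution_backward (x : R -> 'M[R]_(k, l)) t0 x0 s t : 0 <= t0 -> t0 <= s -> s <= t ->
  lin_solution A (fun=> 0) t0 x0 x ->
  norm1 (x s) <= 2 * norm1 (x t) * expR (2 * K * (t - s)).
Proof.
move=> t00 ts st xP; have tt := le_trans ts st.
have [S HS] := solution_bounded tt xP.
have iz : loc_integrable (fun=> 0 : 'M[R]_(k, l)) by move=> b; exact: mx_integrable0.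
have ss : t0 <= s <= t by rewrite ts st.
move: s ss {ts st}.
apply: (@gronwall_backward _ (fun t => norm1 (x t)) t0 t _ K S) => //.
- exact: norm1_ge0.
- by apply: integrable_norm1 => //; apply: lin_solution_integrable xP _ tt.
move=> s /andP[ts st]; have := int_bound t00 ts st xP iz.
rewrite (_ : (fun r => norm1 (0 : 'M[R]_(k, l))) = fun=> 0); last first.
  by apply/funext => r; rewrite norm10.
rewrite Rintegral_cst_segment// mul0r add0r => h.
have := norm1D (- (x t - x s)) (x t); rewrite norm1N opprB subrK; lra.
Qed.

End bounds.


Section flows.
Variables (k : nat) (A : R -> 'M[R]_k) (K : R).
Hypotheses (K0 : 0 < K) (cA : bounded_coef K A).

Lemma loc_integrable0 l : loc_integrable (fun=> 0 : 'M[R]_(k, l)).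
Proof. by move=> b; exact: mx_integrable0. Qed.

Lemma flow_solution s : 0 <= s ->
  lin_solution A (fun=> 0) s 1%:M (fun t => flow A t s).
Proof.
move=> s0.
have [x xP] := lin_solution_exists 1%:M K0 s0 cA (@loc_integrable0 k).
rewrite /flow /solution.
have -> : (fun r (X : 'M[R]_k) => A r *m X) = (fun r X => A r *m X + 0).
  by apply/funext => r; apply/funext => X; rewrite addr0.
by apply: (@getPex _ (is_solution (fun r (X : 'M[R]_k) => A r *m X + 0) s 1%:M)); exists x.
Qed.

Lemma flow_mul_solution l s (v : 'M[R]_(k, l)) : 0 <= s ->
  lin_solution A (fun=> 0) s v (fun t => flow A t s *m v).
Proof.
move=> s0; have := lin_solutionMr v (flow_solution s0); rewrite mul1mx.
by rewrite (_ : (fun=> 0 *m v) = fun=> 0)//; apply/funext => r; rewrite mul0mx.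
Qed.

Lemma lin_solution_flow l s t (x0 : 'M[R]_(k, l)) (x : R -> 'M[R]_(k, l)) :
  0 <= s -> s <= t ->
  lin_solution A (fun=> 0) s x0 x -> x t = flow A t s *m x0.
Proof.
move=> s0 st xP.
exact: (@lin_solution_unique k l A K K0 cA (fun=> 0) x
  (fun t => flow A t s *m x0) s x0 t s0 st xP (flow_mul_solution x0 s0)).
Qed.

Lemma flow_cocycle r s t : 0 <= r -> r <= s -> s <= t ->
  flow A t r = flow A t s *m flow A s r.
Proof.
move=> r0 rs st;
have := lin_solution_restart (flow_solution r0) rs.
by move=> /lin_solution_flow ->//; exact: le_trans rs.
Qed.

Lemma flow_refl s : 0 <= s -> flow A s s = 1%:M.
Proof. by move=> s0; exact: (lin_solution_init (flow_solution s0)). Qed.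

(** A kernel vector is the initial value of a solution that vanishes at time t, and the backward
    bound forces it to be 0. Transposes appear because [kermx] is a left kernel. *)
Lemma flow_unit s t : 0 <= s -> s <= t -> flow A t s \in unitmx.
Proof.
move=> s0 st; rewrite -unitmx_tr -row_free_unit -kermx_eq0.
apply/eqP/row_matrixP => i; rewrite row0.
set w := row i _; have : w *m (flow A t s)^T = 0.
  by apply/sub_kermxP; exact: row_sub.
move=> /(congr1 trmx); rewrite trmx_mul trmxK trmx0 => w0.
have := lin_solution_backward K0 cA s0 (lexx s) st (flow_mul_solution w^T s0).
rewrite /= flow_refl// mul1mx w0 norm10 mulr0 mul0r => /norm1_eq0.
by move=> /(congr1 trmx); rewrite trmxK trmx0.
Qed.

End flows.

Lemma flow_shift k (A : R -> 'M[R]_k) K c s t : 0 < K -> bounded_coef K A ->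
  bounded_coef K (fun r => A (r + c)) ->
  0 <= c -> 0 <= s -> s <= t ->
  flow (fun r => A (r + c)) t s = flow A (t + c) (s + c).
Proof.
move=> K0 cA cA' c0 s0 st.
have := lin_solution_shift (flow_solution K0 cA (addr_ge0 s0 c0)).
by move=> /(lin_solution_flow K0 cA' s0 st); rewrite mulmx1.
Qed.

Lemma flow_bound k (A : R -> 'M[R]_k) K l (v : 'M[R]_(k, l)) s t :
  0 < K -> bounded_coef K A -> 0 <= s -> s <= t ->
  norm1 (flow A t s *m v) <= 2 * norm1 v * expR (2 * K * (t - s)).
Proof.
move=> K0 cA s0 st.
have := @lin_solution_bound k l A K K0 cA _ _ s v t t s0 _
  (flow_mul_solution K0 cA v s0) (@loc_integrable0 k l).
by rewrite st lexx norm10 Rintegral_cst_segment// mul0r addr0; apply.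
Qed.

End linear_solutions.

(** * Signals with dwell time *)

Section signals.
Context {R : realType}.
Implicit Types (a b t : R).

(** Near t only finitely many values are taken. Those other than [sigma t] form a closed set, whose
    complement is a neighbourhood of [sigma t]; continuity at t then leaves only the value
    [sigma t]. *)
Lemma locally_constant (T : topologicalType) (sigma : R -> T) t :
  hausdorff_space T -> piecewise_constant sigma -> time t ->
  ~ switching_times sigma t ->
  \forall s \near within time (nbhs t), sigma s = sigma t.
Proof.
move=> hT pc tt nsw.
have cvt : sigma @ within time (nbhs t) --> sigma t.
  by apply: contrapT => ncv; apply: nsw.
have [_ fF] := pc (t - 1) (t + 1).
set F := (X in finite_set X) in fF.
have cF : closed (F `\ sigma t).
  apply: (accessible_finite_set_closed (T := T)).1.
    exact: hausdorff_accessible.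
  by apply: sub_finite_set fF => x [].
have oF : nbhs (sigma t) (~` (F `\ sigma t)).
  apply: open_nbhs_nbhs; split; first exact: closed_openC.
  by case=> _; apply.
have h1 : \forall s \near within time (nbhs t), (~` (F `\ sigma t)) (sigma s).
  exact: (cvt _ oF).
have h2 : \forall s \near within time (nbhs t), s \in `[t - 1, t + 1]%R /\ time s.
  apply/nbhs_ballP; exists 1 => //= s; rewrite /ball/= => st ts; split => //.
  by rewrite in_itv/=; move: st; rewrite ltr_norml => /andP[? ?]; apply/andP; split; lra.
apply: filterS2 h1 h2 => s h1 [h2 h3]; apply: contrapT => ne; apply: h1.
by split => //; exists s.
Qed.

(** The map [g] is arbitrary, since off its switching times [sigma] is locally constant. Signals can
    thus be composed with mere choice functions, as needed to lift them along a surjection of the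
    value sets. *)
Lemma switching_times_comp (T T' : topologicalType) (g : T -> T') (sigma : R -> T) :
  hausdorff_space T -> piecewise_constant sigma ->
  switching_times (g \o sigma) `<=` switching_times sigma.
Proof.
move=> hT pc t [tt nc]; apply: contrapT => nsw; apply: nc.
have := locally_constant hT pc tt nsw => lc.
apply: cvg_near_cst; apply: filterS lc => s /= -> //.
Qed.

Lemma dwell_signals_comp (T T' : topologicalType) (g : T -> T') (sigma : R -> T)
    tau (N : set T) (N' : set T') :
  hausdorff_space T -> (forall S, N S -> N' (g S)) ->
  dwell_signals tau N sigma -> dwell_signals tau N' (g \o sigma).
Proof.
move=> hT NN [pc vN dw]; have sw := @switching_times_comp _ _ g _ hT pc.
split.
- move=> a b; have [f1 f2] := pc a b; split.
    by apply: sub_finite_set f1 => t [/sw].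
  by rewrite -(image_comp sigma g); apply: finite_image.
- by move=> t tt; apply/NN/vN.
- by move=> s t /sw ss /sw st; exact: dw.
Qed.

Lemma near_time_shift (Q : set R) t c :
  (\forall s \near nbhs t, time s -> time (s + c)) ->
  (\forall s \near within time (nbhs (t + c)), Q s) ->
  \forall s \near within time (nbhs t), Q (s + c).
Proof.
move=> tc /nbhs_ballP[e /= e0 eQ].
have : \forall s \near nbhs t, ball t e s by exact: nbhsx_ballx.
apply: filterS2 tc => s tc ts st; apply: eQ; last exact: tc.
by move: ts; rewrite /ball/= opprD addrACA subrr addr0.
Qed.

(** The inclusion may be strict: at time 0 of the shifted signal continuity is one-sided, so a
    discontinuity of [sigma] at c from the left only is lost. *)
Lemma switching_times_shift (T : topologicalType) (sigma : R -> T) (c : R) : 0 <= c ->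
  switching_times (fun t => sigma (t + c)) `<=`
  [set t | switching_times sigma (t + c)].
Proof.
move=> c0 t [tt nc].
have tc s : time s -> time (s + c).
  by rewrite /time/= !in_itv/= !andbT => ?; apply: addr_ge0.
split; first exact: tc.
move=> cv; apply: nc => P /cv hP.
by apply: (@near_time_shift (fun s => P (sigma s))) => //; apply: nearW.
Qed.

Lemma dwell_signals_shift (T : topologicalType) (sigma : R -> T) tau
  (N : set T) (c : R) : 0 <= c -> dwell_signals tau N sigma ->
  dwell_signals tau N (fun t => sigma (t + c)).
Proof.
move=> c0 [pc vN dw]; have sw := @switching_times_shift T sigma c c0.
have tc t : time t -> time (t + c).
  by rewrite /time/= !in_itv/= !andbT => ?; apply: addr_ge0.
split.
- move=> a b; have [f1 f2] := pc (a + c) (b + c); split.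
    apply: sub_finite_set (finite_image (fun t => t - c) f1).
    move=> t [/sw st tab]; exists (t + c); last by rewrite addrK.
    by split => //; move: tab; rewrite /= !in_itv/= !lerD2r.
  apply: sub_finite_set f2 => _ [t [tt tab] <-]; exists (t + c) => //.
  by split; [exact: tc|move: tab; rewrite /= !in_itv/= !lerD2r].
- by move=> t tt; apply/vN/tc.
- move=> s t /sw ss /sw st st'; have := dw _ _ ss st.
  rewrite (inj_eq (@addIr _ _)) => /(_ st'); congr (_ <= `|_|).
  by ring.
Qed.

(** At [b] the value is already that of [sigma] at 0. The coefficients agree with the constant ones
    on [0, b[ only, which is why solutions are later compared up to an endpoint. *)
Definition prefix_signal (T : Type) (b : R) (S : T) (sigma : R -> T) t :=
  if t < b then S else sigma (t - b).

Lemma switching_times_prefix (T : topologicalType) (b : R) (S : T)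
    (sigma : R -> T) t :
  switching_times (prefix_signal b S sigma) t ->
  t = b \/ b < t /\ switching_times sigma (t - b).
Proof.
move=> [tt nc]; case: (ltgtP t b) => [tb|bt|]; [exfalso|right|by left].
  apply: nc; apply: cvg_near_cst; apply: cvg_within; rewrite /prefix_signal tb.
  have := lt_nbhsl tb; apply: filterS => s /= -> //.
split => //; split; first by rewrite /time/= in_itv/= andbT; lra.
move=> cv; apply: nc => P; rewrite {1}/prefix_signal ltNge (ltW bt)/= => /cv hP.
have bs : \forall s \near nbhs t, b < s by exact: lt_nbhsr.
have := @near_time_shift (fun s => P (sigma s)) t (- b) _ hP.
have H : \forall s \near nbhs t, time s -> time (s - b).
  by apply: filterS bs => s bs _; rewrite /time/= in_itv/= andbT subr_ge0 ltW.
have bs' : within time (nbhs t) (fun s => b < s) by apply: filterS bs.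
rewrite -/(within time (nbhs t) (fun s => P (prefix_signal b S sigma s))).
move=> /(_ H); apply: filterS2 bs' => s /= bs'.
by rewrite /prefix_signal ltNge (ltW bs').
Qed.

(** The junction at [b] may be a new switching time, so the later ones have to be at least [tau]
    away from it. A switching time 0 of [sigma] is exempt: it lands on the junction itself. *)
Lemma dwell_signals_prefix (T : topologicalType) (sigma : R -> T) (tau b : R)
    (N : set T) (S : T) : 0 < b -> tau <= b -> N S ->
  (forall t, switching_times sigma t -> 0 < t -> tau <= t) ->
  dwell_signals tau N sigma -> dwell_signals tau N (prefix_signal b S sigma).
Proof.
move=> b0 tb NS sw0 [pc vN dw].
have sw := @switching_times_prefix T b S sigma.
split.
- move=> x y; have [f1 f2] := pc (x - b) (y - b); split.
    have f3 := finite_image (fun t => t + b) f1.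
    have f4 : finite_set ([set b] `|` [set t + b | t in switching_times sigma `&` `[(x - b)%R, (y - b)%R]]).
      by rewrite finite_setU; split.
    apply: sub_finite_set f4 => t [/sw[->|[bt st]] txy]; [by left|right].
    exists (t - b); last by rewrite subrK.
    by split => //; move: txy; rewrite /= !in_itv/= !lerD2r.
  have f3 : finite_set ([set S] `|` [set sigma x | x in time `&` `[x - b, y - b]]).
    by rewrite finite_setU; split.
  apply: sub_finite_set f3 => _ [t [tt txy] <-]; rewrite /prefix_signal.
  case: ltP => tb'; [by left|right]; exists (t - b) => //; split.
    by rewrite /time/= in_itv/= andbT subr_ge0.
  by move: txy; rewrite /= !in_itv/= !lerD2r.
- move=> t tt; rewrite /prefix_signal; case: ltP => // tb'; apply: vN.
  by rewrite /time/= in_itv/= andbT subr_ge0.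
- have aux s t : s = b -> b < t -> switching_times sigma (t - b) -> tau <= `|s - t|.
    move=> -> bt st; rewrite distrC ger0_norm; last by rewrite subr_ge0 ltW.
    by apply: sw0 => //; rewrite subr_gt0.
  move=> s t /sw[->|[bs ss]] /sw[->|[bt st]] st'.
  + by rewrite eqxx in st'.
  + exact: aux.
  + by rewrite distrC; exact: aux.
  + have := dw _ _ ss st; rewrite (inj_eq (@addIr _ _)) => /(_ st').
    by congr (_ <= `|_|); ring.
Qed.

Lemma dwell_signals_cst (T : topologicalType) (tau : R) (N : set T) (S : T) :
  N S -> dwell_signals tau N (fun=> S).
Proof.
move=> NS; have sw0 t : ~ switching_times (fun=> S) t.
  by case=> _; apply; exact: cvg_cst.
split => //.
- move=> a b; split.
    by rewrite (_ : _ `&` _ = set0)//; apply/seteqP; split => // t [/sw0].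
  by apply: sub_finite_set (finite_set1 S) => _ [t _ <-].
- by move=> s t /sw0.
Qed.

(* A switching time in ]0, tau[ is followed by a dwell of length tau. *)
Lemma dwell_signals_first_switch (T : topologicalType) (sigma : R -> T) (tau : R)
    (N : set T) : 0 <= tau -> dwell_signals tau N sigma ->
  exists s, [/\ 0 <= s, s <= tau &
    forall t, switching_times (fun t => sigma (t + s)) t -> 0 < t -> tau <= t].
Proof.
move=> tau0 [_ _ dw].
have [[s [ss s0 st]]|H] := pselect (exists s, [/\ switching_times sigma s, 0 < s & s < tau]).
  exists s; split; [exact: ltW|exact: ltW|].
  move=> t /(switching_times_shift (ltW s0)) /= st' t0.
  have := dw _ _ st' ss; rewrite addrK (ger0_norm (ltW t0)); apply.
  by rewrite -subr_eq0 addrK gt_eqF.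
exists 0; split => // t /(switching_times_shift (lexx 0)) /=; rewrite addr0 => st t0.
by rewrite leNgt; apply/negP => tt; apply: H; exists t; split.
Qed.

Lemma countable_switching_times (T : topologicalType) (sigma : R -> T) :
  piecewise_constant sigma -> countable (switching_times sigma).
Proof.
move=> pc.
have : countable (\bigcup_(n in [set: nat]) (switching_times sigma `&` `[0, n%:R])).
  apply: bigcup_countable => // n _; apply: finite_set_countable.
  exact: (pc 0 n%:R).1.
apply: sub_countable; apply: subset_card_le => t st.
have [n nt] : exists n : nat, t <= n%:R.
  by exists (Num.trunc t).+1; apply: ltW; exact: truncnS_gt.
exists n => //; split => //; case: st => + _.
by rewrite /time/= !in_itv/= andbT => ->.
Qed.

(** Away from the switching times, local constancy makes the preimage of every set open relative to
    [time]; the switching times themselves are countable. This works for an arbitrary function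
    [g]. *)
Lemma piecewise_constant_measurable (T : topologicalType) (sigma : R -> T)
    (g : T -> R) : hausdorff_space T -> piecewise_constant sigma ->
  measurable_fun time (fun t => g (sigma t)).
Proof.
move=> hT pc mT Y mY.
set D := switching_times sigma.
have cD : countable D by exact: countable_switching_times.
set f := fun t => g (sigma t).
pose O := (interior [set t | time t -> Y (f t)]).
have -> : time `&` f @^-1` Y = ((time `\` D) `&` O) `|` (D `&` f @^-1` Y).
  apply/seteqP; split => t.
    move=> [tt Yt]; have [Dt|nDt] := pselect (D t); [by right|left].
    split => //.
    have : \forall s \near nbhs t, time s -> sigma s = sigma t.
      exact: (locally_constant hT pc tt nDt).
    by apply: filterS => s ss ts; rewrite /f ss.
  move=> [[[tt nDt] Ot]|[Dt Yt]]; split => //; last by case: Dt.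
  by apply: (interior_subset Ot).
have mc A : countable A -> measurable (A : set R).
  by apply: countable_measurable => t; exact: measurable_set1.
apply: measurableU; last first.
  by apply: mc; apply: sub_countable cD; apply: subset_card_le => t [].
apply: measurableI; first by apply: measurableD => //; exact: mc.
by apply: open_measurable; exact: open_interior.
Qed.

End signals.

(** * Minimal realizations *)

Section realizations.
Context {R : realType}.

Lemma mem_sum_col n (P : 'M[R]_n) (J : pred 'I_n) (v : 'cV[R]_n) :
  P \in unitmx ->
  reflect (forall j, ~~ J j -> (invmx P *m v) j ord0 = 0)
    (v \in (\sum_(j < n | J j) <[col j P]>)%VS).
Proof.
move=> uP; apply: (iffP idP) => [vV j nJ|H].
  have sub : ((\sum_(j < n | J j) <[col j P]>) <=
    lker (linfun (mulmx (delta_mx ord0 j *m invmx P : 'rV[R]_n)) : 'Hom('cV[R]_n, 'cV[R]_1)))%VS.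
    apply/subv_sumP => i Ji; rewrite -memvE memv_ker lfunE/= colE !mulmxA.
    rewrite mulmxKV// mul_delta_mx_cond (_ : (j == i) = false) ?mulr0n//.
    by apply: contraNF nJ => /eqP ->.
  have := subvP sub _ vV; rewrite memv_ker lfunE/= -mulmxA -rowE => /eqP/matrixP/(_ 0 0).
  by rewrite !mxE.
rewrite -(mulKVmx uP v); set w := invmx P *m v in H *.
have -> : P *m w = \sum_(j < n | J j) w j 0 *: col j P.
  apply/matrixP => i j; rewrite ord1 mxE (bigID J)/= [X in _ + X]big1 ?addr0; last first.
    by move=> k nJ; rewrite H ?mulr0.
  by rewrite summxE; apply: eq_bigr => k _; rewrite !mxE mulrC.
by apply: memv_sumr => j Jj; rewrite memvZ ?memv_line.
Qed.

Lemma pid_mx_mul m n r l (w : 'M[R]_(n, l)) (i : 'I_m) j (H : (i < n)%N) :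
  ((pid_mx r : 'M[R]_(m, n)) *m w) i j = (i < r)%:R * w (Ordinal H) j.
Proof.
rewrite mxE (bigD1 (Ordinal H))//= big1 ?addr0 => [|k]; first by rewrite mxE eqxx.
by rewrite mxE -val_eqE/= eq_sym => /negPf ->; rewrite mul0r.
Qed.

Lemma pid_mx_mul0 m n r l (w : 'M[R]_(n, l)) (i : 'I_m) j :
  ~~ (i < r)%N -> ((pid_mx r : 'M[R]_(m, n)) *m w) i j = 0.
Proof.
move=> ir; rewrite mxE big1// => k _; rewrite mxE.
by rewrite (negPf ir) andbF mul0r.
Qed.

Lemma norm1_le_norm k l (X : 'M[R]_(k, l)) : norm1 X <= k%:R * l%:R * `|X|.
Proof.
rewrite /norm1 -mulrA mulr_natl -[X in _ *+ X]card_ord -sumr_const.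
apply: ler_sum => i _; rewrite mulr_natl -[X in _ *+ X]card_ord -sumr_const.
apply: ler_sum => j _; rewrite [leRHS]mx_normrE.
exact: (le_bigmax _ (fun ij : 'I_k * 'I_l => `|X ij.1 ij.2|) (i, j)).
Qed.

Definition system_bound n m p (K : R) (S : system R n m p) :=
  [/\ norm1 (mxA S) <= K, norm1 (mxB S) <= K & norm1 (mxC S) <= K].

Lemma bounded_system_bound n m p (M : set (system R n m p)) :
  bounded_set M -> exists K : R, 0 < K /\ forall S, M S -> system_bound K S.
Proof.
case=> K0 [_ HK]; set K1 := `|K0| + 1.
have K10 : 0 <= K1 by rewrite addr_ge0.
have H S : M S -> `|S| <= K1.
  by apply: HK; rewrite (le_lt_trans (ler_norm _))// ltrDl.
pose K := (n%:R * n%:R + n%:R * m%:R + p%:R * n%:R) * K1 + 1.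
exists K; split; first by rewrite ltr_wpDl// !(addr_ge0, mulr_ge0).
have h1 : 0 <= n%:R * n%:R :> R by rewrite mulr_ge0.
have h2 : 0 <= n%:R * m%:R :> R by rewrite mulr_ge0.
have h3 : 0 <= p%:R * n%:R :> R by rewrite mulr_ge0.
have aux k l (X : 'M[R]_(k, l)) : `|X| <= K1 ->
    k%:R * l%:R <= n%:R * n%:R + n%:R * m%:R + p%:R * n%:R :> R -> norm1 X <= K.
  move=> XK kl; apply: le_trans (norm1_le_norm _) _.
  rewrite /K; apply: (@le_trans _ _ (k%:R * l%:R * K1)).
    by apply: ler_wpM2l; rewrite ?mulr_ge0.
  by rewrite ler_wpDr// ler_wpM2r.
move=> [[A B] C] /H; rewrite prod_normE/= ge_max prod_normE/= ge_max.
move=> /andP[/andP[AK BK] CK]; split; apply: aux => //; lra.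
Qed.

Lemma truncate_bound n m p k (P : 'M[R]_n) : exists C : R, 1 <= C /\
  forall K (S : system R n m p), 0 <= K -> system_bound K S ->
  system_bound (C * K) (truncate k P S).
Proof.
pose X := (pid_mx k : 'M[R]_(k, n)) *m invmx P.
pose Y := P *m (pid_mx k : 'M[R]_(k, n))^T.
have X0 := norm1_ge0 X; have Y0 := norm1_ge0 Y.
exists ((1 + norm1 X) * (1 + norm1 Y)); split; first by nra.
have XY0 : 0 <= norm1 X * norm1 Y by exact: mulr_ge0.
move=> K S K0 [AK BK CK]; rewrite /system_bound /truncate /mxA /mxB /mxC /=.
split.
- rewrite -/X -[X *m _ *m P *m _]mulmxA -/Y.
  apply: le_trans (norm1M _ _) _; apply: (@le_trans _ _ (norm1 X * K * norm1 Y)).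
    rewrite ler_wpM2r//; apply: le_trans (norm1M _ _) _.
    by rewrite ler_wpM2l.
  rewrite mulrAC ler_wpM2r//; lra.
- rewrite -/X; apply: le_trans (norm1M _ _) _.
  apply: (@le_trans _ _ (norm1 X * K)); first by rewrite ler_wpM2l.
  by rewrite ler_wpM2r//; lra.
- rewrite -mulmxA -/Y; apply: le_trans (norm1M _ _) _.
  apply: (@le_trans _ _ (norm1 Y * K)); first by rewrite mulrC ler_wpM2l.
  by rewrite ler_wpM2r//; lra.
Qed.

Lemma system_bound_le n m p (K K' : R) (S : system R n m p) : K <= K' ->
  system_bound K S -> system_bound K' S.
Proof. by move=> KK [? ? ?]; split; apply: le_trans KK. Qed.

(** The two reductions run in opposite directions: [E] embeds the controllable coordinates into the
    original space, [L] projects the same coordinates onto the reduced space. Original and reduced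
    states are therefore compared through the intermediate system. The last clause, controllability
    of the reduced system, is the form in which minimality is used later. *)
Lemma realization_maps n m p (M : set (system R n m p)) n'
    (Mmin : set (system R n' m p)) : bounded_set M ->
  minimal_realization M Mmin ->
  exists r (E : 'M[R]_(n, r)) (L : 'M[R]_(n', r))
    (f : system R n m p -> system R r m p) (g : system R r m p -> system R n' m p)
    (K : R),
  [/\ Mmin = g @` (f @` M),
      forall S, M S ->
        [/\ mxA S *m E = E *m mxA (f S), mxB S = E *m mxB (f S)
          & mxC S *m E = mxC (f S)],
      forall S, M S ->
        [/\ L *m mxA (f S) = mxA (g (f S)) *m L, L *m mxB (f S) = mxB (g (f S))
          & mxC (f S) = mxC (g (f S)) *m L],
      0 < K /\ forall S, M S -> [/\ system_bound K S, system_bound K (f S) & system_bound K (g (f S))]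
    & forall W : {vspace 'cV[R]_n'}, contains_ranges Mmin W ->
        A_invariant Mmin W -> forall v, v \in W].
Proof.
move=> bM [V [P /= [[VB VA Vmin] uP PV]]].
set r := \dim V in PV *; set Mc := _ @` M.
move=> [N [Q [[NC NA _] n'E uQ QN Mmin_eq]]].
have rn : (r <= n)%N.
  have := dimvS (subvf V); rewrite dimvf /dim/= muln1//.
have n'r : (n' <= r)%N by rewrite n'E leq_subr.
pose U : 'M[R]_(r, n) := pid_mx r.
pose Vp : 'M[R]_(n', r) := pid_mx n'.
pose E := P *m U^T; pose L := Vp *m invmx Q; pose F := Q *m Vp^T.
pose f := truncate (m := m) (p := p) r P; pose g := truncate (m := m) (p := p) n' Q.
have EV z : E *m z \in V.
  rewrite -PV; apply/(mem_sum_col _ _ uP) => j jr.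
  rewrite /E -mulmxA mulKmx// /U tr_pid_mx.
  exact: pid_mx_mul0.
(* [U *m invmx P] reads off the first r coordinates; on [V] the others vanish, so [E] restores the
   vector. *)
have VE v : v \in V -> E *m (U *m invmx P *m v) = v.
  rewrite -PV => /(mem_sum_col _ _ uP) H.
  rewrite /E -mulmxA -[U *m _ *m _]mulmxA [U^T *m _]mulmxA /U tr_pid_mx pid_mx_id//.
  rewrite -[RHS](mulKVmx uP); congr (_ *m _); apply/matrixP => i j; rewrite ord1.
  rewrite (pid_mx_mul _ _ _ (ltn_ord i)).
  have -> : Ordinal (ltn_ord i) = i by apply: val_inj.
  by have [_|/H ->] := boolP (i < r)%N; rewrite ?mul1r ?mulr0.
have LN z : (L *m z == 0) = (z \in N).
  rewrite -QN; apply/eqP/(mem_sum_col _ _ uQ) => [Lz j|H].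
    rewrite -ltnNge => jn.
    have : (L *m z) (Ordinal jn) ord0 = 0 by rewrite Lz mxE.
    rewrite /L -mulmxA (@pid_mx_mul _ _ _ _ _ (Ordinal jn) _ (ltn_ord j)).
    rewrite jn mul1r => <-.
    by congr (fun_of_matrix _ _ _); apply: val_inj.
  apply/matrixP => i j; rewrite ord1 /L -mulmxA.
  have ir : (i < r)%N by apply: leq_trans n'r.
  by rewrite (pid_mx_mul _ _ _ ir) [RHS]mxE H ?mulr0//= -ltnNge.
have UE : U *m invmx P *m E = 1%:M.
  by rewrite /E mulmxA mulmxKV// /U tr_pid_mx pid_mx_id// pid_mx_1.
have LF : L *m F = 1%:M.
  by rewrite /F mulmxA mulmxKV// /Vp tr_pid_mx pid_mx_id// pid_mx_1.
have colE' k l (X Y : 'M[R]_(k, l)) :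
    (forall v : 'cV[R]_l, X *m v = Y *m v) -> X = Y.
  move=> XY; apply/trmx_inj/row_matrixP => i; apply: trmx_inj.
  by rewrite -!tr_col !trmxK !colE.
have fE S : M S -> [/\ mxA S *m E = E *m mxA (f S), mxB S = E *m mxB (f S)
          & mxC S *m E = mxC (f S)].
  move=> MS; rewrite /f /truncate /mxA /mxB /mxC /=; split.
  - apply: colE' => v; rewrite -mulmxA.
    by apply: etrans (esym (VE _ (VA S MS _ (EV v)))) _; rewrite /E /U /mxA !mulmxA.
  - apply: colE' => v.
    by apply: etrans (esym (VE _ (VB S MS v))) _; rewrite /E /U /mxB !mulmxA.
  - by rewrite mulmxA.
have gE S : Mc S ->
        [/\ L *m mxA S = mxA (g S) *m L, L *m mxB S = mxB (g S)
          & mxC S = mxC (g S) *m L].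
  (* [F] is a right inverse of [L], so v - FLv lies in the kernel [N] of [L]. Invariance of [N] lets
     A pass to the quotient, and C does so because it vanishes on [N]. *)
  move=> MS; have NFL (v : 'cV[R]_r) : v - F *m (L *m v) \in N.
    by rewrite -LN mulmxBr (mulmxA L F) LF mul1mx subrr.
  rewrite /g /truncate /mxA /mxB /mxC /=; split => //.
  - apply: colE' => v.
    have : mxA S *m (v - F *m (L *m v)) \in N by apply: NA => //; exact: NFL.
    rewrite -LN !mulmxBr subr_eq0 => /eqP.
    by rewrite /L /F /mxA !mulmxA.
  - apply: colE' => v.
    have : mxC S *m (v - F *m (L *m v)) = 0 by apply: NC => //; exact: NFL.
    rewrite !mulmxBr => /eqP; rewrite subr_eq0 => /eqP.
    by rewrite /L /F /mxC !mulmxA.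
have [K1 [K10 MK]] := bounded_system_bound bM.
have [C1 [C11 HC1]] := @truncate_bound n m p r P.
have [C2 [C21 HC2]] := @truncate_bound r m p n' Q.
(* The factors [C1] and [C2] are at least 1, so the bound for the reduced system also covers the
   original and the intermediate one. *)
exists r, E, L, f, g, (C2 * (C1 * K1)); split => //.
- by move=> S MS; apply: gE; exists S.
- split; first by rewrite !mulr_gt0//; lra.
  have C1K1 : K1 <= C1 * K1 by nra.
  have C2K1 : C1 * K1 <= C2 * (C1 * K1) by nra.
  move=> S MS; have b1 := MK S MS; have b2 := HC1 _ _ (ltW K10) b1.
  have C10 : 0 <= C1 * K1 by lra.
  have b3 := HC2 _ _ C10 b2; split => //.
    by apply: system_bound_le b1; exact: le_trans C2K1.
  by apply: system_bound_le b2.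
move=> W WB WA.
(* The image under [E] of the preimage of [W] under [L] contains the ranges of all B and is
   invariant under all A of the original system, hence contains [V]. As [E] is injective and [L] is
   onto, [W] is the whole space. *)
pose W0 := (linfun (mulmx E) @: (linfun (mulmx L) @^-1: W))%VS : {vspace 'cV[R]_n}.
have W0P z : L *m z \in W -> E *m z \in W0.
  move=> LzW; rewrite -[E *m z](lfunE (mulmx E)); apply: memv_img.
  by rewrite -memv_preim lfunE.
have VW0 : (V <= W0)%VS.
  apply: Vmin => S MS.
    move=> w; have [_ -> _] := fE S MS; rewrite -mulmxA; apply: W0P.
    have [_ e _] := gE (f S) (ex_intro2 _ _ S MS erefl).
    by rewrite mulmxA e; apply: WB; rewrite Mmin_eq; exists (f S) => //; exists S.
  move=> v /memv_imgP[z]; rewrite -memv_preim !lfunE/= => zW ->.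
  have [e1 _ _] := fE S MS; rewrite mulmxA e1 -mulmxA; apply: W0P.
  have [e _ _] := gE (f S) (ex_intro2 _ _ S MS erefl).
  rewrite mulmxA e -mulmxA; apply: WA => //.
  by rewrite Mmin_eq; exists (f S) => //; exists S.
move=> v; have := subvP VW0 _ (EV (F *m v)).
move=> /memv_imgP[z]; rewrite -memv_preim !lfunE/= => zW.
move=> /(congr1 (mulmx (U *m invmx P))); rewrite [LHS](mulmxA _ E) [RHS](mulmxA _ E) UE !mul1mx => Fz.
by move: zW; rewrite -Fz mulmxA LF mul1mx.
Qed.
End realizations.

(** * Energy and L2-gain *)

Section euclidean_norm.
Context {R : realType}.

Definition sqn k (v : 'cV[R]_k) : R := \sum_i v i ord0 ^+ 2.

Lemma sqn_ge0 k (v : 'cV[R]_k) : 0 <= sqn v.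
Proof. by apply: sumr_ge0 => i _; exact: sqr_ge0. Qed.

Lemma enorm_sq k (v : 'cV[R]_k) : enorm v ^+ 2 = sqn v.
Proof. by rewrite sqr_sqrtr ?sqn_ge0. Qed.

Lemma enorm_ge0 k (v : 'cV[R]_k) : 0 <= enorm v.
Proof. exact: sqrtr_ge0. Qed.

Lemma enorm_le k l (v : 'cV[R]_k) (w : 'cV[R]_l) (c : R) : 0 <= c ->
  (enorm v <= c * enorm w) = (sqn v <= c ^+ 2 * sqn w).
Proof.
move=> c0; rewrite -!enorm_sq -exprMn ler_pXn2r// nnegrE ?enorm_ge0//.
by rewrite mulr_ge0 ?enorm_ge0.
Qed.

Lemma sqnD k (v w : 'cV[R]_k) : sqn (v + w) <= 2 * (sqn v + sqn w).
Proof.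
rewrite /sqn -big_split/= mulr_sumr; apply: ler_sum => i _; rewrite mxE.
have := sqr_ge0 (v i ord0 - w i ord0); nra.
Qed.

Lemma sqnZ k (a : R) (v : 'cV[R]_k) : sqn (a *: v) = a ^+ 2 * sqn v.
Proof.
by rewrite /sqn mulr_sumr; apply: eq_bigr => i _; rewrite mxE exprMn.
Qed.

Lemma sqn_entry k (v : 'cV[R]_k) i : v i ord0 ^+ 2 <= sqn v.
Proof.
by rewrite /sqn (bigD1 i)//= lerDl; apply: sumr_ge0 => j _; exact: sqr_ge0.
Qed.

Lemma norm1_col k (v : 'cV[R]_k) : norm1 v = \sum_i `|v i ord0|.
Proof. by apply: eq_bigr => i _; rewrite big_ord1. Qed.

Lemma sqn_le_norm1 k (v : 'cV[R]_k) : sqn v <= norm1 v ^+ 2.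
Proof.
rewrite norm1_col expr2 mulr_suml; apply: ler_sum => i _.
rewrite -real_normK ?num_real// expr2 ler_wpM2l//.
by rewrite (bigD1 i)//= lerDl; apply: sumr_ge0.
Qed.

Lemma norm1_le_enorm k (v : 'cV[R]_k) : norm1 v <= k%:R * enorm v.
Proof.
rewrite norm1_col mulr_natl -[X in _ *+ X]card_ord -sumr_const.
apply: ler_sum => i _.
rewrite -(ler_pXn2r (n := 2)) ?nnegrE ?enorm_ge0//.
by rewrite real_normK ?num_real// enorm_sq sqn_entry.
Qed.

Lemma norm1_sq_le k (v : 'cV[R]_k) : norm1 v ^+ 2 <= k%:R ^+ 2 * sqn v.
Proof.
rewrite -enorm_sq -exprMn ler_pXn2r ?nnegrE ?norm1_ge0 ?mulr_ge0 ?enorm_ge0//.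
exact: norm1_le_enorm.
Qed.

Lemma sqnM k l (X : 'M[R]_(k, l)) (v : 'cV[R]_l) :
  sqn (X *m v) <= (norm1 X * l%:R) ^+ 2 * sqn v.
Proof.
apply: le_trans (sqn_le_norm1 _) _.
apply: (@le_trans _ _ ((norm1 X * norm1 v) ^+ 2)).
  by rewrite ler_pXn2r ?nnegrE ?mulr_ge0 ?norm1_ge0// norm1M.
by rewrite !exprMn -[leRHS]mulrA ler_wpM2l ?sqr_ge0// norm1_sq_le.
Qed.

Lemma enormM k l (X : 'M[R]_(k, l)) (v : 'cV[R]_l) :
  enorm (X *m v) <= norm1 X * l%:R * enorm v.
Proof. by rewrite enorm_le ?sqnM// mulr_ge0 ?norm1_ge0. Qed.

Lemma enorm0 k : enorm (0 : 'cV[R]_k) = 0.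
Proof.
by rewrite /enorm big1 ?sqrtr0// => i _; rewrite mxE expr0n.
Qed.

Lemma enorm_eq0 k (v : 'cV[R]_k) : enorm v = 0 -> v = 0.
Proof.
by move=> v0; apply: norm1_eq0; apply: le_trans (norm1_le_enorm _) _; rewrite v0 mulr0.
Qed.

Lemma enormZ k (a : R) (v : 'cV[R]_k) : 0 <= a -> enorm (a *: v) = a * enorm v.
Proof.
by move=> a0; rewrite /enorm -!/(sqn _) sqnZ sqrtrM ?sqr_ge0// sqrtr_sqr ger0_norm.
Qed.

Let opnorm_set k l (X : 'M[R]_(k, l)) :=
  [set enorm (X *m v) | v in [set v : 'cV[R]_l | enorm v <= 1]].

Lemma enorm_opnorm k l (X : 'M[R]_(k, l)) (v : 'cV[R]_l) :
  enorm (X *m v) <= opnorm X * enorm v.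
Proof.
have hs : has_sup (opnorm_set X).
  split; first by exists (enorm (X *m 0)), 0; rewrite //= enorm0.
  exists (norm1 X * l%:R) => _ [w /= w1 <-]; apply: le_trans (enormM _ _) _.
  by rewrite ler_piMr// mulr_ge0 ?norm1_ge0.
have := enorm_ge0 v; rewrite le_eqVlt => /predU1P[v0|v0].
  by rewrite (enorm_eq0 (esym v0)) mulmx0 !enorm0 mulr0.
have v0' := ltW v0.
rewrite -ler_pdivrMr// mulrC -enormZ ?invr_ge0// scalemxAr.
apply: sup_upper_bound => //; exists ((enorm v)^-1 *: v) => //=.
by rewrite enormZ ?invr_ge0// mulVf ?gt_eqF.
Qed.

Lemma opnorm_le k l (X : 'M[R]_(k, l)) (c : R) : 0 <= c ->
  (forall v, enorm (X *m v) <= c * enorm v) -> opnorm X <= c.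
Proof.
move=> c0 H; apply: ge_sup.
  by exists (enorm (X *m 0)), 0; rewrite //= enorm0.
by move=> _ [w /= w1 <-]; apply: le_trans (H w) _; rewrite ler_piMr.
Qed.

Lemma opnorm_ge0 k l (X : 'M[R]_(k, l)) : 0 <= opnorm X.
Proof.
have hs : has_sup (opnorm_set X).
  split; first by exists (enorm (X *m 0)), 0; rewrite //= enorm0.
  exists (norm1 X * l%:R) => _ [w /= w1 <-]; apply: le_trans (enormM _ _) _.
  by rewrite ler_piMr// mulr_ge0 ?norm1_ge0.
apply: le_trans (enorm_ge0 (X *m 0)) _.
by apply: sup_upper_bound => //; exists 0; rewrite //= enorm0.
Qed.

End euclidean_norm.

Section energy.
Context {R : realType}.
Local Notation mu := (@lebesgue_measure R).
Implicit Types (a b t g : R).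
Local Notation int a b f := (Rintegral mu `[a, b] f).
Local Notation itg a b f := (mu.-integrable `[a, b] (EFin \o f)).

Lemma measurable_time : measurable (time : set R).
Proof. exact: (measurable_itv `[0, +oo[). Qed.

(** The square of the L2 norm. Squares make energies additive over consecutive time windows. *)
Definition energy k (f : R -> 'cV[R]_k) : \bar R :=
  (\int[mu]_(t in time) (sqn (f t))%:E)%E.

Lemma energy_ge0 k (f : R -> 'cV[R]_k) : (0 <= energy f)%E.
Proof. by apply: integral_ge0 => t _; rewrite lee_fin sqn_ge0. Qed.

Lemma L2norm_energy k (f : R -> 'cV[R]_k) : L2norm f = (energy f `^ 2^-1)%E.
Proof.
rewrite /L2norm unlock /=; congr (_ `^ _)%E.
rewrite /energy [RHS]integral_mkcond; apply: eq_integral => t _.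
rewrite !patchE; case: ifP => _; last by rewrite abse0 poweR0r ?pnatr_eq0.
by rewrite /= ger0_norm ?enorm_ge0// powR_mulrn ?enorm_ge0// enorm_sq.
Qed.

Lemma L2_signal_energy k (u : R -> 'cV[R]_k) : L2_signal u -> L2norm u != 0%E ->
  exists2 U : R, 0 < U & energy u = U%:E.
Proof.
move=> [_]; rewrite L2norm_energy; have := energy_ge0 u.
case: (energy u) => [U| |]//=; last by rewrite gt_eqF ?invr_gt0.
rewrite lee_fin le_eqVlt => /predU1P[<- _|U0 _ _]; last by exists U.
by rewrite powR0 ?invr_neq0// eqxx.
Qed.

Lemma L2_ratio k l (y : R -> 'cV[R]_k) (u : R -> 'cV[R]_l) (U g : R) : 0 < U ->
  0 <= g -> energy u = U%:E ->
  (L2norm y / L2norm u <= g%:E)%E <-> (energy y <= (g ^+ 2 * U)%:E)%E.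
Proof.
move=> U0 g0 uU; rewrite !L2norm_energy uU /= powR12_sqrt ?(ltW U0)//.
have sU : 0 < Num.sqrt U by rewrite sqrtr_gt0.
rewrite inver gt_eqF//.
have := energy_ge0 y; case: (energy y) => [Y| |]//=.
  rewrite lee_fin => Y0; rewrite powR12_sqrt// -EFinM !lee_fin.
  rewrite ler_pdivrMr//.
  have gU : 0 <= g * Num.sqrt U by rewrite mulr_ge0// ltW.
  have -> : (Num.sqrt Y <= g * Num.sqrt U) = (Y <= g ^+ 2 * U).
    rewrite -[LHS](ler_pXn2r (n := 2)) ?nnegrE ?sqrtr_ge0//.
    by rewrite exprMn !sqr_sqrtr ?(ltW U0).
  by [].
move=> _; rewrite gt_eqF ?invr_gt0//.
by rewrite gt0_mulye ?lte_fin ?invr_gt0//; split; rewrite leye_eq.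
Qed.

(** The working form of a finite gain: the constant is the square of a bound on the gain, and the
    inequality involves neither quotients nor roots. *)
Lemma L2_gain_finite n m p (T : set (R -> system R n m p)) :
  (L2_gain T < +oo)%E <->
  exists2 g : R, 0 <= g & forall u sigma, L2_signal u -> L2norm u != 0%E ->
    T sigma -> (energy (output sigma u) <= (g * fine (energy u))%:E)%E.
Proof.
split=> [fin|[g g0 H]].
  have G0 : (0 <= L2_gain T)%E by apply: ereal_sup_ubound; left.
  have := ge0_fin_numE G0; rewrite fin => /fineK Gr.
  exists (fine (L2_gain T) ^+ 2); first exact: sqr_ge0.
  move=> u sigma Lu u0 Ts; have [U U0 uU] := L2_signal_energy Lu u0.
  rewrite uU /=; apply/(L2_ratio _ U0 _ uU); first exact: fine_ge0.
  by rewrite Gr; apply: ereal_sup_ubound; right; exists u, sigma.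
apply: (@le_lt_trans _ _ (Num.sqrt g)%:E); last exact: ltry.
apply: ge_ereal_sup => _ [->|[u [sigma [Lu u0 Ts ->]]]].
  by rewrite lee_fin sqrtr_ge0.
have [U U0 uU] := L2_signal_energy Lu u0.
apply/(L2_ratio _ U0 _ uU); first exact: sqrtr_ge0.
by rewrite sqr_sqrtr//; have := H _ _ Lu u0 Ts; rewrite uU.
Qed.

Lemma measurable_sqn k (D : set R) (f : R -> 'cV[R]_k) :
  mx_measurable D f -> measurable_fun D (fun t => sqn (f t)).
Proof.
move=> mf; apply: measurable_sum => i; apply: measurable_funX; exact: mf.
Qed.

Lemma energy_le k (f : R -> 'cV[R]_k) (c : R) : mx_measurable time f ->
  (forall n : nat, itg 0 n%:R (fun t => sqn (f t)) /\ int 0 n%:R (fun t => sqn (f t)) <= c) ->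
  (energy f <= c%:E)%E.
Proof.
move=> mf H.
have mz := @measurable_time.
pose h := (fun t => sqn (f t)) \_ time.
have h0 t : 0 <= h t by rewrite /h patchE; case: ifP => // _; exact: sqn_ge0.
have mh : measurable_fun setT h.
  by apply/(measurable_restrictT _ mz); exact: measurable_sqn.
have eh : energy f = (\int[mu]_(x in `[0%R, +oo[) (h x)%:E)%E.
  by apply: eq_integral => t tt; rewrite /h patchE tt.
have cv : (\int[mu]_(x in `[0%R, n%:R]) (h x)%:E)%E @[n --> \oo] --> energy f.
  by rewrite eh; exact: ge0_cvgn_integral.
apply: cvge_le cv; apply: nearW => n.
have [i1 i2] := H n.
have -> : (\int[mu]_(x in `[0%R, n%:R]) (h x)%:E =
    \int[mu]_(x in `[0%R, n%:R]) (sqn (f x))%:E)%E.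
  apply: eq_integral => t /set_mem; rewrite /= in_itv/= => /andP[t0 _].
  by rewrite /h patchE mem_set// /time/= in_itv/= t0.
rewrite -(fineK (integrable_fin_num _ i1))// lee_fin//.
Qed.

Lemma energy_ge k (f : R -> 'cV[R]_k) b : mx_measurable time f ->
  (energy f < +oo)%E ->
  itg 0 b (fun t => sqn (f t)) /\ ((int 0 b (fun t => sqn (f t)))%:E <= energy f)%E.
Proof.
move=> mf fin.
have mz := @measurable_time.
have sub : `[0, b]%classic `<=` time.
  by move=> t; rewrite /time /= !in_itv/= => /andP[-> _].
have it : mu.-integrable time (fun t => (sqn (f t))%:E).
  apply/integrableP; split; first by apply/measurable_EFinP; exact: measurable_sqn.
  by under eq_integral do rewrite gee0_abs ?lee_fin ?sqn_ge0//.
have ib : itg 0 b (fun t => sqn (f t)) by apply: integrableS it.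
split => //; rewrite fineK; last exact: integrable_fin_num.
apply: ge0_subset_integral => //; first by apply/measurable_EFinP; exact: measurable_sqn.
by move=> t _; rewrite lee_fin sqn_ge0.
Qed.

End energy.

(** * Outputs of switched systems and invariance of the gain *)

Section switched_systems.
Context {R : realType}.
Local Notation mu := (@lebesgue_measure R).
Implicit Types (a b t s : R).
Local Notation int a b f := (Rintegral mu `[a, b] f).
Local Notation itg a b f := (mu.-integrable `[a, b] (EFin \o f)).

Lemma lin_solution_eq_forcing k l (A : R -> 'M[R]_k) (G G' : R -> 'M[R]_(k, l))
    t0 x0 x :
  (forall t, t0 <= t -> G t = G' t) -> lin_solution A G t0 x0 x ->
  lin_solution A G' t0 x0 x.
Proof.
move=> GG xP t tt; have [i1 e1] := xP t tt.
have e r : `[t0, t]%classic r -> A r *m x r + G r = A r *m x r + G' r.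
  by rewrite /= in_itv/= => /andP[rt _]; rewrite GG.
split; first by apply: eq_mx_integrable i1.
by rewrite e1; congr (_ + _); apply: eq_mx_integral.
Qed.

Lemma dwell_signals_bounded_coef (T : topologicalType) k l tau (N : set T)
    (g : T -> 'M[R]_(k, l)) (sigma : R -> T) (K : R) : hausdorff_space T ->
  (forall S, N S -> norm1 (g S) <= K) -> dwell_signals tau N sigma ->
  bounded_coef K (fun t => g (sigma t)).
Proof.
move=> hT NK [pc vN _]; split.
  move=> i j; exact: (@piecewise_constant_measurable R T sigma (fun S => g S i j)).
by move=> t t0; apply/NK/vN; rewrite /time/= in_itv/= t0.
Qed.

Lemma hausdorff_system n m p : hausdorff_space (system R n m p).
Proof. exact: norm_hausdorff. Qed.

Lemma mx_measurableM k l h (D : set R) (X : R -> 'M[R]_(k, l)) (Y : R -> 'M[R]_(l, h)) :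
  mx_measurable D X -> mx_measurable D Y -> mx_measurable D (fun t => X t *m Y t).
Proof.
move=> mX mY i j.
rewrite (_ : (fun t => _) = (fun t => \sum_q X t i q * Y t q j)).
  by apply: measurable_sum => q; apply: measurable_funM.
by apply/funext => t; rewrite mxE.
Qed.

Lemma measurable_time_segments (f : R -> R) :
  (forall n : nat, measurable_fun (`[0, n%:R] : set R) f) -> measurable_fun time f.
Proof.
move=> mf; rewrite (_ : time = \bigcup_(n : nat) `[0, n%:R]%classic).
  by apply/measurable_fun_bigcup.
apply/seteqP; split => t; rewrite /time/= in_itv/= andbT.
  move=> t0; exists (Num.trunc t).+1 => //=.
  by rewrite in_itv/= t0/=; apply: ltW; exact: truncnS_gt.
by case=> n _ /=; rewrite in_itv/= => /andP[].
Qed.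

(** On a bounded segment, |s| <= 1 + s^2 turns square integrability into integrability. *)
Lemma L2_signal_loc_integrable k (u : R -> 'cV[R]_k) :
  L2_signal u -> loc_integrable u.
Proof.
move=> [mu' Lu] b.
have mT := @measurable_time R.
have mu1 : mx_measurable time u by move=> i j; rewrite ord1; exact: mu'.
have fin : (energy u < +oo)%E.
  by move: Lu; rewrite L2norm_energy => /lty_poweRy; apply; rewrite invr_neq0.
have [iu _] := energy_ge b mu1 fin.
move=> i j; rewrite ord1.
have i1 : itg 0 b (fun=> 1 : R).
  apply: (@bounded_integrable_segment _ _ _ _ 1); first exact: measurable_cst.
  by move=> t _; rewrite normr1.
have i2 := @integrableD _ _ _ mu _ _ _ _ i1 iu.
apply: le_integrable (i2 _) => //.
  apply/measurable_EFinP; apply: measurable_funS (mu1 i ord0) => //.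
  by move=> t; rewrite /time /= !in_itv/= => /andP[-> _].
move=> t _; change (`|u t i ord0|%:E <= `|1 + sqn (u t)|%:E)%E; rewrite lee_fin.
rewrite [leRHS]ger0_norm ?addr_ge0 ?sqn_ge0//.
have := sqn_entry (u t) i; rewrite -real_normK ?num_real//.
have := sqr_ge0 (`|u t i ord0| - 1); nra.
Qed.

Section one_signal.
Variables (n m p : nat) (sigma : R -> system R n m p) (K : R).
Hypotheses (K0 : 0 < K) (cA : bounded_coef K (fun t => mxA (sigma t)))
  (cB : bounded_coef K (fun t => mxB (sigma t)))
  (cC : bounded_coef K (fun t => mxC (sigma t))).

Lemma forcing_loc_integrable (u : R -> 'cV[R]_m) : loc_integrable u ->
  loc_integrable (fun t => mxB (sigma t) *m u t).
Proof. by move=> iu b; apply: bounded_coef_mul cB (iu b). Qed.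

Lemma state_solution (u : R -> 'cV[R]_m) : loc_integrable u ->
  lin_solution (fun t => mxA (sigma t)) (fun t => mxB (sigma t) *m u t) 0 0
    (state sigma u).
Proof.
move=> iu; have iG := forcing_loc_integrable iu.
have [x xP] := lin_solution_exists 0 K0 (lexx 0) cA iG.
rewrite /state /solution.
by apply: (@getPex _ (is_solution (fun r (X : 'cV[R]_n) =>
  mxA (sigma r) *m X + mxB (sigma r) *m u r) 0 0)); exists x.
Qed.

Lemma output_measurable_segment G t0 a b x0 (x : R -> 'cV[R]_n) : 0 <= t0 ->
  t0 <= a -> a <= b ->
  lin_solution (fun t => mxA (sigma t)) G t0 x0 x ->
  mx_measurable `[a, b] (fun t => mxC (sigma t) *m x t).
Proof.
move=> t00 ta ab xP; apply: mx_measurableM.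
  by apply: bounded_coef_measurable cC; exact: le_trans ta.
exact: mx_integrable_measurable (lin_solution_integrable xP ta ab).
Qed.

Lemma output_integrable G t0 a b x0 (x : R -> 'cV[R]_n) : 0 <= t0 ->
  t0 <= a -> a <= b ->
  lin_solution (fun t => mxA (sigma t)) G t0 x0 x ->
  itg a b (fun t => sqn (mxC (sigma t) *m x t)).
Proof.
move=> t00 ta ab xP; have tb := le_trans ta ab.
have [S [S0 HS]] := continuous_mx_bounded (lin_solution_continuous xP tb).
apply: (@bounded_integrable_segment _ _ _ _ ((K * S) ^+ 2)).
  by apply: measurable_sqn; apply: output_measurable_segment xP.
move=> t; rewrite in_itv/= => /andP[at' tb']; have tt := le_trans ta at'.
rewrite ger0_norm ?sqn_ge0//; apply: le_trans (sqn_le_norm1 _) _.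
rewrite ler_pXn2r ?nnegrE ?norm1_ge0 ?mulr_ge0// ?(ltW K0)//.
apply: le_trans (norm1M _ _) _; apply: ler_pM; rewrite ?norm1_ge0//.
  by apply: cC.2; exact: le_trans tt.
by apply: HS; rewrite tt.
Qed.

Lemma output_measurable (u : R -> 'cV[R]_m) : loc_integrable u ->
  mx_measurable time (output sigma u).
Proof.
move=> iu i j; apply: measurable_time_segments => k.
exact: (output_measurable_segment (lexx 0) (lexx 0) (ler0n _ k) (state_solution iu)).
Qed.

End one_signal.

Definition system_coefs n m p (K : R) (sigma : R -> system R n m p) :=
  [/\ bounded_coef K (fun t => mxA (sigma t)),
      bounded_coef K (fun t => mxB (sigma t))
    & bounded_coef K (fun t => mxC (sigma t))].

Lemma dwell_signals_coefs n m p tau (N : set (system R n m p)) K sigma :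
  (forall S, N S -> system_bound K S) -> dwell_signals tau N sigma ->
  system_coefs K sigma.
Proof.
move=> NK ds; have hT := @hausdorff_system n m p.
by split; apply: (dwell_signals_bounded_coef hT _ ds) => S /NK[].
Qed.

Lemma state_intertwine n n' m p (K : R) (sigma : R -> system R n m p)
    (sigma' : R -> system R n' m p) (E : 'M[R]_(n', n)) (u : R -> 'cV[R]_m) t :
  0 < K -> system_coefs K sigma -> system_coefs K sigma' ->
  (forall t, 0 <= t -> mxA (sigma' t) *m E = E *m mxA (sigma t)) ->
  (forall t, 0 <= t -> mxB (sigma' t) = E *m mxB (sigma t)) ->
  loc_integrable u -> 0 <= t -> state sigma' u t = E *m state sigma u t.
Proof.
move=> K0 [cA cB _] [cA' cB' _] AE BE iu t0.
have xP := state_solution K0 cA cB iu.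
have := lin_solution_intertwine AE xP; rewrite mulmx0 => ExP.
have := lin_solution_unique K0 cA' (lexx 0) t0 (state_solution K0 cA' cB' iu).
move=> /(_ (fun t => E *m state sigma u t)) ->//.
by apply: lin_solution_eq_forcing ExP => s s0; rewrite mulmxA BE.
Qed.

(** Along a signal and its two images the states are Ez, z and Lz, where z is the intermediate
    state, and the output matrices satisfy CE = C1 = C2 L, with C1 the intermediate and C2 the
    reduced one. So the outputs coincide for every input. *)
Lemma L2_gain_realization n m p (M : set (system R n m p)) n'
    (Mmin : set (system R n' m p)) tau : bounded_set M ->
  minimal_realization M Mmin ->
  (L2_gain (dwell_signals tau M) < +oo)%E <->
  (L2_gain (dwell_signals tau Mmin) < +oo)%E.
Proof.
move=> bM /(realization_maps bM)[r [E [L [f [g [K [Mmin_eq fE gE [K0 bK] _]]]]]]].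
have key sigma sigmac sigma' (u : R -> 'cV[R]_m) : L2_signal u ->
    dwell_signals tau M sigma -> dwell_signals tau (f @` M) sigmac ->
    dwell_signals tau Mmin sigma' ->
    (forall t, 0 <= t -> sigmac t = f (sigma t) /\ sigma' t = g (sigmac t)) ->
    energy (output sigma u) = energy (output sigma' u).
  move=> Lu ds dsc ds' H; have iu := L2_signal_loc_integrable Lu.
  have c1 : system_coefs K sigma by apply: dwell_signals_coefs ds => S /bK[].
  have c2 : system_coefs K sigmac.
    by apply: dwell_signals_coefs dsc => _ [S /bK[_ ? _] <-].
  have c3 : system_coefs K sigma'.
    by apply: dwell_signals_coefs ds'; rewrite Mmin_eq => _ [_ [S /bK[_ _ ?] <-] <-].
  apply: eq_integral => t; rewrite inE /time/= in_itv/= andbT => t0.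
  have tM s : 0 <= s -> M (sigma s).
    by case: ds => _ vM _ s0; apply: vM; rewrite /time/= in_itv/= s0.
  congr (sqn _)%:E; rewrite /output.
  rewrite (state_intertwine (E := E) K0 c2 c1 _ _ iu t0); last 2 first.
  - by move=> s s0; have [-> _] := H s s0; have [] := fE _ (tM s s0).
  - by move=> s s0; have [-> _] := H s s0; have [] := fE _ (tM s s0).
  rewrite (state_intertwine (E := L) K0 c2 c3 _ _ iu t0); last 2 first.
  - by move=> s s0; have [-> ->] := H s s0; have [] := gE _ (tM s s0).
  - by move=> s s0; have [-> ->] := H s s0; have [] := gE _ (tM s s0).
  have [-> ->] := H t t0.
  have [_ _ e] := fE _ (tM t t0); have [_ _ e'] := gE _ (tM t t0).
  by rewrite !mulmxA e {1}e'.
have hT := @hausdorff_system.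
rewrite !L2_gain_finite; split => -[G G0 H]; exists G => // u sigma Lu u0 ds.
  (* A signal of the reduced class is lifted by a pointwise choice of preimages, which keeps the
     dwell time. Outside [Mmin] the value of [h] is arbitrary. *)
  have /choice[h hP] : forall S', exists S, Mmin S' -> M S /\ g (f S) = S'.
    move=> S'; have [|nS'] := pselect (Mmin S'); last first.
      have [[S MS]|nM] := pselect (exists S, M S); first by exists S.
      by exists (0, 0, 0).
    by rewrite {1}Mmin_eq => -[_ [S MS <-] <-]; exists S.
  have ds1 : dwell_signals tau M (h \o sigma).
    by apply: dwell_signals_comp ds => // S /hP[].
  have ds2 : dwell_signals tau (f @` M) (f \o (h \o sigma)).
    by apply: dwell_signals_comp ds1 => // S MS; exists S.
  rewrite -(key _ _ _ _ Lu ds1 ds2 ds); first exact: H.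
  move=> t t0; split => //=; case: ds => _ vN _.
  have := vN t; rewrite /time/= in_itv/= t0 => /(_ isT)/hP[_].
  by move=> ->.
have ds2 : dwell_signals tau (f @` M) (f \o sigma).
  by apply: dwell_signals_comp ds => // S MS; exists S.
have ds3 : dwell_signals tau Mmin (g \o (f \o sigma)).
  by apply: dwell_signals_comp ds2 => // S MS; rewrite Mmin_eq; exists S.
by rewrite (key _ _ _ _ Lu ds ds2 ds3)//; exact: H.
Qed.

End switched_systems.

(** * Contraction and finite gain *)

Section contraction.
Context {R : realType}.
Local Notation mu := (@lebesgue_measure R).
Implicit Types (a b t s : R).
Local Notation int a b f := (Rintegral mu `[a, b] f).
Local Notation itg a b f := (mu.-integrable `[a, b] (EFin \o f)).

(** The time [T] is common to the whole class. If the class is stable under time shifts, the same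
    contraction holds on every window of length [T] and can be iterated. *)
Definition contracting k (SA : set (R -> 'M[R]_k)) :=
  exists T : R, 0 < T /\ forall A, SA A -> forall v : 'cV[R]_k,
    enorm (flow A T 0 *m v) <= 2^-1 * enorm v.

Section rho.
Variables (k : nat) (SA : set (R -> 'M[R]_k)) (K : R).
Hypotheses (K0 : 0 < K) (cSA : forall A, SA A -> bounded_coef K A).
Hypothesis shiftSA : forall A (c : R), 0 <= c -> SA A -> SA (fun t => A (t + c)).

Lemma rho_lt1_contracting : (rho SA < 1)%E -> contracting SA.
Proof.
move=> /ereal_inf_lt[_ [V [t0 [_ tV]] <-]] sup1.
set G := (X in ereal_sup (X @` _)) in sup1.
have supG t : V t -> (G t <= ereal_sup (G @` V))%E.
  by move=> Vt; apply: ereal_sup_ubound; exists t.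
have G0 t : (0 <= G t)%E by apply: ereal_sup_ubound; left.
have V1 : V (`|t0| + 1) by apply: tV; rewrite (le_lt_trans (ler_norm _))// ltrDl.
have sup0 := le_trans (G0 _) (supG _ V1).
have supf : ereal_sup (G @` V) \is a fin_num.
  by rewrite ge0_fin_numE// (lt_trans sup1)// ltry.
set c := fine (ereal_sup (G @` V)).
have c1 : c < 1 by rewrite -lte_fin /c fineK.
have c0 : 0 <= c by exact: fine_ge0.
have cn : `|c| < 1 by rewrite ger0_norm.
have h0 : 0 < 2^-1 :> R by [].
have := @cvg_geometric R 1 c cn => /cvgrPdist_lt/(_ _ h0) [N _ HN].
(* The window length is an integer, past [t0] so that the bound by c is in force, and past [N] so
   that c^q <= 1/2. *)
pose q := maxn N (Num.trunc (`|t0| + 1)).+1.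
have q0 : (0 < q)%N by rewrite /q leq_max orbT.
have cq : c ^+ q <= 2^-1.
  have := HN q (leq_maxl _ _); rewrite /= sub0r normrN mul1r => h.
  by apply: ltW; apply: le_lt_trans h; apply: ler_norm.
have qt0 : t0 < q%:R.
  apply: le_lt_trans (ler_norm _) _.
  apply: (@lt_trans _ _ (`|t0| + 1)); first by rewrite ltrDl.
  by apply: lt_le_trans (truncnS_gt _) _; rewrite ler_nat leq_maxr.
exists q%:R; split; first by rewrite ltr0n.
move=> A SAA v; apply: le_trans (enorm_opnorm _ _) _.
apply: ler_wpM2r; first exact: enorm_ge0.
apply: le_trans cq.
have : ((opnorm (flow A q%:R 0) `^ q%:R^-1)%:E <= c%:E)%E.
  rewrite /c fineK//; apply: le_trans (supG _ (tV _ qt0)).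
  by apply: ereal_sup_ubound; right; exists A.
rewrite lee_fin => opc.
have := @ge0_ler_powR _ q%:R (ler0n _ _) _ _ _ _ opc.
rewrite !nnegrE powR_ge0 c0 => /(_ isT isT).
by rewrite -powRrM mulVf ?pnatr_eq0 -?lt0n// powRr1 ?opnorm_ge0// powR_mulrn.
Qed.

Lemma contracting_iter (T : R) A (v : 'cV[R]_k) q : 0 < T ->
  (forall A, SA A -> forall v : 'cV[R]_k,
    enorm (flow A T 0 *m v) <= 2^-1 * enorm v) ->
  SA A -> enorm (flow A (q%:R * T) 0 *m v) <= (2 ^+ q)^-1 * enorm v.
Proof.
move=> T0 HT SAA; elim: q => [|q IH].
  by rewrite mul0r (flow_refl K0 (cSA SAA) (lexx 0)) mul1mx expr0 invr1 mul1r.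
have qT : 0 <= q%:R * T by rewrite mulr_ge0// ltW.
have e : q.+1%:R * T = T + q%:R * T by rewrite -natr1 mulrDl mul1r addrC.
have cA := cSA SAA.
rewrite e (flow_cocycle K0 cA (lexx 0) qT); last by rewrite lerDr ltW.
have sA := shiftSA qT SAA.
have := flow_shift K0 cA (cSA sA) qT (lexx 0) (ltW T0); rewrite add0r => <-.
rewrite -mulmxA; apply: le_trans (HT _ sA _) _.
rewrite exprS invfM -mulrA ler_wpM2l//.
Qed.

Lemma enorm_flow_le A T s t (v : 'cV[R]_k) : SA A -> 0 <= s -> s <= t -> t <= s + T ->
  enorm (flow A t s *m v) <= 2 * expR (2 * K * T) * k%:R * enorm v.
Proof.
move=> SAA s0 st tT; have cA := cSA SAA.
have e0 := enorm_ge0 (flow A t s *m v).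
apply: (@le_trans _ _ (norm1 (flow A t s *m v))).
  by rewrite -(ler_pXn2r (n := 2)) ?nnegrE ?norm1_ge0// enorm_sq sqn_le_norm1.
apply: le_trans (flow_bound v K0 cA s0 st) _.
have e1 : expR (2 * K * (t - s)) <= expR (2 * K * T).
  by rewrite ler_expR ler_wpM2l ?mulr_ge0 ?(ltW K0)//; lra.
have -> : 2 * expR (2 * K * T) * k%:R * enorm v =
  2 * (k%:R * enorm v) * expR (2 * K * T) by ring.
apply: ler_pM => //; rewrite ?mulr_ge0 ?expR_ge0 ?norm1_ge0//.
by apply: ler_wpM2l => //; exact: norm1_le_enorm.
Qed.

Lemma contracting_rho_lt1 : contracting SA -> (rho SA < 1)%E.
Proof.
case=> T [T0 HT].
pose C := 2 * expR (2 * K * T) * k%:R.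
have C0 : 0 <= C by rewrite !mulr_ge0 ?expR_ge0.
pose q0 := (Num.trunc C).+1.
have Cq0 : C <= 2 ^+ q0.
  apply: le_trans (ltW (truncnS_gt C)) _.
  by rewrite -natrX ler_nat ltnW// ltn_expl.
(* A contraction by 1/2 per window suggests the rate 2^(-1/T); half of the exponent is given up. For
   t > (2 q0 + 1)T that half pays for the constant [C], at most 2^q0, and for the incomplete last
   window. *)
pose c : R := 2 `^ (- (2 * T)^-1).
have c1 : c < 1.
  rewrite /c powRN invf_lt1 ?powR_gt0//.
  have r0 : 0 < (2 * T)^-1 by rewrite invr_gt0 mulr_gt0.
  have := gt0_ltr_powR r0 (x := 1) (y := 2).
  by rewrite !nnegrE powR1; apply => //; rewrite ltr1n.
apply: (@le_lt_trans _ _ c%:E); last by rewrite lte_fin.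
apply: ereal_inf_le; eexists.
  exists [set t | (2 * q0 + 1)%:R * T < t]; last by reflexivity.
  by exists ((2 * q0 + 1)%:R * T); split; [exact: num_real|].
apply: ge_ereal_sup => _ [t /= tT <-].
apply: ge_ereal_sup => _ [->|[A SAA <-]]; first by rewrite lee_fin powR_ge0.
rewrite lee_fin.
have t0 : 0 < t by apply: le_lt_trans tT; rewrite mulr_ge0// ltW.
pose q := Num.trunc (t / T).
have tT0 : 0 <= t / T by rewrite divr_ge0// ltW.
have qt : q%:R * T <= t by rewrite -ler_pdivlMr// truncn_le.
have tq : t <= q%:R * T + T.
  by have := truncnS_gt (t / T); rewrite -/q ltr_pdivrMr// -natr1 mulrDl mul1r => /ltW.
have q0q : (2 * q0 + 1 <= q)%N.
  by rewrite /q truncn_ge_nat// ler_pdivlMr// ltW.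
have qT0 : 0 <= q%:R * T by rewrite mulr_ge0// ltW.
have op : opnorm (flow A t 0) <= 2 `^ (- (t / (2 * T))).
  apply: opnorm_le; first exact: powR_ge0.
  move=> v; rewrite (flow_cocycle K0 (cSA SAA) (lexx 0) qT0 qt) -mulmxA.
  apply: le_trans (enorm_flow_le _ SAA qT0 qt tq) _.
  rewrite -/C; apply: (@le_trans _ _ (C * ((2 ^+ q)^-1 * enorm v))).
    by apply: ler_wpM2l => //; exact: contracting_iter.
  rewrite mulrA ler_wpM2r ?enorm_ge0//.
  apply: (@le_trans _ _ (2 ^+ q0 / 2 ^+ q)).
    by rewrite ler_wpM2r ?invr_ge0 ?exprn_ge0.
  rewrite -!powR_mulrn// -powRN -powRD; last by rewrite (_ : _ != 0) ?implybT// pnatr_eq0.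
  apply: ler_powR; first by rewrite ler1n.
  have h1 : t / (2 * T) <= (q%:R + 1) / 2.
    rewrite ler_pdivrMr ?mulr_gt0// mulrA divfK//; lra.
  have : (2 * q0 + 1)%:R <= q%:R :> R by rewrite ler_nat.
  rewrite natrD natrM; lra.
have := @ge0_ler_powR _ t^-1 _ _ _ _ _ op.
rewrite !nnegrE opnorm_ge0 powR_ge0 invr_ge0 (ltW t0) => /(_ isT isT isT) /le_trans; apply.
rewrite -powRrM /c (_ : - (t / (2 * T)) / t = - (2 * T)^-1)//.
field; rewrite ?gt_eqF// ?mulr_gt0//.
Qed.

End rho.

(** Integration of (f - c)^2 >= 0, with c the mean of f over the segment. *)
Lemma cauchy_schwarz_segment (f : R -> R) a b : a < b -> itg a b f ->
  itg a b (fun t => f t ^+ 2) -> (int a b f) ^+ 2 <= (b - a) * int a b (fun t => f t ^+ 2).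
Proof.
move=> ab fi f2i; set I := int a b f; set c := I / (b - a).
have ba : 0 < b - a by lra.
have i1 : itg a b (fun t => - (2 * c) * f t).
  by have := @integrableZl _ _ _ mu _ _ (- (2 * c)) _ fi; apply.
have i2 : itg a b (fun=> c ^+ 2).
  apply: (@bounded_integrable_segment _ _ _ _ `|c ^+ 2|) => //.
have i3 : itg a b (fun t => - (2 * c) * f t + c ^+ 2).
  by have := @integrableD _ _ _ mu _ _ _ _ i1 i2; apply.
have : 0 <= int a b (fun t => f t ^+ 2 + (- (2 * c) * f t + c ^+ 2)).
  apply: Rintegral_ge0 => t _.
  by have := sqr_ge0 (f t - c); rewrite sqrrB; lra.
rewrite RintegralD// RintegralD// RintegralZl// Rintegral_cst_segment ?(ltW ab)// -/I.
rewrite -subr_ge0.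
have -> : (b - a) * int a b (fun t => f t ^+ 2) - I ^+ 2 =
  (b - a) * (int a b (fun t => f t ^+ 2) + (- (2 * c) * I + c ^+ 2 * (b - a))).
  by rewrite /c; field; rewrite gt_eqF.
by move=> ?; rewrite mulr_ge0// ltW.
Qed.

End contraction.

(** * From uniform contraction to finite gain *)

Section contraction_gain.
Context {R : realType}.
Local Notation mu := (@lebesgue_measure R).
Implicit Types (a b t s : R).
Local Notation int a b f := (Rintegral mu `[a, b] f).
Local Notation itg a b f := (mu.-integrable `[a, b] (EFin \o f)).

Lemma L2_signal_sqn_integrable k (u : R -> 'cV[R]_k) a b : 0 <= a -> L2_signal u ->
  itg a b (fun t => sqn (u t)).
Proof.
move=> a0 [mu' Lu].
have mu1 : mx_measurable time u by move=> i j; rewrite ord1; exact: mu'.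
have fin : (energy u < +oo)%E.
  by move: Lu; rewrite L2norm_energy => /lty_poweRy; apply; rewrite invr_neq0.
by apply: integrable_sub_segment (energy_ge b mu1 fin).1.
Qed.

Lemma norm1_integral_sq k (u : R -> 'cV[R]_k) a b : 0 <= a -> a < b ->
  L2_signal u ->
  (int a b (fun t => norm1 (u t))) ^+ 2 <=
    (b - a) * (k%:R ^+ 2 * int a b (fun t => sqn (u t))).
Proof.
move=> a0 ab Lu; have iu : mx_integrable `[a, b] u.
  by apply: mx_integrable_sub (L2_signal_loc_integrable Lu b).
have inu := integrable_norm1 (measurable_itv _) iu.
have isq := L2_signal_sqn_integrable b a0 Lu.
have iks : itg a b (fun t => k%:R ^+ 2 * sqn (u t)).
  by have := @integrableZl _ _ _ mu _ _ (k%:R ^+ 2) _ isq; apply.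
have in2 : itg a b (fun t => norm1 (u t) ^+ 2).
  apply: le_integrable iks => //.
    apply/measurable_EFinP; apply: measurable_funX.
    by have /integrableP[/measurable_EFinP] := inu.
  move=> t _; change (`|norm1 (u t) ^+ 2|%:E <= `|k%:R ^+ 2 * sqn (u t)|%:E)%E.
  rewrite lee_fin !ger0_norm ?mulr_ge0 ?sqn_ge0 ?exprn_ge0 ?norm1_ge0//.
  exact: norm1_sq_le.
apply: le_trans (cauchy_schwarz_segment ab inu in2) _.
apply: ler_wpM2l; first by rewrite subr_ge0 ltW.
by rewrite -RintegralZl//; apply: le_Rintegral => // t _; exact: norm1_sq_le.
Qed.

Section window.
Variables (n m p : nat) (K T : R).
Hypotheses (K0 : 0 < K) (T0 : 0 < T).

Let e := expR (2 * K * T).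
(** With e = exp(2KT), Gronwall bounds the response to the input on one window by 2Ke times the
    integral of its [norm1]; the square of that integral is at most T m^2 times the input energy. *)
Definition forced_const := (2 * K * e) ^+ 2 * (T * m%:R ^+ 2).
Definition free_const := (2 * e) ^+ 2 * n%:R ^+ 2.
Definition output_const := (K * n%:R) ^+ 2.

Variables (sigma : R -> system R n m p) (u : R -> 'cV[R]_m) (a : R).
Hypotheses (cS : system_coefs K sigma) (Lu : L2_signal u) (a0 : 0 <= a).

Let A t := mxA (sigma t).
Let x := state sigma u.
Let U := int a (a + T) (fun t => sqn (u t)).

(** The difference starts from 0 at time [a] and has the forcing term of the full equation, so the
    input alone enters its Gronwall bound. *)
Lemma forced_response t : a <= t <= a + T ->
  sqn (x t - flow A t a *m x a) <= forced_const * U.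
Proof.
move=> /andP[at' tT]; have [cA cB cC] := cS.
have iu := L2_signal_loc_integrable Lu.
have iG := forcing_loc_integrable cB iu.
have xP := lin_solution_restart (state_solution K0 cA cB iu) a0.
have wP := lin_solutionD xP (lin_solutionN (flow_mul_solution K0 cA (x a) a0)).
rewrite subrr in wP.
have {}wP : lin_solution A (fun t => mxB (sigma t) *m u t) a 0
    (fun t => x t - flow A t a *m x a).
  by apply: lin_solution_eq_forcing wP => s _; rewrite oppr0 addr0.
have tt : a <= t <= a + T by rewrite at'.
have := lin_solution_bound K0 cA a0 tt wP iG; rewrite norm10 add0r.
set I := int a (a + T) _; set J := int a (a + T) (fun t => norm1 (u t)) => h.
have iu' : mx_integrable `[a, a + T] u by apply: mx_integrable_sub (iu (a + T)).
have inu := integrable_norm1 (measurable_itv _) iu'.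
have IJ : I <= K * J.
  rewrite /J -RintegralZl//; apply: le_Rintegral => //.
  - by apply: integrable_norm1 => //; apply: mx_integrable_sub (iG (a + T)).
  - by have := @integrableZl _ _ _ mu _ _ K _ inu; apply.
  - move=> r; rewrite /= in_itv/= => /andP[ar _].
    apply: le_trans (norm1M _ _) _; rewrite ler_wpM2r ?norm1_ge0//.
    by apply: cB.2; exact: le_trans ar.
have I0 : 0 <= I by apply: Rintegral_ge0 => ? _; exact: norm1_ge0.
have J0 : 0 <= J by apply: Rintegral_ge0 => ? _; exact: norm1_ge0.
have et : expR (2 * K * (t - a)) <= e.
  by rewrite ler_expR ler_wpM2l ?mulr_ge0 ?(ltW K0)//; lra.
have h2 : norm1 (x t - flow A t a *m x a) <= 2 * K * e * J.
  apply: le_trans h _.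
  have -> : 2 * K * e * J = 2 * (K * J) * e by ring.
  by apply: ler_pM; rewrite ?mulr_ge0 ?expR_ge0// ler_wpM2l.
apply: le_trans (sqn_le_norm1 _) _.
apply: (@le_trans _ _ ((2 * K * e * J) ^+ 2)).
  by rewrite ler_pXn2r ?nnegrE ?norm1_ge0 ?mulr_ge0 ?expR_ge0 ?(ltW K0).
rewrite exprMn /forced_const -[leRHS]mulrA ler_wpM2l ?sqr_ge0//.
have aT : a < a + T by rewrite ltrDl.
have := norm1_integral_sq a0 aT Lu; rewrite -/J -/U; have -> : a + T - a = T by ring.
by rewrite mulrA.
Qed.

Lemma free_response t (v : 'cV[R]_n) : a <= t <= a + T ->
  sqn (flow A t a *m v) <= free_const * sqn v.
Proof.
move=> /andP[at' tT]; have [cA _ _] := cS.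
have h := flow_bound v K0 cA a0 at'.
have et : expR (2 * K * (t - a)) <= e.
  by rewrite ler_expR ler_wpM2l ?mulr_ge0 ?(ltW K0)//; lra.
have h2 : norm1 (flow A t a *m v) <= 2 * e * norm1 v.
  apply: le_trans h _; have -> : 2 * e * norm1 v = 2 * norm1 v * e by ring.
  by apply: ler_pM; rewrite ?mulr_ge0 ?expR_ge0 ?norm1_ge0.
apply: le_trans (sqn_le_norm1 _) _.
apply: (@le_trans _ _ ((2 * e * norm1 v) ^+ 2)).
  by rewrite ler_pXn2r ?nnegrE ?norm1_ge0 ?mulr_ge0 ?expR_ge0 ?norm1_ge0.
by rewrite exprMn /free_const -mulrA ler_wpM2l ?sqr_ge0// norm1_sq_le.
Qed.

Lemma output_sqn_le t (v : 'cV[R]_n) : 0 <= t ->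
  sqn (mxC (sigma t) *m v) <= output_const * sqn v.
Proof.
move=> t0; have [_ _ cC] := cS; apply: le_trans (sqnM _ _) _.
apply: ler_wpM2r; rewrite ?sqn_ge0// /output_const ler_pXn2r ?nnegrE ?mulr_ge0 ?norm1_ge0 ?(ltW K0)//.
by rewrite ler_wpM2r//; exact: cC.2.
Qed.

Lemma window_output :
  int a (a + T) (fun t => sqn (output sigma u t)) <=
    T * (2 * output_const * free_const * sqn (x a) +
         2 * output_const * forced_const * U).
Proof.
have [cA cB cC] := cS; have aT : a <= a + T by rewrite lerDl ltW.
have iu := L2_signal_loc_integrable Lu.
apply: (@le_trans _ _ (int a (a + T) (fun=> 2 * output_const * free_const * sqn (x a) +
         2 * output_const * forced_const * U))); last first.
  by rewrite Rintegral_cst_segment// addrAC subrr add0r mulrC.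
apply: le_Rintegral => //.
- exact: (output_integrable K0 cC (lexx 0) a0 aT (state_solution K0 cA cB iu)).
- apply: continuous_compact_integrable; first exact: segment_compact.
  by apply: continuous_subspaceT => ?; exact: cvg_cst.
move=> t; rewrite /= in_itv/= => tt; have t0 : 0 <= t by case/andP: tt => h _; exact: le_trans h.
apply: le_trans (output_sqn_le _ t0) _.
have -> : state sigma u t = flow A t a *m x a + (x t - flow A t a *m x a).
  by rewrite addrC subrK.
have h1 := free_response (x a) tt; have h2 := forced_response tt.
have h3 := sqnD (flow A t a *m x a) (x t - flow A t a *m x a).
have o0 : 0 <= output_const by exact: sqr_ge0.
apply: le_trans (ler_wpM2l o0 h3) _.
have -> : 2 * output_const * free_const * sqn (x a) + 2 * output_const * forced_const * U
  = output_const * (2 * (free_const * sqn (x a) + forced_const * U)) by ring.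
by rewrite !ler_wpM2l// lerD.
Qed.

End window.

Lemma dwell_signals_mxA n m p tau (N : set (system R n m p)) sigma :
  dwell_signals tau N sigma ->
  dwell_signals tau [set mxA S | S in N] (fun t => mxA (sigma t)).
Proof.
move=> ds; apply: (dwell_signals_comp (g := @mxA R n m p) _ _ ds).
  exact: hausdorff_system.
by move=> S NS; exists S.
Qed.

(** The squared state acts as a storage function. Over a window it drops to at most half, up to
    input energy: the contraction gives 1/4 and [sqnD] costs a factor 2. The output energy of the
    window is at most c3 times the squared initial state, up to input energy, so with the weight 2
    c3 the loss of storage pays for the output. *)
Lemma contracting_L2_gain n m p tau (N : set (system R n m p)) (K : R) : 0 < K ->
  (forall S, N S -> system_bound K S) ->
  contracting (dwell_signals tau [set mxA S | S in N]) ->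
  (L2_gain (dwell_signals tau N) < +oo)%E.
Proof.
move=> K0 NK [T [T0 HT]].
pose c1 := forced_const m K T.
pose c3 := T * (2 * output_const n K * free_const n K T).
pose c4 := T * (2 * output_const n K * c1).
have c10 : 0 <= c1 by rewrite /c1 /forced_const !mulr_ge0 ?sqr_ge0// ltW.
have c30 : 0 <= c3.
  by rewrite /c3 /output_const /free_const !mulr_ge0 ?sqr_ge0// ltW.
have c40 : 0 <= c4 by rewrite /c4 /output_const !mulr_ge0 ?sqr_ge0// ltW.
(* Per unit of input energy: c4 from the output of the window, and 2 c1 from the squared state,
   multiplied by the storage weight 2 c3. *)
pose c5 := c4 + 4 * c3 * c1.
have c50 : 0 <= c5 by rewrite /c5; nra.
apply/L2_gain_finite; exists c5 => // u sigma Lu u0 ds.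
have cS := dwell_signals_coefs NK ds; have [cA cB cC] := cS.
have iu := L2_signal_loc_integrable Lu.
have xP := state_solution K0 cA cB iu.
have iy b : 0 <= b -> itg 0 b (fun t => sqn (output sigma u t)).
  by move=> b0; exact: (output_integrable K0 cC (lexx 0) (lexx 0) b0 xP).
have isq b : itg 0 b (fun t => sqn (u t)).
  exact: L2_signal_sqn_integrable.
have key j : int 0 (j%:R * T) (fun t => sqn (output sigma u t)) +
    2 * c3 * sqn (state sigma u (j%:R * T)) <=
    c5 * int 0 (j%:R * T) (fun t => sqn (u t)).
  elim: j => [|j IH].
    rewrite mul0r !set_itv1 !Rintegral_set1 (lin_solution_init xP).
    by rewrite /sqn big1 ?mulr0 ?addr0// => i _; rewrite mxE expr0n.
  have jT : 0 <= j%:R * T by rewrite mulr_ge0// ltW.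
  have e : j.+1%:R * T = j%:R * T + T by rewrite -natr1 mulrDl mul1r.
  have jTT : j%:R * T <= j%:R * T + T by rewrite lerDl ltW.
  have jT1 : 0 <= j%:R * T + T := le_trans jT jTT.
  rewrite e (Rintegral_chasles jT jTT (iy _ jT1)) (Rintegral_chasles jT jTT (isq _)).
  have w := window_output K0 T0 cS Lu jT.
  have tt : j%:R * T <= j%:R * T + T <= j%:R * T + T by rewrite jTT lexx.
  have f := forced_response K0 T0 cS Lu jT tt.
  have sA : dwell_signals tau [set mxA S | S in N] (fun t => mxA (sigma (t + j%:R * T))).
    by apply: (@dwell_signals_mxA n m p tau N (fun t => sigma (t + j%:R * T))); exact: dwell_signals_shift.
  have cA' : bounded_coef K (fun t => mxA (sigma (t + j%:R * T))).
    by have [] := dwell_signals_coefs NK (dwell_signals_shift jT ds).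
  have := HT _ sA (state sigma u (j%:R * T)).
  have := flow_shift K0 cA cA' jT (lexx 0) (ltW T0); rewrite add0r [T + _]addrC => ->.
  rewrite enorm_le// => h.
  have := sqnD (flow (fun t => mxA (sigma t)) (j%:R * T + T) (j%:R * T) *m state sigma u (j%:R * T))
    (state sigma u (j%:R * T + T) - flow (fun t => mxA (sigma t)) (j%:R * T + T) (j%:R * T) *m state sigma u (j%:R * T)).
  rewrite addrC subrK.
  move: IH w f h; rewrite -/c1.
  set Y := int 0 _ _; set Y' := int (j%:R * T) _ _; set U := int 0 _ _.
  set U' := int (j%:R * T) _ _; set X := sqn (state _ _ (j%:R * T)).
  set X' := sqn (state _ _ _); set F := sqn (flow _ _ _ *m _); set W := sqn (_ - _).
  move=> IH w f h D.
  rewrite /c4 /c5 in w *; move: w.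
  have -> : T * (2 * output_const n K * free_const n K T * X + 2 * output_const n K * c1 * U') =
     c3 * X + c4 * U' by rewrite /c3 /c4; ring.
  move=> w; have D1 : c3 * X' <= c3 * (2 * (2^-1 ^+ 2 * X + c1 * U')).
    by apply: ler_wpM2l => //; apply: le_trans D _; apply: ler_wpM2l => //; exact: lerD.
  have E1 : c3 * (2 * (2^-1 ^+ 2 * X + c1 * U')) = c3 * X / 2 + 2 * c3 * c1 * U' by field.
  rewrite E1 in D1.
  have -> : (c4 + 4 * c3 * c1) * (U + U') = c5 * U + (c4 * U' + 4 * c3 * c1 * U').
    by rewrite /c5; ring.
  move: IH D1 w; clear; lra.
have um : mx_measurable time u by move=> i j; rewrite ord1; exact: Lu.1.
have [U U0 uU] := L2_signal_energy Lu u0.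
have fin : (energy u < +oo)%E by rewrite uU ltry.
have ub b : int 0 b (fun t => sqn (u t)) <= fine (energy u).
  by have [_] := energy_ge b um fin; rewrite uU lee_fin.
apply: energy_le; first exact: (output_measurable K0 cA cB cC iu).
move=> j; split; first exact: iy.
pose q := (Num.trunc (j%:R / T)).+1.
have jq : j%:R <= q%:R * T.
  by rewrite -ler_pdivrMr//; apply: ltW; exact: truncnS_gt.
have qT : 0 <= q%:R * T by rewrite mulr_ge0// ltW.
apply: (@le_trans _ _ (int 0 (q%:R * T) (fun t => sqn (output sigma u t)))).
  rewrite (Rintegral_chasles (ler0n _ j) jq (iy _ qT)) lerDl.
  by apply: Rintegral_ge0 => t _; exact: sqn_ge0.
apply: (@le_trans _ _ (c5 * int 0 (q%:R * T) (fun t => sqn (u t)))).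
  apply: le_trans (key q); rewrite lerDl.
  by apply: mulr_ge0; [exact: mulr_ge0|exact: sqn_ge0].
by apply: ler_wpM2l.
Qed.

End contraction_gain.

(** * Uniform bound on the free output energy *)

Section local_uniqueness.
Context {R : realType}.
Local Notation mu := (@lebesgue_measure R).
Implicit Types (a b t s r : R).
Local Notation int a b f := (Rintegral mu `[a, b] f).
Local Notation itg a b f := (mu.-integrable `[a, b] (EFin \o f)).

Lemma eq_mx_integral_bndo k l (F G : R -> 'M[R]_(k, l)) a b :
  (forall r, a <= r < b -> F r = G r) -> mx_integrable `[a, b] F ->
  mx_integrable `[a, b] G -> mx_integral `[a, b] F = mx_integral `[a, b] G.
Proof.
move=> FG iF iG; apply/matrixP => i j; rewrite !mxE.
have sub : `[a, b[%classic `<=` `[a, b]%classic.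
  by move=> r; rewrite /= !in_itv/= => /andP[-> /ltW].
have e (H : R -> 'M[R]_(k, l)) : mx_integrable `[a, b] H ->
    int a b (fun t => H t i j) = Rintegral mu `[a, b[ (fun t => H t i j).
  move=> iH; rewrite Rintegral_itv_bndo_bndc//; apply: integrableS (iH i j) => //.
rewrite !e//; apply: eq_Rintegral => r /set_mem; rewrite /= in_itv/= => ab.
by rewrite FG.
Qed.

(* The coefficients may disagree at b, as in the concatenation of two signals. *)
Lemma lin_solution_local k l (A A' : R -> 'M[R]_k) (G G' : R -> 'M[R]_(k, l)) K
    t0 b x0 (x x' : R -> 'M[R]_(k, l)) : 0 < K -> bounded_coef K A ->
  0 <= t0 -> t0 <= b ->
  (forall s, t0 <= s < b -> A s = A' s) -> (forall s, t0 <= s < b -> G s = G' s) ->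
  lin_solution A G t0 x0 x -> lin_solution A' G' t0 x0 x' -> x b = x' b.
Proof.
move=> K0 cA t00 tb AA GG xP xP'.
have ix := lin_solution_integrable xP (lexx _) tb.
have ix' := lin_solution_integrable xP' (lexx _) tb.
have id := mx_integrableB (measurable_itv _) ix ix'.
have cd i j : {within `[t0, b], continuous (fun t => (x t - x' t) i j)}.
  rewrite (_ : (fun t => _) = (fun t => x t i j - x' t i j)).
    have c1 := lin_solution_continuous xP tb.
    have c2 := lin_solution_continuous xP' tb.
    by move=> t; apply: cvgB; [exact: c1|exact: c2].
  by apply/funext => t; rewrite !mxE.
have [S [S0 HS]] := continuous_mx_bounded cd.
apply/eqP; rewrite -subr_eq0; apply/eqP/norm1_eq0.
have H t : t0 <= t <= b -> norm1 (x t - x' t) <=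
    0 + K * int t0 t (fun s => norm1 (x s - x' s)).
  move=> /andP[tt tb']; rewrite add0r.
  have [i1 e1] := xP t tt; have [i2 e2] := xP' t tt.
  have idt : mx_integrable `[t0, t] (fun s => x s - x' s).
    by apply: mx_integrable_sub id.
  have iA := bounded_coef_mul t00 cA idt.
  have -> : x t - x' t = mx_integral `[t0, t] (fun s => A s *m (x s - x' s)).
    rewrite e1 e2 opprD addrACA subrr add0r.
    have := @mx_integralD R `[t0, t] (measurable_itv _) _ _ _ _ i2 iA => e.
    apply/eqP; rewrite subr_eq addrC -e; apply/eqP.
    apply: eq_mx_integral_bndo => //; last by apply: mx_integrableD.
    move=> r /andP[tr rt]; have rr : t0 <= r < b by rewrite tr (lt_le_trans rt).
    by rewrite mulmxBr -AA// GG//; apply/matrixP => i j; rewrite !mxE; ring.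
  apply: le_trans (norm1_mx_integral _ iA) _ => //.
  have ind := integrable_norm1 (measurable_itv _) idt.
  rewrite -RintegralZl//; apply: le_Rintegral => //.
  - exact: integrable_norm1.
  - by have := @integrableZl _ _ _ mu _ _ K _ ind; apply.
  - move=> r; rewrite /= in_itv/= => /andP[tr _].
    apply: le_trans (norm1M _ _) _; rewrite ler_wpM2r ?norm1_ge0//.
    by apply: cA.2; exact: le_trans tr.
have := @gronwall _ (fun t => norm1 (x t - x' t)) t0 b 0 K S K0 (lexx 0) _
  (integrable_norm1 (measurable_itv _) id) H b.
rewrite lexx tb mulr0 mul0r; apply => //.
by move=> t /HS ->; rewrite norm1_ge0.
Qed.

Lemma cvg_sumR (T : Type) (F : set_system T) {FF : Filter F} (I : Type)
    (r : seq I) (f : I -> T -> R) (l : I -> R) :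
  (forall i, f i @ F --> l i) ->
  (fun x => \sum_(i <- r) f i x) @ F --> \sum_(i <- r) l i.
Proof.
move=> fl; elim: r => [|i r IH].
  by under eq_fun do rewrite big_nil; rewrite big_nil; exact: cvg_cst.
by under eq_fun do rewrite big_cons; rewrite big_cons; apply: cvgD.
Qed.

(** The derivative of PX is P(AX + c), a continuous function whose integrals after [t1] vanish. The
    state is known only through its integral equation, so it is the primitive of this function that
    is differentiated. *)
Lemma kernel_derivative k h (A : 'M[R]_k) (c x0 : 'cV[R]_k) (X : R -> 'cV[R]_k)
    (P : 'M[R]_(h, k)) t1 t : 0 <= t1 -> t1 < t ->
  lin_solution (fun=> A) (fun=> c) 0 x0 X ->
  (forall s, t1 < s -> P *m X s = 0) -> P *m (A *m X t + c) = 0.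
Proof.
move=> t10 t1t XP PX; apply/matrixP => i j; rewrite [RHS]mxE.
pose f s := (P *m (A *m X s + c)) i j.
(* Strictly between [t1] and [t]: PX vanishes from [a] on, and [t] is interior to the segment
   [a, t + 1]. *)
pose a := (t1 + t) / 2; have ta : t1 < a < t by rewrite /a; apply/andP; split; lra.
have /andP[t1a at_] := ta.
have a0 : 0 <= a := le_trans t10 (ltW t1a).
have at1 : a <= t + 1 by lra.
have iAX b : a <= b -> mx_integrable `[a, b] (fun s => P *m (A *m X s + c)).
  by move=> ab; apply: mx_integrableMl => //; exact: (lin_solution_increment XP a0 ab).1.
(* For s < a the segment is empty and the integral is 0 by convention, so the primitive is zero on
   the whole line and its derivative can be read off. *)
have F0 : (fun s => int a s f) = cst 0.
  apply/funext => s /=; have [as_|sa] := leP a s; last first.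
    by rewrite set_itv_ge ?Rintegral_set0// bnd_simp -ltNge.
  have [i1 e1] := lin_solution_increment XP a0 as_.
  have := mx_integralMl (measurable_itv `[a, s]) P i1.
  move=> /matrixP/(_ i j); rewrite [LHS]mxE => ->.
  have -> : mx_integral `[a, s] (fun r => A *m X r + c) = X s - X a.
    by rewrite e1 addrAC subrr add0r.
  by rewrite mulmxBr !PX ?subrr ?mxE// (lt_le_trans t1a).
have tt : t < t + 1 by rewrite ltrDl.
have fi : itg a (t + 1) f by exact: (iAX _ at1 i j).
have cf : {for t, continuous f}.
  have c1 : {within `[0, t + 1], continuous f}.
    have cX := lin_solution_continuous XP (le_trans a0 at1).
    rewrite (_ : f = fun s => \sum_q P i q * (\sum_r A q r * X s r j + c q j)).
      move=> s; apply: cvg_sumR => q; apply: cvgM; first exact: cvg_cst.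
      apply: cvgD; last exact: cvg_cst.
      apply: cvg_sumR => r; apply: cvgM; first exact: cvg_cst.
      exact: cX.
    apply/funext => s; rewrite /f mxE; apply: eq_bigr => q _; congr (_ * _).
    by rewrite !mxE.
  have t1' : 0 < t + 1 by lra.
  have [h1 _ _] := (continuous_within_itvP _ t1').1 c1.
  by apply: h1; rewrite in_itv/=; apply/andP; split; lra.
have [_] := continuous_FTC1_closed tt fi at_ cf.
by rewrite F0 derive1_cst => /esym.
Qed.

(** Among the subspaces on which [Q] holds, one of maximal dimension contains every vector
    satisfying [Q], since such a vector could otherwise be adjoined. [Q] is not boolean, so the
    dimension is maximized classically; [cokermx] then presents the subspace as a kernel. *)
Lemma linear_prop_kernel k (Q : 'cV[R]_k -> Prop) : Q 0 ->
  (forall v w, Q v -> Q w -> Q (v + w)) -> (forall (c : R) v, Q v -> Q (c *: v)) ->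
  exists P : 'M[R]_k, forall v, Q v <-> P *m v = 0.
Proof.
move=> Q0 QD QZ.
pose good (M : 'M[R]_k) := forall u : 'rV[R]_k, (u <= M)%MS -> Q u^T.
pose pr d := `[< exists M, good M /\ \rank M = d >].
have ex : exists d, pr d.
  exists 0%N; apply/asboolP; exists 0; split; last by rewrite mxrank0.
  by move=> u; rewrite submx0 => /eqP ->; rewrite trmx0.
have bd d : pr d -> (d <= k)%N.
  by move=> /asboolP[M [_ <-]]; exact: rank_leq_row.
case: (ex_maxnP ex bd) => d /asboolP[M [gM rM]] dmax.
exists (cokermx M)^T => v; split=> [Qv|].
  suff vM : (v^T <= M)%MS.
    by apply: trmx_inj; rewrite trmx_mul trmxK trmx0; apply/eqP; rewrite -submxE.
  apply: contrapT => /negP nvM.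
  have gM' : good (M + v^T)%MS.
    move=> u /sub_addsmxP[[u1 u2] /= ->]; rewrite linearD/=; apply: QD.
      by apply: gM; exact: submxMl.
    by rewrite trmx_mul trmxK [u2]mx11_scalar tr_scalar_mx mul_mx_scalar; exact: QZ.
  have : (\rank (M + v^T)%MS <= d)%N by apply: dmax; apply/asboolP; exists (M + v^T)%MS.
  rewrite leqNgt => /negP; apply; rewrite -rM; apply: rank_ltmx.
  rewrite /ltmx addsmxSl/=; apply: contra nvM; apply: submx_trans; exact: addsmxSr.
move=> Mv; rewrite -[v]trmxK; apply: gM; rewrite submxE.
by rewrite -trmx_eq0 trmx_mul trmxK Mv.
Qed.

(** The constant involves only the images of the basis vectors. This is how separate energy bounds
    for finitely many vectors become one bound for all vectors. *)
Lemma sqnM_cols k l (Z : 'M[R]_(k, l)) (v : 'cV[R]_l) :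
  sqn (Z *m v) <= l%:R ^+ 2 * (\sum_j sqn (Z *m delta_mx j ord0)) * sqn v.
Proof.
have e : \sum_j sqn (Z *m delta_mx j ord0) = \sum_i \sum_j Z i j ^+ 2.
  rewrite [RHS]exchange_big/=; apply: eq_bigr => j _; apply: eq_bigr => i _.
  by rewrite -colE mxE.
rewrite e mulrAC mulr_sumr; set V := sqn v; apply: ler_sum => i _.
pose a : 'cV[R]_l := \col_j (Z i j * v j ord0).
have -> : (Z *m v) i ord0 = \sum_j a j ord0.
  by rewrite mxE; apply: eq_bigr => j _; rewrite mxE.
apply: (@le_trans _ _ (norm1 a ^+ 2)).
  rewrite -real_normK ?num_real// ler_pXn2r ?nnegrE ?norm1_ge0//.
  by rewrite norm1_col; exact: ler_norm_sum.
apply: le_trans (norm1_sq_le _) _; rewrite -[leRHS]mulrA ler_wpM2l ?sqr_ge0//.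
rewrite mulr_sumr; apply: ler_sum => j _; rewrite mxE exprMn mulrC ler_wpM2r ?sqr_ge0//.
exact: sqn_entry.
Qed.

End local_uniqueness.

(** * Constant inputs that are cut off *)

Section pulse.
Context {R : realType}.
Local Notation mu := (@lebesgue_measure R).
Implicit Types (a b t s : R).
Local Notation int a b f := (Rintegral mu `[a, b] f).

(** Together with a constant signal of length [b] this input drives 0 to a reached state, after
    which the output is free. *)
Definition pulse k (b : R) (w : 'cV[R]_k) : R -> 'cV[R]_k :=
  fun t => if t < b then w else 0.

Lemma pulse_measurable k D b (w : 'cV[R]_k) : mx_measurable D (pulse b w).
Proof.
move=> i j; rewrite (_ : (fun t => _) = (fun t => if t < b then w i j else 0)).
  apply: measurable_funTS; apply: measurable_fun_ifT.
  - by apply: measurable_fun_ltr.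
  - by [].
  - by [].
by apply/funext => t; rewrite /pulse; case: ifP => //; rewrite mxE.
Qed.

Lemma pulse_L2 k b (w : 'cV[R]_k) : 0 < b -> w != 0 ->
  L2_signal (pulse b w) /\ L2norm (pulse b w) != 0%E.
Proof.
move=> b0 w0.
have sqp t : sqn (pulse b w t) = (if t < b then sqn w else 0).
  rewrite /pulse; case: ifP => // _; rewrite /sqn big1// => i _.
  by rewrite mxE expr0n.
have ip a c : mu.-integrable `[a, c] (EFin \o (fun t => sqn (pulse b w t))).
  apply: (@bounded_integrable_segment _ _ _ _ (sqn w)).
    by apply: measurable_sqn; exact: pulse_measurable.
  move=> t _; rewrite ger0_norm ?sqn_ge0// sqp; case: ifP => // _; exact: sqn_ge0.
have en : (energy (pulse b w) <= (b * sqn w)%:E)%E.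
  apply: energy_le; first exact: pulse_measurable.
  move=> n; split; first exact: ip.
  have bn : b <= b + n%:R by rewrite lerDl.
  apply: (@le_trans _ _ (int 0 (b + n%:R) (fun t => sqn (pulse b w t)))).
    rewrite (@Rintegral_chasles _ _ 0 n%:R (b + n%:R))//; last by rewrite lerDr ltW.
    by rewrite lerDl; apply: Rintegral_ge0 => ? _; exact: sqn_ge0.
  rewrite (Rintegral_chasles (ltW b0) bn)//.
  have -> : int b (b + n%:R) (fun t => sqn (pulse b w t)) = int b (b + n%:R) (fun=> 0).
    apply: eq_Rintegral => t /set_mem; rewrite /= in_itv/= => /andP[bt _].
    by rewrite sqp ltNge bt.
  rewrite Rintegral_cst_segment// mul0r addr0.
  apply: (@le_trans _ _ (int 0 b (fun=> sqn w))); last first.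
    by rewrite Rintegral_cst_segment ?(ltW b0)// subr0 mulrC.
  apply: le_Rintegral => //.
    apply: continuous_compact_integrable; first exact: segment_compact.
    by apply: continuous_subspaceT => ?; exact: cvg_cst.
  by move=> t _; rewrite sqp; case: ifP => // _; exact: sqn_ge0.
have fin : (energy (pulse b w) < +oo)%E by apply: le_lt_trans en _; exact: ltry.
have b20 : 0 < b / 2 by rewrite divr_gt0.
have w1 : 0 < sqn w.
  rewrite lt_neqAle sqn_ge0 andbT eq_sym; apply: contra w0 => /eqP w0.
  by apply/eqP/enorm_eq0; rewrite /enorm -/(sqn w) w0 sqrtr0.
(* The first half of the pulse already has positive energy, and on [0, b/2] the cut-off at b is not
   met. *)
have [_ low] := energy_ge (b / 2) (@pulse_measurable k time b w) fin.
have pos : (0 < energy (pulse b w))%E.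
  apply: lt_le_trans low; rewrite lte_fin.
  have -> : int 0 (b / 2) (fun t => sqn (pulse b w t)) = int 0 (b / 2) (fun=> sqn w).
    apply: eq_Rintegral => t /set_mem; rewrite /= in_itv/= => /andP[_ tb].
    by rewrite sqp ifT// (le_lt_trans tb)// ltr_pdivrMr//; lra.
  by rewrite Rintegral_cst_segment ?(ltW b20)// subr0 mulr_gt0.
split; last by rewrite L2norm_energy gt_eqF// poweR_gt0.
split; last by rewrite L2norm_energy poweR_lty.
by move=> i; exact: pulse_measurable.
Qed.

End pulse.

(** * The subspace of states with bounded free output energy *)

Section bounded_output_energy.
Context {R : realType}.
Local Notation mu := (@lebesgue_measure R).
Implicit Types (a b t s : R).
Local Notation int a b f := (Rintegral mu `[a, b] f).
Local Notation itg a b f := (mu.-integrable `[a, b] (EFin \o f)).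

Lemma tail_energy n m p (sigma sigma' : R -> system R n m p) K b c
    (x0 : 'cV[R]_n) (x : R -> 'cV[R]_n) : 0 < K ->
  system_coefs K sigma -> system_coefs K sigma' -> 0 <= b -> 0 <= c ->
  (forall s, 0 <= s -> sigma' (s + b) = sigma s) ->
  lin_solution (fun t => mxA (sigma' t)) (fun=> 0) b x0 x ->
  int b (b + c) (fun t => sqn (mxC (sigma' t) *m x t)) =
  int 0 c (fun t => sqn (mxC (sigma t) *m (flow (fun t => mxA (sigma t)) t 0 *m x0))).
Proof.
move=> K0 [cA cB cC] [cA' cB' cC'] b0 c0 ss xP.
have bc : b <= b + c by rewrite lerDl.
have i1 := output_integrable K0 cC' b0 (lexx b) bc xP.
have := @Rintegral_shift R b 0 c (fun t => sqn (mxC (sigma' t) *m x t)).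
rewrite add0r [c + b]addrC => /(_ i1) <-.
apply: eq_Rintegral => t /set_mem; rewrite /= in_itv/= => /andP[t0 _].
rewrite ss//; congr (sqn (_ *m _)).
have xP' : lin_solution (fun t => mxA (sigma' t)) (fun=> 0) (0 + b) x0 x by rewrite add0r.
have := lin_solution_shift xP'.
have := flow_mul_solution K0 cA x0 (lexx 0) => h1 h2; apply/esym.
apply: (lin_solution_local K0 cA (lexx 0) t0 _ _ h1 h2) => //.
by move=> s /andP[s0 _]; rewrite ss.
Qed.

Section class.
Variables (n m p : nat) (tau K g : R) (N : set (system R n m p)).
Hypotheses (K0 : 0 < K) (tau0 : 0 <= tau).
Hypothesis NK : forall S, N S -> system_bound K S.
Hypothesis gainN : forall u sigma, L2_signal u -> L2norm u != 0%E ->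
  dwell_signals tau N sigma ->
  (energy (output sigma u) <= (g * fine (energy u))%:E)%E.

(* Signals that can be preceded by a constant one of length at least tau. *)
Definition late_switching : set (R -> system R n m p) :=
  [set sigma | dwell_signals tau N sigma /\
    forall t, switching_times sigma t -> 0 < t -> tau <= t].

Let phi (sigma : R -> system R n m p) t : 'M[R]_(p, n) :=
  mxC (sigma t) *m flow (fun t => mxA (sigma t)) t 0.

(** [G] may depend on [v], but not on the signal or the horizon. Mere finiteness, instead of a
    prescribed bound, is what makes these vectors a subspace. *)
Definition finite_output (v : 'cV[R]_n) := exists G : R,
  forall sigma, late_switching sigma -> forall b, 0 <= b ->
    int 0 b (fun t => sqn (phi sigma t *m v)) <= G.

Let phi_integrable sigma v a b : dwell_signals tau N sigma -> 0 <= a -> a <= b ->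
  itg a b (fun t => sqn (phi sigma t *m v)).
Proof.
move=> /(dwell_signals_coefs NK)[cA cB cC] a0 ab.
have := output_integrable K0 cC (lexx 0) a0 ab (flow_mul_solution K0 cA v (lexx 0)).
apply: eq_integrable => // t _; rewrite /= /phi mulmxA//.
Qed.

Lemma finite_output0 : finite_output 0.
Proof.
exists 0 => sigma _ b b0.
rewrite (_ : (fun t => _) = fun=> 0) ?Rintegral_cst_segment ?mul0r//.
apply/funext => t; rewrite mulmx0 /sqn big1// => i _.
by rewrite mxE expr0n.
Qed.

Lemma finite_outputD v w :
  finite_output v -> finite_output w -> finite_output (v + w).
Proof.
move=> [G HG] [G' HG']; exists (2 * (G + G')) => sigma ls b b0.
have [ds _] := ls.
have i1 := phi_integrable v ds (lexx 0) b0; have i2 := phi_integrable w ds (lexx 0) b0.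
have i3 : itg 0 b (fun t => sqn (phi sigma t *m v) + sqn (phi sigma t *m w)).
  by have := @integrableD _ _ _ mu _ _ _ _ i1 i2; apply.
apply: (@le_trans _ _ (int 0 b (fun t => 2 * (sqn (phi sigma t *m v) + sqn (phi sigma t *m w))))).
  apply: le_Rintegral => //; first exact: phi_integrable.
    by have := @integrableZl _ _ _ mu _ _ 2 _ i3; apply.
  by move=> t _; rewrite mulmxDr; exact: sqnD.
by rewrite RintegralZl// RintegralD// ler_wpM2l// lerD// ?HG ?HG'.
Qed.

Lemma finite_outputZ (c : R) v : finite_output v -> finite_output (c *: v).
Proof.
move=> [G HG]; exists (c ^+ 2 * G) => sigma ls b b0; have [ds _] := ls.
rewrite (_ : (fun t => _) = (fun t => c ^+ 2 * sqn (phi sigma t *m v))); last first.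
  by apply/funext => t; rewrite -scalemxAr sqnZ.
rewrite RintegralZl//; last exact: phi_integrable.
by rewrite ler_wpM2l ?sqr_ge0// HG.
Qed.

Lemma finite_output_flow S v t : N S -> tau < t -> finite_output v ->
  finite_output (flow (fun=> mxA S) t 0 *m v).
Proof.
move=> NS tt [G HG]; exists G => sigma ls b b0; have [ds sw] := ls.
have t0 : 0 < t by exact: le_lt_trans tt.
have ds' : dwell_signals tau N (prefix_signal t S sigma).
  by apply: dwell_signals_prefix => //; exact: ltW.
(* The prefixed signal switches at t > tau at the earliest, so the bound known for [v] applies to
   it. *)
have ls' : late_switching (prefix_signal t S sigma).
  split; first exact: ds'.
  move=> s /switching_times_prefix[->|[ts _] _]; first by rewrite (ltW tt).
  by rewrite ltW// (lt_trans tt).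
have cS := dwell_signals_coefs NK ds; have cS' := dwell_signals_coefs NK ds'.
have [cA' _ _] := cS'.
have cc := dwell_signals_coefs NK (dwell_signals_cst tau NS).
have [cAc _ _] := cc.
have tb : t <= t + b by rewrite lerDl.
have ss s : 0 <= s -> prefix_signal t S sigma (s + t) = sigma s.
  by move=> s0; rewrite /prefix_signal ltNge lerDr s0/= addrK.
have xP := flow_mul_solution K0 cA' v (lexx 0).
have xP1 := lin_solution_restart xP (ltW t0).
have e1 := tail_energy K0 cS cS' (ltW t0) b0 ss xP1.
have e2 : flow (fun=> mxA S) t 0 *m v = flow (fun s => mxA (prefix_signal t S sigma s)) t 0 *m v.
  apply: (lin_solution_local K0 cAc (lexx 0) (ltW t0) _ _ (flow_mul_solution K0 cAc v (lexx 0)) xP) => //.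
  by move=> s /andP[_ st]; rewrite /prefix_signal st.
have -> : (fun s => sqn (phi sigma s *m (flow (fun=> mxA S) t 0 *m v))) =
  (fun s => sqn (mxC (sigma s) *m (flow (fun t => mxA (sigma t)) s 0 *m
     (flow (fun s => mxA (prefix_signal t S sigma s)) t 0 *m v)))).
  by apply/funext => s; rewrite e2 /phi -mulmxA.
rewrite -e1.
have tb0 : 0 <= t + b := addr_ge0 (ltW t0) b0.
apply: le_trans (HG _ ls' _ tb0).
rewrite (Rintegral_chasles (ltW t0) tb (phi_integrable _ ds' (lexx 0) tb0)).
rewrite (_ : (fun s => sqn (mxC _ *m _)) = (fun s => sqn (phi (prefix_signal t S sigma) s *m v))).
  by rewrite lerDr; apply: Rintegral_ge0 => ? _; exact: sqn_ge0.
by apply/funext => s; rewrite /phi mulmxA.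
Qed.

(** [w] is nonzero because the gain inequality concerns nonzero inputs. The bound is the gain
    constant times the energy of the pulse, which depends on w and t but not on the signal that
    follows. *)
Lemma finite_output_reached S (w : 'cV[R]_m) (X : R -> 'cV[R]_n) t :
  N S -> tau < t -> w != 0 ->
  lin_solution (fun=> mxA S) (fun=> mxB S *m w) 0 0 X -> finite_output (X t).
Proof.
move=> NS tt w0 XP.
have t0 : 0 < t by exact: le_lt_trans tt.
have [Lu u0] := pulse_L2 t0 w0.
exists (g * fine (energy (pulse t w))) => sigma ls b b0; have [ds sw] := ls.
have ds' : dwell_signals tau N (prefix_signal t S sigma).
  by apply: dwell_signals_prefix => //; exact: ltW.
have cS := dwell_signals_coefs NK ds; have cS' := dwell_signals_coefs NK ds'.
have [cA' cB' cC'] := cS'.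
have [cAc _ _] := dwell_signals_coefs NK (dwell_signals_cst tau NS).
have tb : t <= t + b by rewrite lerDl.
have ss s : 0 <= s -> prefix_signal t S sigma (s + t) = sigma s.
  by move=> s0; rewrite /prefix_signal ltNge lerDr s0/= addrK.
have iu := L2_signal_loc_integrable Lu.
have xP := state_solution K0 cA' cB' iu.
have xP1 : lin_solution (fun s => mxA (prefix_signal t S sigma s)) (fun=> 0) t
    (state (prefix_signal t S sigma) (pulse t w) t) (state (prefix_signal t S sigma) (pulse t w)).
  apply: lin_solution_eq_forcing (lin_solution_restart xP (ltW t0)) => s ts.
  by rewrite /pulse ltNge ts/= mulmx0.
have e1 := tail_energy K0 cS cS' (ltW t0) b0 ss xP1.
have e2 : X t = state (prefix_signal t S sigma) (pulse t w) t.
  apply: (lin_solution_local K0 cAc (lexx 0) (ltW t0) _ _ XP xP).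
    by move=> s /andP[_ st]; rewrite /prefix_signal st.
  by move=> s /andP[_ st]; rewrite /prefix_signal /pulse st.
have -> : (fun s => sqn (phi sigma s *m X t)) =
  (fun s => sqn (mxC (sigma s) *m (flow (fun t => mxA (sigma t)) s 0 *m
     state (prefix_signal t S sigma) (pulse t w) t))).
  by apply/funext => s; rewrite e2 /phi mulmxA.
rewrite -e1.
have tb0 : 0 <= t + b := addr_ge0 (ltW t0) b0.
have en := gainN Lu u0 ds'.
have my := output_measurable K0 cA' cB' cC' iu.
have [_ low] := energy_ge (t + b) my (le_lt_trans en (ltry _)).
rewrite -lee_fin; apply: le_trans en; apply: le_trans low; rewrite lee_fin.
have iy := output_integrable K0 cC' (lexx 0) (lexx 0) tb0 xP.
rewrite (Rintegral_chasles (ltW t0) tb iy).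
by rewrite lerDr; apply: Rintegral_ge0 => ? _; exact: sqn_ge0.
Qed.

Hypothesis controllableN : forall W : {vspace 'cV[R]_n}, contains_ranges N W ->
  A_invariant N W -> forall v, v \in W.

Lemma finite_output_all v : finite_output v.
Proof.
have [P HP] := linear_prop_kernel finite_output0 finite_outputD finite_outputZ.
pose W := lker (linfun (mulmx P) : 'Hom('cV[R]_n, 'cV[R]_n)).
have WP w : (w \in W) = (P *m w == 0) by rewrite memv_ker lfunE.
have WQ w : w \in W <-> finite_output w.
  by rewrite WP HP; split => /eqP.
have tauT : tau < tau + 1 by rewrite ltrDl.
have T0 : 0 <= tau + 1 by rewrite addr_ge0.
(* The flow [Phi] over time tau + 1 is injective and maps [W] into itself, hence onto itself by
   dimension, so w = Phi x with x in [W]. The trajectory exp(sA)x lies in [W] for s > tau, and its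
   derivative at tau + 1 is Aw. *)
have invW : A_invariant N W.
  move=> S NS w wW.
  have [cA _ _] := dwell_signals_coefs NK (dwell_signals_cst tau NS).
  pose Phi := flow (fun=> mxA S) (tau + 1) 0.
  have uPhi : Phi \in unitmx by apply: (flow_unit K0 cA).
  pose f := linfun (mulmx Phi) : 'Hom('cV[R]_n, 'cV[R]_n).
  have fW : (f @: W <= W)%VS.
    apply/subvP => _ /memv_imgP[x xW ->]; rewrite lfunE/=.
    by apply/WQ/finite_output_flow => //; apply/WQ.
  have kf : lker f = 0%VS.
    apply/eqP; rewrite -subv0; apply/subvP => x; rewrite memv_ker lfunE/= memv0.
    by move=> /eqP xf; rewrite -(mulKmx uPhi x) xf mulmx0.
  have fWW : (f @: W)%VS = W.
    apply/eqP; rewrite eqEdim fW/= limg_dim_eq// kf capv0//.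
  move: wW; rewrite -{1}fWW => /memv_imgP[x xW ->]; rewrite lfunE/= WP.
  have xP := flow_mul_solution K0 cA x (lexx 0).
  have := @kernel_derivative R n n (mxA S) 0 x _ P tau (tau + 1) tau0 tauT xP.
  rewrite addr0 => ->// s ts.
  by apply/HP; apply: finite_output_flow => //; apply/WQ.
apply/WQ; apply: controllableN => // S NS w.
have [->|w0] := eqVneq w 0; first by rewrite mulmx0 mem0v.
have [cA cB _] := dwell_signals_coefs NK (dwell_signals_cst tau NS).
have iG : loc_integrable (fun=> mxB S *m w).
  move=> b i j; apply: (@bounded_integrable_segment _ _ _ _ `|(mxB S *m w) i j|) => //.
have [X XP] := lin_solution_exists 0 K0 (lexx 0) cA iG.
have XQ s : tau < s -> finite_output (X s).
  by move=> ts; exact: (finite_output_reached NS ts w0 XP).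
(* The derivative AX + Bw of a trajectory of reached states lies in [W], and so does AX by
   invariance; hence Bw does. *)
have := @kernel_derivative R n n (mxA S) (mxB S *m w) 0 X P tau (tau + 1) tau0 tauT XP.
have PX s : tau < s -> P *m X s = 0 by move=> ts; apply/HP/XQ.
move=> /(_ PX); rewrite mulmxDr.
have : mxA S *m X (tau + 1) \in W by apply: invW => //; apply/WQ/XQ.
by rewrite !WP => /eqP ->; rewrite add0r => ->.
Qed.

Lemma output_energy_uniform : exists G : R, 0 <= G /\
  forall sigma, late_switching sigma -> forall b v, 0 <= b ->
    int 0 b (fun t => sqn (phi sigma t *m v)) <= G * sqn v.
Proof.
have /choice[G HG] := fun j : 'I_n => finite_output_all (delta_mx j ord0).
exists (n%:R ^+ 2 * \sum_j `|G j|); split.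
  by rewrite mulr_ge0 ?sqr_ge0// sumr_ge0.
move=> sigma ls b v b0; have [ds _] := ls.
have ij j := phi_integrable (delta_mx j ord0) ds (lexx 0) b0.
have isum : itg 0 b (fun t => \sum_j sqn (phi sigma t *m delta_mx j ord0)).
  by apply: integrable_sumR.
have -> : n%:R ^+ 2 * (\sum_j `|G j|) * sqn v = (n%:R ^+ 2 * sqn v) * \sum_j `|G j| by ring.
apply: (@le_trans _ _ (int 0 b (fun t => (n%:R ^+ 2 * sqn v) *
    \sum_j sqn (phi sigma t *m delta_mx j ord0)))).
  apply: le_Rintegral => //; first exact: phi_integrable.
    by have := @integrableZl _ _ _ mu _ _ (n%:R ^+ 2 * sqn v) _ isum; apply.
  by move=> t _; rewrite mulrAC; exact: sqnM_cols.
rewrite RintegralZl// ler_wpM2l ?mulr_ge0 ?sqr_ge0 ?sqn_ge0//.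
rewrite Rintegral_sum//; apply: ler_sum => j _.
by apply: le_trans (HG j _ ls _ b0) (ler_norm _).
Qed.

End class.
End bounded_output_energy.

(** * Contraction from observability *)

Section observability.
Context {R : realType}.
Local Notation mu := (@lebesgue_measure R).
Implicit Types (a b t s : R).
Local Notation int a b f := (Rintegral mu `[a, b] f).
Local Notation itg a b f := (mu.-integrable `[a, b] (EFin \o f)).

Lemma norm1_tr k l (X : 'M[R]_(k, l)) : norm1 X^T = norm1 X.
Proof.
rewrite /norm1 exchange_big/=; apply: eq_bigr => i _; apply: eq_bigr => j _.
by rewrite mxE.
Qed.

(** Through this identity the matrix inequality of uniform observability becomes a lower bound on
    output energy. *)
Lemma gramian_quadratic n m p (sigma : R -> system R n m p) K t T (v : 'cV[R]_n) :
  0 < K -> system_coefs K sigma -> 0 <= t -> 0 <= T ->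
  let Phi s := flow (fun r => mxA (sigma r)) s t in
  (v^T *m mx_integral `[t, t + T] (fun s =>
     (Phi s)^T *m (mxC (sigma s))^T *m mxC (sigma s) *m Phi s) *m v) ord0 ord0 =
  int t (t + T) (fun s => sqn (mxC (sigma s) *m (Phi s *m v))).
Proof.
move=> K0 [cA cB cC] t0 T0 Phi; set F := (X in mx_integral _ X).
have tT : t <= t + T by rewrite lerDl.
have PhiP := flow_solution K0 cA t0.
have iPhi := lin_solution_integrable PhiP (lexx t) tT.
have mPhi := mx_integrable_measurable iPhi.
have mCP : mx_measurable `[t, t + T] (fun s => mxC (sigma s) *m Phi s).
  by apply: mx_measurableM mPhi; apply: bounded_coef_measurable cC.
have [S [S0 HS]] := continuous_mx_bounded (lin_solution_continuous PhiP tT).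
have iF : mx_integrable `[t, t + T] F.
  apply: (@bounded_mx_integrable R _ _ _ _ _ (K * S * (K * S))).
    rewrite (_ : F = fun s => (mxC (sigma s) *m Phi s)^T *m (mxC (sigma s) *m Phi s)).
      apply: (mx_measurableM _ mCP) => i j.
      rewrite (_ : (fun s => _) = (fun s => (mxC (sigma s) *m Phi s) j i))//.
      by apply/funext => s; rewrite mxE.
    by apply/funext => s; rewrite /F trmx_mul !mulmxA.
  move=> s ss; have s0 : 0 <= s by case/andP: ss => ts _; exact: le_trans ts.
  have -> : F s = (mxC (sigma s) *m Phi s)^T *m (mxC (sigma s) *m Phi s).
    by rewrite /F trmx_mul !mulmxA.
  have h : norm1 (mxC (sigma s) *m Phi s) <= K * S.
    by apply: le_trans (norm1M _ _) _; apply: ler_pM; rewrite ?norm1_ge0 ?cC.2 ?HS.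
  apply: le_trans (norm1M _ _) _; apply: ler_pM; rewrite ?norm1_ge0 ?norm1_tr//.
have -> : v^T *m mx_integral `[t, t + T] F *m v =
    mx_integral `[t, t + T] (fun s => v^T *m F s *m v).
  by rewrite mx_integralMr ?mx_integralMl//; exact: mx_integrableMl.
rewrite mxE; apply: eq_Rintegral => s _.
have -> : v^T *m F s *m v = (mxC (sigma s) *m (Phi s *m v))^T *m (mxC (sigma s) *m (Phi s *m v)).
  by rewrite /F !trmx_mul !mulmxA.
by rewrite mxE /sqn; apply: eq_bigr => i _; rewrite mxE expr2.
Qed.

Section class.
Variables (n m p : nat) (tau K : R) (N : set (system R n m p)).
Hypotheses (K0 : 0 < K) (tau0 : 0 <= tau).
Hypothesis NK : forall S, N S -> system_bound K S.

Let A (sigma : R -> system R n m p) t := mxA (sigma t).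
Let y sigma (v : 'cV[R]_n) t := mxC (sigma t) *m (flow (A sigma) t 0 *m v).

Let y_integrable sigma v a b : dwell_signals tau N sigma -> 0 <= a -> a <= b ->
  itg a b (fun t => sqn (y sigma v t)).
Proof.
move=> /(dwell_signals_coefs NK)[cA cB cC] a0 ab.
exact: (output_integrable K0 cC (lexx 0) a0 ab (flow_mul_solution K0 cA v (lexx 0))).
Qed.

Lemma observable_contracting (G : R) : 0 <= G ->
  (forall sigma, late_switching tau N sigma -> forall b v, 0 <= b ->
    int 0 b (fun t => sqn (mxC (sigma t) *m flow (fun t => mxA (sigma t)) t 0 *m v))
      <= G * sqn v) ->
  uniformly_observable (dwell_signals tau N) ->
  contracting (dwell_signals tau [set mxA S | S in N]).
Proof.
move=> G0 HG [T0 [gam [T00 gam0 obs]]].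
have coefs sigma (ds : dwell_signals tau N sigma) := dwell_signals_coefs NK ds.
(* The given bound concerns signals without a switch in ]0, tau[; an arbitrary one becomes so after
   a wait s <= tau. [free_const] bounds the state reached at s, and energy is counted only from a >=
   tau on. *)
have [G' [G'0 HG']] : exists G' : R, 0 <= G' /\ forall sigma v a b,
    dwell_signals tau N sigma -> tau <= a -> a <= b ->
    int a b (fun t => sqn (y sigma v t)) <= G' * sqn v.
  have c0 : 0 <= free_const n K (tau + 1).
    by rewrite /free_const !mulr_ge0 ?sqr_ge0.
  exists (G * free_const n K (tau + 1)); split; first exact: mulr_ge0.
  move=> sigma v a b ds ta ab.
  have [s [s0 st sw]] := dwell_signals_first_switch tau0 ds.
  have ds' := dwell_signals_shift s0 ds.
  have cS := coefs _ ds; have [cA cB cC] := cS.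
  have sa := le_trans st ta; have sb := le_trans sa ab; have bs0 : 0 <= b - s by rewrite subr_ge0.
  have xP := lin_solution_restart (flow_mul_solution K0 cA v (lexx 0)) s0.
  have e := tail_energy K0 (coefs _ ds') cS s0 bs0 (fun r _ => erefl _) xP.
  rewrite addrCA subrr addr0 in e.
  apply: (@le_trans _ _ (int s b (fun t => sqn (y sigma v t)))).
    rewrite (Rintegral_chasles sa ab (y_integrable _ ds s0 sb)) lerDr.
    by apply: Rintegral_ge0 => ? _; exact: sqn_ge0.
  rewrite e -mulrA.
  apply: (@le_trans _ _ (G * sqn (flow (A sigma) s 0 *m v))).
    have := HG _ (conj ds' sw) (b - s) (flow (A sigma) s 0 *m v) bs0.
    by under eq_Rintegral do rewrite -mulmxA.
  apply: ler_wpM2l => //.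
  have fr := @free_response R n m p K (tau + 1) K0 sigma 0 cS (lexx 0) s v.
  apply: fr.
  by rewrite s0 add0r; lra.
have obs_window sigma v t : dwell_signals tau N sigma -> 0 <= t ->
    gam * sqn (flow (A sigma) t 0 *m v) <= int t (t + T0) (fun s => sqn (y sigma v s)).
  move=> ds t0; have cS := coefs _ ds; have [cA cB cC] := cS.
  have := obs _ ds t t0 (flow (A sigma) t 0 *m v).
  rewrite (gramian_quadratic _ K0 cS t0 (ltW T00)) => h.
  have -> : int t (t + T0) (fun s => sqn (y sigma v s)) =
    int t (t + T0) (fun s => sqn (mxC (sigma s) *m (flow (A sigma) s t *m (flow (A sigma) t 0 *m v)))).
    apply: eq_Rintegral => s /set_mem; rewrite /= in_itv/= => /andP[ts _].
    by rewrite /y (flow_cocycle K0 cA (lexx 0) t0 ts) !mulmxA.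
  apply: le_trans h; rewrite mul_mx_scalar -scalemxAl mxE ler_wpM2l ?(ltW gam0)//.
  by rewrite [leRHS]mxE /sqn; apply: ler_sum => i _; rewrite [X in _ <= X * _]mxE expr2.
(* Observability at t bounds the squared state there by 1/gam times the output energy after t, which
   for t >= tau is at most G' times the squared initial state. *)
pose kap := G' / gam.
have kap0 : 0 <= kap by rewrite divr_ge0// ltW.
have state_le sigma v t : dwell_signals tau N sigma -> tau <= t ->
    sqn (flow (A sigma) t 0 *m v) <= kap * sqn v.
  move=> ds tt; have t0 := le_trans tau0 tt.
  rewrite /kap mulrAC ler_pdivlMr// mulrC; apply: le_trans (obs_window _ _ _ ds t0) _.
  by apply: HG' => //; rewrite lerDl ltW.
have state_le2 sigma v s t : dwell_signals tau N sigma -> 0 <= s -> s + tau <= t ->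
    sqn (flow (A sigma) t 0 *m v) <= kap * sqn (flow (A sigma) s 0 *m v).
  move=> ds s0 st; have [cA cB cC] := coefs _ ds.
  have ds' := dwell_signals_shift s0 ds; have [cA' _ _] := coefs _ ds'.
  have st' : s <= t by apply: le_trans st; rewrite lerDl.
  have ts0 : 0 <= t - s by rewrite subr_ge0.
  rewrite (flow_cocycle K0 cA (lexx 0) s0 st') -mulmxA.
  have := flow_shift K0 cA cA' s0 (lexx 0) ts0; rewrite add0r subrK => <-.
  by apply: (state_le (fun r => sigma (r + s)) _ _ ds'); rewrite lerBrDl.
(* Enough windows to make the squared final state at most 1/4 of the squared initial one, i.e., the
   factor 1/2 for the norm. *)
pose q := (Num.trunc (4 * kap * G' / gam)).+1.
have q0 : 0 < q%:R :> R by rewrite ltr0n.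
have qb : 4 * kap * G' <= q%:R * gam.
  by rewrite -ler_pdivrMr//; apply: ltW; exact: truncnS_gt.
(* One [tau] is the wait before the energy bound applies; the other keeps the start of every window
   at least [tau] before the final time, as the comparison of states requires. *)
pose T := 2 * tau + q%:R * T0.
exists T; split; first by rewrite /T ltr_wpDl ?mulr_ge0// mulr_gt0.
move=> B dB v.
(* [contracting] speaks of matrix signals. Such a signal is lifted to triples by choosing one triple
   for each matrix, which adds no switching time. The default value is harmless: for t >= 0 the
   signal takes values in the image of [N]. *)
have [h hP] : exists h : 'M[R]_n -> system R n m p, forall X, [set mxA S | S in N] X ->
    N (h X) /\ mxA (h X) = X.
  have /choice[h hP] : forall X, exists S, [set mxA S | S in N] X -> N S /\ mxA S = X.
    move=> X; have [[S NS SX]|nX] := pselect ([set mxA S | S in N] X).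
      by exists S.
    by exists (0, 0, 0).
  by exists h.
have ds : dwell_signals tau N (h \o B).
  by apply: dwell_signals_comp dB => [|X /hP[]//]; exact: norm_hausdorff.
set sigma := h \o B in ds.
have [cA cB cC] := coefs _ ds.
have BA t : 0 <= t -> A sigma t = B t.
  move=> t0; have [_ vB _] := dB; have := vB t; rewrite /time/= in_itv/= t0.
  by move=> /(_ isT)/hP[].
have T0' : 0 <= T by rewrite /T addr_ge0 ?mulr_ge0// ltW.
have cBc : bounded_coef K B.
  apply: (@dwell_signals_bounded_coef R _ n n tau _ id _ K) dB; first exact: norm_hausdorff.
  by move=> _ [S /NK[? _ _] <-].
have -> : flow B T 0 *m v = flow (A sigma) T 0 *m v.
  apply: (lin_solution_local K0 cBc (lexx 0) T0' _ _
    (flow_mul_solution K0 cBc v (lexx 0)) (flow_mul_solution K0 cA v (lexx 0))) => //.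
  by move=> s /andP[s0 _]; rewrite -BA.
rewrite enorm_le//.
set E := sqn (flow (A sigma) T 0 *m v).
have key j : (j <= q)%N -> j%:R * (gam * E) <=
    kap * int tau (tau + j%:R * T0) (fun s => sqn (y sigma v s)).
  elim: j => [_|j IH jq].
    by rewrite !mul0r addr0 set_itv1 Rintegral_set1 mulr0.
  have {}IH := IH (ltnW jq).
  have jT : 0 <= j%:R * T0 by rewrite mulr_ge0// ltW.
  have a1 : tau <= tau + j%:R * T0 by rewrite lerDl.
  have a0 := le_trans tau0 a1.
  have e : tau + j.+1%:R * T0 = tau + j%:R * T0 + T0 by rewrite -natr1 mulrDl mul1r addrA.
  have a2 : tau + j%:R * T0 <= tau + j%:R * T0 + T0 by rewrite lerDl ltW.
  rewrite e (Rintegral_chasles a1 a2 (y_integrable _ ds tau0 (le_trans a1 a2))).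
  have w := obs_window sigma v _ ds a0.
  have jqT : j%:R * T0 <= q%:R * T0.
    by rewrite ler_pM2r// ler_nat ltnW.
  have aT : tau + j%:R * T0 + tau <= T.
    have -> : T = tau + q%:R * T0 + tau by rewrite /T; ring.
    by rewrite lerD2r lerD2l.
  have s2 := state_le2 sigma v _ _ ds a0 aT; rewrite -/E in s2.
  have h1 : gam * E <= kap * int (tau + j%:R * T0) (tau + j%:R * T0 + T0) (fun s => sqn (y sigma v s)).
    apply: (@le_trans _ _ (kap * (gam * sqn (flow (A sigma) (tau + j%:R * T0) 0 *m v)))).
      by rewrite mulrCA ler_wpM2l// ltW.
    by apply: ler_wpM2l.
  by rewrite -natr1 mulrDl mul1r mulrDr lerD.
have qT : tau <= tau + q%:R * T0 by rewrite lerDl mulr_ge0// ltW.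
have h1 := HG' sigma v _ _ ds (lexx _) qT.
have h2 := le_trans (key q (leqnn q)) (ler_wpM2l kap0 h1).
have qg : 0 < q%:R * gam by rewrite mulr_gt0.
have E0 : E * (q%:R * gam) <= (4^-1 * sqn v) * (q%:R * gam).
  apply: (@le_trans _ _ (kap * (G' * sqn v))).
    by apply: le_trans h2; rewrite mulrC mulrA.
  have -> : kap * (G' * sqn v) = 4^-1 * sqn v * (4 * kap * G') by field.
  by rewrite ler_wpM2l// mulr_ge0 ?sqn_ge0.
rewrite ler_pM2r// in E0; apply: le_trans E0 _.
by rewrite exprVn -natrX.
Qed.

End class.
End observability.

Theorem theorem27 (R : realType) (n m p : nat)
    (n_gt0 : (0 < n)%N) (m_gt0 : (0 < m)%N) (p_gt0 : (0 < p)%N)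
    (M : set (system R n m p)) (M_bounded : bounded_set M)
    (n' : nat) (Mmin : set (system R n' m p))
    (Mmin_realization : minimal_realization M Mmin) :
  (forall tau : R, 0 <= tau ->
     uniformly_observable (dwell_signals tau Mmin) ->
     ((L2_gain (dwell_signals tau M) < +oo)%E <->
      (rho (dwell_signals tau [set mxA S | S in Mmin]) < 1)%E))
  /\
  ((forall tau : R, 0 < tau ->
      uniformly_observable (dwell_signals tau Mmin)) ->
   ereal_inf [set tau%:E | tau in
     [set tau : R | 0 < tau /\ (L2_gain (dwell_signals tau M) < +oo)%E]] =
   ereal_inf [set tau%:E | tau in
     [set tau : R | 0 < tau /\
        (rho (dwell_signals tau [set mxA S | S in Mmin]) < 1)%E]]).
Proof.
have gain_rho (tau : R) : 0 <= tau ->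
    uniformly_observable (dwell_signals tau Mmin) ->
    (L2_gain (dwell_signals tau M) < +oo)%E <->
    (rho (dwell_signals tau [set mxA S | S in Mmin]) < 1)%E.
  move=> tau0 obs; rewrite (L2_gain_realization tau M_bounded Mmin_realization).
  have [r [E [L [f [g [K [MminE _ _ [K0 bound] controllable]]]]]]] :=
    realization_maps M_bounded Mmin_realization.
  have MminK S : Mmin S -> system_bound K S.
    by rewrite MminE => -[_ [S' MS' <-] <-]; have [] := bound _ MS'.
  split=> [/L2_gain_finite[c _ gain]|rho1].
    have [G [G0 HG]] := output_energy_uniform K0 tau0 MminK gain controllable.
    apply: (contracting_rho_lt1 K0) => [A|A c0 c0_ge0|].
    - apply: (@dwell_signals_bounded_coef R _ n' n' tau _ id A K).
        exact: norm_hausdorff.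
      by move=> _ [S /MminK[? _ _] <-].
    - exact: dwell_signals_shift.
    - exact: (observable_contracting K0 tau0 MminK G0 HG obs).
  exact: contracting_L2_gain K0 MminK (rho_lt1_contracting rho1).
(* The equivalence holds at every tau > 0, so the two sets of dwell times are equal. The infima are
   extended-valued, and the case of empty sets is included. *)
split=> // obs; congr (ereal_inf (_ @` _)); apply/seteqP.
by split=> tau [tau0] h; split=> //; apply/(gain_rho _ (ltW tau0) (obs _ tau0)).
Qed.
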